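(* Let $G$ be a locally compact group with a continuous $2$-cocycle $c : G\times G\to\mathbb{T}$, and let $G_c$ be the associated Mackey group. (i) If $L^1(G_c)$ is $C^*$-unique, then $L^1(G,c)$ is $C^*$-unique. (ii) If $L^1(G_c)$ is symmetric and $C^*$-unique, and $\pi : L^1(G,c)\to \mathbb{B}(\mathcal{H})$ is a faithful $*$-representation on a Hilbert space $\mathcal{H}$, then $f\mapsto \Vert \pi(f)\Vert_{\mathbb{B}(\mathcal{H})}$, $f\in L^1(G,c)$, is the full (i.e. maximal) $C^*$-norm on $L^1(G,c)$, and $\sigma_{L^1(G,c)}(f)=\sigma_{\mathbb{B}(\mathcal{H})}(\pi(f))$ for all $f\in L^1(G,c)$.
   Context: A continuous $2$-cocycle for a locally compact group $G$ with unit $e$ is a continuous map $c:G\times G\to\mathbb{T}$ (the unit circle in $\mathbb{C}$) with $c(x_1,x_2)c(x_1x_2,x_3)=c(x_1,x_2x_3)c(x_2,x_3)$ and $c(x,e)=c(e,x)=1$ for all $x,x_1,x_2,x_3\in G$. Twisted convolution algebra: $L^1(G,c)$ is the Banach $*$-algebra $L^1(G)$ (with respect to a left Haar measure, with modular function $m$) with the usual norm $\Vert\cdot\Vert_1$, product $(f_1\natural_c f_2)(x)=\int_G f_1(y)f_2(y^{-1}x)c(y,y^{-1}x)\,dy$ and involution $f^{*_c}(x)=m(x^{-1})\overline{c(x,x^{-1})f(x^{-1})}$. Mackey group: $G_c$ is $G\times\mathbb{T}$ with the product topology and group law $(x_1,\tau_1)(x_2,\tau_2)=(x_1x_2,\tau_1\tau_2\overline{c(x_1,x_2)})$.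 It is a locally compact group with Haar measure the product of the Haar measure on $G$ and the normalized Haar measure on $\mathbb{T}$. $L^1(G_c)$ is its usual (untwisted) convolution $*$-algebra. $\sigma_{\mathcal{A}}(a)$ denotes the spectrum of $a$ in the algebra $\mathcal{A}$; if $\mathcal{A}$ is nonunital, it is taken in the minimal unitization. A Banach $*$-algebra $\mathcal{A}$ is symmetric if $\sigma_{\mathcal{A}}(a^*a)\subseteq[0,\infty)$ for all $a\in\mathcal{A}$. A Banach $*$-algebra $\mathcal{A}$ admitting a faithful $*$-representation on a Hilbert space is $C^*$-unique if the maximal $C^*$-norm $\Vert a\Vert_*=\sup\{\Vert\pi(a)\Vert : \pi \text{ a } *\text{-representation of } \mathcal{A} \text{ as bounded operators on a Hilbert space}\}$ is the unique $C^*$-norm on $\mathcal{A}$. Faithful means injective. Convention: if $L^1(G,c)$ is unital, it is always implied that $\pi(1_{L^1(G,c)})=\mathrm{Id}_{\mathcal{H}}$. *)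

(* Defs.v *)
From HB Require Import structures.
From mathcomp Require Import all_boot all_order all_algebra.
From mathcomp Require Import all_classical all_reals all_analysis.
From mathcomp Require Import complex.

Set Implicit Arguments.
Unset Strict Implicit.
Unset Printing Implicit Defensive.

Import Order.TTheory GRing.Theory Num.Theory.
Import numFieldNormedType.Exports.

Local Open Scope quotient_scope.
Local Open Scope classical_set_scope.
Local Open Scope ring_scope.

HB.instance Definition _ (R : realType) := NormedModule.copy R[i] R[i]^o.

Definition cabs (R : realType) (z : R[i]) : R := complex.Re `|z|.

HB.mixin Record isTopologicalGroup G of PointedTopological G & Group G := {
  mulg_continuous : continuous (fun p : G * G => (p.1 * p.2)%g);
  invg_continuous : continuous (fun x : G => (x^-1)%g) }.

#[short(type="topologicalGroupType")]
HB.structure Definition TopologicalGroup :=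
  {G of PointedTopological G & Group G & isTopologicalGroup G}.

Lemma conjC_continuous (K : numClosedFieldType) :
  continuous (fun z : K => z^*).
Proof.
move=> z; apply/(@cvgrPdist_lt K K^o _ (nbhs z) (nbhs_filter z)) => e e0.
near=> w.
by rewrite -rmorphB norm_conjC; near: w; apply: cvgr_dist_lt.
Unshelve. all: by end_near. Qed.

Record circle (R : realType) := Circle {
  circle_val :> R[i];
  circle_valP : `|circle_val| == 1 }.

Section circle.
Variable R : realType.
Local Notation T := (circle R).

HB.instance Definition _ := [isSub for @circle_val R].
HB.instance Definition _ := [Choice of T by <:].

Fact circle1_subproof : `|1 : R[i]| == 1. Proof. by rewrite normr1. Qed.
Definition circle1 : T := Circle circle1_subproof.

Fact circleM_subproof (x y : T) : `|(x : R[i]) * y| == 1.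
Proof. by rewrite normrM (eqP (circle_valP x)) (eqP (circle_valP y)) mulr1. Qed.
Definition circleM (x y : T) : T := Circle (circleM_subproof x y).

Fact circleV_subproof (x : T) : `|(x : R[i])^*| == 1.
Proof. by rewrite norm_conjC circle_valP. Qed.
Definition circleV (x : T) : T := Circle (circleV_subproof x).

Lemma circleVM (x : T) : (x : R[i])^* * x = 1.
Proof. by rewrite mulrC -normCK (eqP (circle_valP x)) expr1n. Qed.

Fact circle_mulA : associative circleM.
Proof. by move=> x y z; apply/val_inj; rewrite /= mulrA. Qed.
Fact circle_mul1 : left_id circle1 circleM.
Proof. by move=> x; apply/val_inj; rewrite /= mul1r. Qed.
Fact circle_mulr1 : right_id circle1 circleM.
Proof. by move=> x; apply/val_inj; rewrite /= mulr1. Qed.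
Fact circle_mulV : left_inverse circle1 circleV circleM.
Proof. by move=> x; apply/val_inj; rewrite /= circleVM. Qed.
Fact circle_mulrV : right_inverse circle1 circleV circleM.
Proof. by move=> x; apply/val_inj; rewrite /= mulrC circleVM. Qed.

HB.instance Definition _ := isGroup.Build T
  circle_mulA circle_mul1 circle_mulr1 circle_mulV circle_mulrV.
HB.instance Definition _ := isPointed.Build T circle1.
HB.instance Definition _ :=
  PointedTopological.copy T (initial_topology (@circle_val R)).

Lemma circle_val_continuous : continuous (@circle_val R : T -> R[i]).
Proof. exact: initial_continuous. Qed.

Lemma continuous_to_circle (X : topologicalType) (f : X -> T) :
  continuous (fun x => (f x : R[i])) -> continuous f.
Proof.
move=> cf; apply/continuousP => A [B oB <-].
exact: ((continuousP _).1 cf B oB).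
Qed.

Fact circle_mul_continuous : continuous (fun p : T * T => (p.1 * p.2)%g).
Proof.
apply: continuous_to_circle => p /=.
apply: (@continuousM R[i] (T * T)%type (fun p => circle_val p.1)
  (fun p => circle_val p.2)).
- apply: (@continuous_comp _ _ _ fst (@circle_val R)); first exact: cvg_fst.
  exact: circle_val_continuous.
- apply: (@continuous_comp _ _ _ snd (@circle_val R)); first exact: cvg_snd.
  exact: circle_val_continuous.
Qed.

Fact circle_inv_continuous : continuous (fun x : T => (x^-1)%g).
Proof.
apply: continuous_to_circle => x /=.
apply: (@continuous_comp _ _ _ (@circle_val R) (fun z : R[i] => z^*)).
- exact: circle_val_continuous.
- exact: conjC_continuous.
Qed.

HB.instance Definition _ := isTopologicalGroup.Build T
  circle_mul_continuous circle_inv_continuous.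

End circle.

Record cocycle (R : realType) (G : topologicalGroupType) := Cocycle {
  cocycle_fun :> G -> G -> circle R;
  cocycle_continuous : continuous (fun p : G * G => cocycle_fun p.1 p.2);
  cocycle_eq : forall x1 x2 x3,
    (cocycle_fun x1 x2 * cocycle_fun (x1 * x2) x3 =
     cocycle_fun x1 (x2 * x3) * cocycle_fun x2 x3)%g;
  cocyclex1 : forall x, cocycle_fun x 1%g = 1%g;
  cocycle1x : forall x, cocycle_fun 1%g x = 1%g }.

Program Definition trivial_cocycle (R : realType) (G : topologicalGroupType) :
  cocycle R G := @Cocycle R G (fun _ _ => 1%g) _ _ _ _.
Next Obligation. by move=> R G; exact: cst_continuous. Qed.
Next Obligation. by []. Qed.
Next Obligation. by []. Qed.
Next Obligation. by []. Qed.

Definition mackey (R : realType) (G : topologicalGroupType) (c : cocycle R G) :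
  Type := (G * circle R)%type.

Section mackey.
Variables (R : realType) (G : topologicalGroupType) (c : cocycle R G).
Local Notation M := (mackey c).

HB.instance Definition _ := Topological.copy M (G * circle R)%type.

Lemma circle_mulgC (s t : circle R) : (s * t = t * s)%g.
Proof. by apply/val_inj; rewrite /= mulrC. Qed.

Definition mackey_one : M := (1%g, 1%g).
HB.instance Definition _ := isPointed.Build M mackey_one.

Definition mackey_mul (p q : M) : M :=
  ((p.1 * q.1)%g, (p.2 * q.2 * (c p.1 q.1)^-1)%g).
Definition mackey_inv (p : M) : M := ((p.1)^-1%g, ((p.2)^-1 * c p.1 (p.1)^-1)%g).

Lemma cocycleV (x : G) : c x x^-1%g = c x^-1%g x.
Proof.
have := cocycle_eq c x x^-1%g x.
by rewrite mulgV mulVg cocycle1x cocyclex1 mulg1 mul1g.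
Qed.

Fact mackey_mulA : associative mackey_mul.
Proof.
move=> [x r] [y s] [z t]; rewrite /mackey_mul /=; congr pair.
  by rewrite mulgA.
transitivity (r * s * t * (c x (y * z)%g * c y z)^-1)%g.
  by rewrite invgM !mulgA.
by rewrite -cocycle_eq (circle_mulgC (c x y)) invgM !mulgA -(mulgA (r * s)%g)
  (circle_mulgC t) !mulgA.
Qed.
Fact mackey_mul1 : left_id mackey_one mackey_mul.
Proof.
by move=> [x r]; rewrite /mackey_mul /= cocycle1x invg1 mulg1 !mul1g.
Qed.
Fact mackey_mulr1 : right_id mackey_one mackey_mul.
Proof.
by move=> [x r]; rewrite /mackey_mul /= cocyclex1 invg1 !mulg1.
Qed.
Fact mackey_mulV : left_inverse mackey_one mackey_inv mackey_mul.
Proof.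
move=> [x r]; rewrite /mackey_mul /mackey_inv /mackey_one /= mulVg.
by rewrite -cocycleV (circle_mulgC r^-1%g) mulgVK mulgV.
Qed.
Fact mackey_mulrV : right_inverse mackey_one mackey_inv mackey_mul.
Proof.
move=> [x r]; rewrite /mackey_mul /mackey_inv /mackey_one /= mulgV.
by rewrite mulgA mulgV mul1g mulgV.
Qed.

HB.instance Definition _ := isGroup.Build M
  mackey_mulA mackey_mul1 mackey_mulr1 mackey_mulV mackey_mulrV.


Let continuous_fst1 (X Y Z : topologicalType) (f : X -> Z) :
  continuous f -> continuous (fun p : X * Y => f p.1).
Proof.
by move=> cf p; apply: (@continuous_comp _ _ _ fst f); [exact: cvg_fst|exact: cf].
Qed.

Let continuous_snd1 (X Y Z : topologicalType) (f : Y -> Z) :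
  continuous f -> continuous (fun p : X * Y => f p.2).
Proof.
by move=> cf p; apply: (@continuous_comp _ _ _ snd f); [exact: cvg_snd|exact: cf].
Qed.

Let continuous_pair (X Y Z : topologicalType) (f : X -> Y) (g : X -> Z) :
  continuous f -> continuous g -> continuous (fun x => (f x, g x)).
Proof. by move=> cf cg x; apply: cvg_pair; [exact: cf|exact: cg]. Qed.

Let continuous_comp2 (X Y Z W : topologicalType) (h : Y -> Z -> W)
    (f : X -> Y) (g : X -> Z) :
  continuous (fun p : Y * Z => h p.1 p.2) -> continuous f -> continuous g ->
  continuous (fun x => h (f x) (g x)).
Proof.
move=> ch cf cg x.
apply: (@continuous_comp _ _ _ (fun x => (f x, g x)) (fun p => h p.1 p.2)).
- exact: continuous_pair.
- exact: ch.
Qed.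

Let continuous_mulg (X : topologicalType) (H : topologicalGroupType)
    (f g : X -> H) :
  continuous f -> continuous g -> continuous (fun x => (f x * g x)%g).
Proof. exact: (continuous_comp2 (@mulg_continuous H)). Qed.

Let continuous_invg (X : topologicalType) (H : topologicalGroupType)
    (f : X -> H) : continuous f -> continuous (fun x => (f x)^-1%g).
Proof.
move=> cf x; apply: (@continuous_comp _ _ _ f (fun y : H => y^-1%g)).
- exact: cf.
- exact: invg_continuous.
Qed.

Let cid (X : topologicalType) : continuous (fun x : X => x).
Proof. by move=> x; exact: cvg_id. Qed.

Fact mackey_mul_continuous : continuous (fun p : M * M => (p.1 * p.2)%g).
Proof.
have c11 : continuous (fun p : M * M => p.1.1).
  exact: (continuous_fst1 (continuous_fst1 (@cid G))).
have c12 : continuous (fun p : M * M => p.1.2).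
  exact: (continuous_fst1 (continuous_snd1 (@cid (circle R)))).
have c21 : continuous (fun p : M * M => p.2.1).
  exact: (continuous_snd1 (continuous_fst1 (@cid G))).
have c22 : continuous (fun p : M * M => p.2.2).
  exact: (continuous_snd1 (continuous_snd1 (@cid (circle R)))).
apply: (@continuous_pair (M * M)%type G (circle R)).
- exact: continuous_mulg.
- apply: continuous_mulg; first exact: continuous_mulg.
  apply: continuous_invg.
  by apply: continuous_comp2 => //; exact: cocycle_continuous.
Qed.

Fact mackey_inv_continuous : continuous (fun p : M => (p^-1)%g).
Proof.
have c1 : continuous (fun p : M => p.1).
  exact: (continuous_fst1 (@cid G)).
have c2 : continuous (fun p : M => p.2).
  exact: (continuous_snd1 (@cid (circle R))).
apply: (@continuous_pair M G (circle R)); first exact: continuous_invg.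
apply: continuous_mulg; first exact: continuous_invg.
apply: continuous_comp2 => //; first exact: cocycle_continuous.
exact: continuous_invg.
Qed.

HB.instance Definition _ := isTopologicalGroup.Build M
  mackey_mul_continuous mackey_inv_continuous.

End mackey.

Section L1.
Context d (X : measurableType d) (R : realType).
Variable mu : {measure set X -> \bar R}.
Implicit Types f g : X -> R[i].

Definition cintegrable f : Prop :=
  mu.-integrable [set: X] (fun x => (complex.Re (f x))%:E) /\
  mu.-integrable [set: X] (fun x => (complex.Im (f x))%:E).

Definition cintegral f : R[i] :=
  Complex (\int[mu]_(x in [set: X]) complex.Re (f x))
          (\int[mu]_(x in [set: X]) complex.Im (f x)).

Definition cintegrable_pred : {pred X -> R[i]} := fun f => `[< cintegrable f >].

Fact cintegrable_submod_closed : submod_closed cintegrable_pred.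
Proof.
split=> [|z f g /asboolP[fR fI] /asboolP[gR gI]]; apply/asboolP.
  by split; exact: integrable0.
have lin (a b : R) (u v w : X -> R) :
    mu.-integrable setT (EFin \o u) -> mu.-integrable setT (EFin \o v) ->
    mu.-integrable setT (EFin \o w) ->
    mu.-integrable setT (fun x => (a * u x + b * v x + w x)%:E).
  move=> iu iv iw.
  apply: (eq_integrable measurableT _
    (((fun x => (a * u x)%:E) \+ (fun x => (b * v x)%:E)) \+ (EFin \o w))%E).
    by [].
  apply: integrableD => //; apply: integrableD => //.
  - exact: (integrableZl measurableT a iu).
  - exact: (integrableZl measurableT b iv).
split.
- apply: (eq_integrable measurableT _ _ _
    (lin (complex.Re z) (- complex.Im z) _ _ _ fR fI gR)) => x _.
  rewrite -[(z *: f + g) x]/(z * f x + g x) mulNr.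
  by case: z (f x) (g x) => [a b] [p q] [r s].
- apply: (eq_integrable measurableT _ _ _
    (lin (complex.Re z) (complex.Im z) _ _ _ fI fR gI)) => x _.
  rewrite -[(z *: f + g) x]/(z * f x + g x).
  by case: z (f x) (g x) => [a b] [p q] [r s].
Qed.

HB.instance Definition _ := GRing.isSubmodClosed.Build R[i] (X -> R[i])
  cintegrable_pred cintegrable_submod_closed.

Record L1fun := L1Fun {
  L1fun_val :> X -> R[i];
  L1fun_valP : L1fun_val \in cintegrable_pred }.

HB.instance Definition _ := [isSub for L1fun_val].
HB.instance Definition _ := [Choice of L1fun by <:].
HB.instance Definition _ := [SubChoice_isSubLmodule of L1fun by <:].

Definition L1eq (f g : L1fun) : bool := `[< {ae mu, forall x, f x = g x} >].

Fact L1eq_refl : reflexive L1eq.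
Proof. by move=> f; apply/asboolP; exact: aeW. Qed.

Fact L1eq_sym : symmetric L1eq.
Proof.
by move=> f g; apply/idP/idP => /asboolP h; apply/asboolP;
  apply: filterS h => x ->.
Qed.

Fact L1eq_trans : transitive L1eq.
Proof.
move=> g f h /asboolP fg /asboolP gh; apply/asboolP.
by apply: filterS2 fg gh => x -> ->.
Qed.

Canonical L1eq_equiv := EquivRel L1eq L1eq_refl L1eq_sym L1eq_trans.

Definition L1 : Type := {eq_quot L1eq}.
HB.instance Definition _ := Choice.on L1.
HB.instance Definition _ := EqQuotient.on L1.

Definition L1rep (u : L1) : X -> R[i] := (repr u : L1fun).
Coercion L1rep : L1 >-> Funclass.

Lemma L1eqP (f g : L1fun) :
  {ae mu, forall x, f x = g x} <-> \pi_L1 f = \pi_L1 g.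
Proof. by split=> [h|/eqmodP/asboolP//]; apply/eqmodP/asboolP. Qed.

Lemma L1rep_pi (f : L1fun) : {ae mu, forall x, L1rep (\pi_L1 f) x = f x}.
Proof. by apply/L1eqP; rewrite reprK. Qed.

Definition L1_zero : L1 := \pi_L1 0.
Definition L1_opp (u : L1) : L1 := \pi_L1 (- repr u).
Definition L1_add (u v : L1) : L1 := \pi_L1 (repr u + repr v).
Definition L1_scale (z : R[i]) (u : L1) : L1 := \pi_L1 (z *: repr u).

Lemma L1_addE (f g : L1fun) : L1_add (\pi_L1 f) (\pi_L1 g) = \pi_L1 (f + g).
Proof.
apply/L1eqP; apply: filterS2 (L1rep_pi f) (L1rep_pi g) => x hf hg.
by rewrite /= !fctE; congr (_ + _).
Qed.

Lemma L1_oppE (f : L1fun) : L1_opp (\pi_L1 f) = \pi_L1 (- f).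
Proof.
apply/L1eqP; apply: filterS (L1rep_pi f) => x hf.
by rewrite /= !fctE; congr (- _).
Qed.

Lemma L1_scaleE z (f : L1fun) : L1_scale z (\pi_L1 f) = \pi_L1 (z *: f).
Proof.
apply/L1eqP; apply: filterS (L1rep_pi f) => x hf.
by rewrite /= !fctE; congr (_ * _).
Qed.

Fact L1_addA : associative L1_add.
Proof.
elim/quotW=> f; elim/quotW=> g; elim/quotW=> h.
by rewrite (L1_addE g h) (L1_addE f g) (L1_addE f) (L1_addE _ h) addrA.
Qed.
Fact L1_addC : commutative L1_add.
Proof. by elim/quotW=> f; elim/quotW=> g;
  rewrite (L1_addE f g) (L1_addE g f) addrC. Qed.
Fact L1_add0 : left_id L1_zero L1_add.
Proof. by elim/quotW=> f; rewrite L1_addE add0r. Qed.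
Fact L1_addN : left_inverse L1_zero L1_opp L1_add.
Proof. by elim/quotW=> f; rewrite L1_oppE L1_addE addNr. Qed.

HB.instance Definition _ :=
  GRing.isZmodule.Build L1 L1_addA L1_addC L1_add0 L1_addN.

Fact L1_scaleA a b u : L1_scale a (L1_scale b u) = L1_scale (a * b) u.
Proof. by elim/quotW: u => f; 
  rewrite (L1_scaleE b f) (L1_scaleE a) (L1_scaleE _ f) scalerA. Qed.
Fact L1_scale1 : left_id 1 L1_scale.
Proof. by elim/quotW=> f; rewrite L1_scaleE scale1r. Qed.
Fact L1_scaleDr : right_distributive L1_scale +%R.
Proof.
by move=> a; elim/quotW=> f; elim/quotW=> g;
  rewrite [_ + _](L1_addE f g) (L1_scaleE a f) (L1_scaleE a g)
  (L1_scaleE a) [RHS]L1_addE scalerDr.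
Qed.
Fact L1_scaleDl u : {morph L1_scale^~ u : a b / a + b}.
Proof.
move=> a b; elim/quotW: u => f.
by rewrite /= !(L1_scaleE _ f) [RHS]L1_addE scalerDl.
Qed.

HB.instance Definition _ := GRing.Zmodule_isLmodule.Build R[i] L1
  L1_scaleA L1_scale1 L1_scaleDr L1_scaleDl.

(** The class in [L1] of a function that agrees a.e. with an integrable one;
    the default value [0] is for the other functions. *)
Definition toL1 f : L1 := xget 0 [set u : L1 | {ae mu, forall x, u x = f x}].

End L1.
Arguments L1 {d X R} mu.

Notation borel T := (g_sigma_algebraType (@open T)).

(** Radon in the sense: outer regular on Borel sets, inner regular on open sets.
    [K] below is Borel as soon as [G] is Hausdorff. *)
Record left_haar (R : realType) (G : topologicalGroupType)
    (mu : {measure set (borel G) -> \bar R}) : Prop := LeftHaar {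
  left_haar_neq0 : mu [set: G] <> 0%E;
  left_haar_invariant : forall (x : G) (A : set (borel G)), measurable A ->
    mu [set (x * y)%g | y in (A : set G)] = mu A;
  left_haar_compact : forall K : set G, compact K -> (mu K < +oo)%E;
  left_haar_outer : forall A : set (borel G), measurable A ->
    mu A = ereal_inf [set mu U | U in [set U : set G | open U /\ A `<=` U]];
  left_haar_inner : forall U : set G, open U ->
    mu U = ereal_sup [set mu K | K in [set K : set G | compact K /\ K `<=` U]] }.

(** Convention: [mu (A x) = m x * mu A], so that [dx^-1 = m x^-1 dx]. *)
Definition modular_function (R : realType) (G : topologicalGroupType)
    (mu : {measure set (borel G) -> \bar R}) (m : G -> R) : Prop :=
  forall x : G, 0 < m x /\
    forall A : set (borel G), measurable A ->
      mu [set (y * x)%g | y in (A : set G)] = ((m x)%:E * mu A)%E.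

(** For a Haar measure [mu] that is not sigma-finite, the outer regular product
    and the abstract product measure may differ on rectangles with a side of
    infinite measure; rectangles of finite measure determine the former. *)
Definition mackey_haar (R : realType) (G : topologicalGroupType)
    (c : cocycle R G) (mu : {measure set (borel G) -> \bar R})
    (nu : {measure set (borel (mackey c)) -> \bar R}) : Prop :=
  left_haar nu /\
  exists lam : {measure set (borel (circle R)) -> \bar R},
    [/\ left_haar lam, lam [set: circle R] = 1%E &
      forall (A : set (borel G)) (B : set (borel (circle R))),
        measurable A -> measurable B -> (mu A < +oo)%E ->
        nu (A `*` B) = (mu A * lam B)%E].

(** Only the operations are recorded: the axioms of an associative *-algebra are
    theorems about the instances below. *)
Record starAlg (R : realType) := StarAlg {
  starAlg_sort :> lmodType R[i];
  amul : starAlg_sort -> starAlg_sort -> starAlg_sort;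
  astar : starAlg_sort -> starAlg_sort }.

Section spectrum.
Variables (R : realType) (A : lmodType R[i]) (mul : A -> A -> A).

Definition is_unity (e : A) : Prop := forall a, mul e a = a /\ mul a e = a.

Definition ainvertible (e a : A) : Prop :=
  exists b, mul a b = e /\ mul b a = e.

End spectrum.

(** [(a, s)] stands for [a + s 1], so that the unit is [(0, 1)]. *)
Definition unitization_mul (R : realType) (A : lmodType R[i])
    (mul : A -> A -> A) (p q : A * R[i]) : A * R[i] :=
  (mul p.1 q.1 + q.2 *: p.1 + p.2 *: q.1, p.2 * q.2).

Definition spectrum (R : realType) (A : lmodType R[i]) (mul : A -> A -> A)
    (a : A) : set R[i] :=
  [set z | (exists2 e, is_unity mul e & ~ ainvertible mul e (a - z *: e)) \/
           ((~ exists e, is_unity mul e) /\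
            ~ ainvertible (unitization_mul mul) (0, 1) (a, - z))].

Definition symmetric_alg (R : realType) (A : starAlg R) : Prop :=
  forall (a : A) (z : R[i]),
    spectrum (@amul R A) (amul (astar a) a) z -> 0 <= z.

(** The integrals exist for almost every [x] and define an integrable function,
    by Fubini's theorem, so that [toL1] does not use its default value. The usual
    algebra [L^1(G)] is obtained with [c := trivial_cocycle R G]. *)
Section twisted.
Variables (R : realType) (G : topologicalGroupType).
Variables (mu : {measure set (borel G) -> \bar R}) (m : G -> R).
Variable c : cocycle R G.

Definition tconv (f g : L1 mu) : L1 mu :=
  toL1 mu (fun x : G => cintegral mu (fun y : G =>
    f y * g (y^-1 * x)%g * circle_val (c y (y^-1 * x)%g))).

Definition tinvol (f : L1 mu) : L1 mu :=
  toL1 mu (fun x : G => (m x^-1%g)%:C%C * (circle_val (c x x^-1%g) * f x^-1%g)^*).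

Definition L1alg : starAlg R := StarAlg tconv tinvol.

End twisted.

HB.mixin Record isHilbert (R : realType) H of CompleteNormedModule R[i] H := {
  inner : H -> H -> R[i];
  inner_linear : forall (z : R[i]) (u v w : H),
    inner (z *: u + v) w = z * inner u w + inner v w;
  inner_conj : forall u v : H, inner v u = (inner u v)^*;
  inner_norm : forall u : H, inner u u = `|u| ^+ 2 }.

#[short(type="hilbertType")]
HB.structure Definition Hilbert (R : realType) :=
  {H of CompleteNormedModule R[i] H & isHilbert R H}.

Section bop.
Variables (R : realType) (H : hilbertType R).

Definition bop_pred : {pred H -> H} :=
  fun T => `[< linear T /\ continuous T >].

Fact bop_submod_closed : submod_closed bop_pred.
Proof.
split=> [|z S T /asboolP[lS cS] /asboolP[lT cT]]; apply/asboolP; split.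
- by move=> z u v; rewrite /= scaler0 addr0.
- exact: cst_continuous.
- move=> a u v; rewrite -!/(_ (z *: S + T) _).
  rewrite -[(z *: S + T) _]/(z *: S _ + T _) -[(z *: S + T) u]/(z *: S u + T u).
  rewrite -[(z *: S + T) v]/(z *: S v + T v) lS lT !scalerDr !scalerA.
  by rewrite (mulrC z a) addrACA.
- move=> u; apply: (@continuousD R[i] H H (z \*: S) T); last exact: cT.
  apply: (@continuous_comp _ _ _ S (fun v : H => z *: v)); first exact: cS.
  exact: scaler_continuous.
Qed.

HB.instance Definition _ := GRing.isSubmodClosed.Build R[i] (H -> H)
  bop_pred bop_submod_closed.

Record bop := Bop { bop_val :> H -> H; bop_valP : bop_val \in bop_pred }.

HB.instance Definition _ := [isSub for bop_val].
HB.instance Definition _ := [Choice of bop by <:].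
HB.instance Definition _ := [SubChoice_isSubLmodule of bop by <:].

Fact bop_comp_subproof (S T : bop) : S \o T \in bop_pred.
Proof.
have /asboolP[lS cS] := bop_valP S; have /asboolP[lT cT] := bop_valP T.
apply/asboolP; split=> [z u v|u]; first by rewrite /= lT lS.
by apply: continuous_comp; [exact: cT|exact: cS].
Qed.
Definition bop_comp (S T : bop) : bop := Bop (bop_comp_subproof S T).

Fact bop_id_subproof : idfun \in bop_pred.
Proof. by apply/asboolP; split=> [//|u]; exact: cvg_id. Qed.
Definition bop_id : bop := Bop bop_id_subproof.

Definition opnorm (T : bop) : R :=
  sup [set cabs `|T u| | u in [set u : H | `|u| <= 1]].

End bop.

(** [starRep_adj] says that the image of [astar a] is the adjoint of the image
    of [a]. Representations of unital algebras are unital. *)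
Record starRep (R : realType) (A : starAlg R) (H : hilbertType R) := StarRep {
  starRep_fun :> {linear A -> bop H};
  starRepM : forall a b : A,
    starRep_fun (amul a b) = bop_comp (starRep_fun a) (starRep_fun b);
  starRep_adj : forall (a : A) (u v : H),
    inner (starRep_fun (astar a) u) v = inner u (starRep_fun a v);
  starRep1 : forall e : A, is_unity (@amul R A) e -> starRep_fun e = bop_id H }.

Section cstar.
Variables (R : realType) (A : starAlg R).

Record cstar_norm (N : A -> R) : Prop := CstarNorm {
  cstar_normD : forall a b, N (a + b) <= N a + N b;
  cstar_normZ : forall (z : R[i]) a, N (z *: a) = cabs z * N a;
  cstar_norm0_eq0 : forall a, N a = 0 -> a = 0;
  cstar_normM : forall a b, N (amul a b) <= N a * N b;
  cstar_norm_star : forall a, N (amul (astar a) a) = N a ^+ 2 }.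

Definition max_norm (a : A) : R :=
  sup [set r | exists (H : hilbertType R) (pi : starRep A H), r = opnorm (pi a)].

Definition cstar_unique : Prop :=
  (exists (H : hilbertType R) (pi : starRep A H), injective pi) /\
  cstar_norm max_norm /\
  forall N : A -> R, cstar_norm N -> N = max_norm.

End cstar.

(* Main.v *)
Require Import Defs.
From HB Require Import structures.
From mathcomp Require Import all_boot all_order all_algebra.
From mathcomp Require Import all_classical all_reals all_analysis.
From mathcomp Require Import complex.
From mathcomp Require Import measurable_realfun ring lra.

Set Implicit Arguments.
Unset Strict Implicit.
Unset Printing Implicit Defensive.

Import Order.TTheory GRing.Theory Num.Theory.
Import numFieldNormedType.Exports.

Local Open Scope classical_set_scope.
Local Open Scope ring_scope.

(** The group algebra of the Mackey group [G_c] contains a copy of [L^1(G,c)]. The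
    functions [(x, t) |-> t f(x)] on [G_c] form a closed two-sided ideal, on which
    the convolution of [G_c] becomes the twisted convolution of [G], and taking a
    Fourier coefficient along the central circle is a *-homomorphism that projects
    [L^1(G_c)] onto this ideal. Write [j] for the embedding and [Q] for the
    projection. The whole theorem follows from formal consequences of
    [Q (j f) = f], [F * j g = j (Q F * g)] and [(j f)^* = j (f^* )], the results
    [L1_equivariantK], [amul_equivariant] and [astar_equivariant], together with
    the completeness of the [L^1] norm.

    Part (i): representations and C*-norms pass between the two algebras. A
    C*-norm [N] on the ideal is glued to the maximal C*-norm [M] of [L^1(G_c)] as
    [F |-> max (N (Q F)) (M (F - j (Q F)))], which is a C*-norm. By uniqueness it
    is [M], and its restriction to the ideal is [N]: see [cstar_unique_retract].
    That [L^1(G_c)] satisfies the axioms of a *-algebra is read off from its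
    faithful representation.

    Part (ii): a C*-norm on [L^1(G,c)] is given by [f |-> |pi f|], which is
    therefore the maximal one. The symmetry of [L^1(G_c)] passes to [L^1(G,c)] by
    applying [Q] to the inverses ([symmetric_retract]). On a symmetric Banach
    *-algebra the square root of the spectral radius of [a^* a] is a C*-norm
    (Ptak), because the spectral radius is submultiplicative on self-adjoint
    elements and sums of positive elements are positive. By uniqueness, this norm
    is [|pi a|], so that [|pi h|] is the spectral radius of [h] for self-adjoint
    [h] ([symmetric_spr_opnorm]). If [pi f - z] is invertible, it is bounded below
    with its adjoint; hence [1 - (f - z)^* (f - z) / C] is mapped to a strict
    contraction, its spectral radius is less than [1] as well, and [f - z] is
    invertible ([spectral_invariance]). Some care is needed in the unitization,
    where [pi] need not be faithful. The required Banach algebra theory consists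
    of Gelfand's formula for the spectral radius, proved by averaging resolvents
    over square roots of scalars, and of square roots by iteration.

    The measure theory is complicated by the fact that [G] need not be
    sigma-compact or second countable: Haar measure need not be sigma-finite, and
    the Borel sets of [G * G] need not be generated by rectangles, so that Fubini's
    theorem is not available for convolutions. The basic estimate is that the
    convolution of the indicators of two open sets [U] and [V] has integral at most
    [mu U mu V] ([integral_conv_section]). It follows from Tonelli's theorem on
    finite unions of rectangles, by inner regularity and the tube lemma. By outer
    regularity it yields the submultiplicativity of the [L^1] norm up to a constant
    ([convolution_bound]), and the invariance of null sets under inversion
    ([haar_inv_null]). On [G_c], by contrast, Fubini's theorem holds with respect
    to the projection to [G] ([fubini_mackey]): integrable functions live above a
    sigma-compact subset of [G], and the circle is second countable. *)

(** * Complex numbers *)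

Section complex_modulus.
Variable R : realType.
Implicit Types z w : R[i].

Lemma normr_cabs z : `|z| = (cabs z)%:C%C.
Proof. by rewrite /cabs normc_def. Qed.

Lemma cabs_sqrt z :
  cabs z = Num.sqrt (complex.Re z ^+ 2 + complex.Im z ^+ 2).
Proof. by rewrite /cabs normc_def. Qed.

Lemma cabs_ge0 z : 0 <= cabs z.
Proof. by rewrite cabs_sqrt sqrtr_ge0. Qed.

Lemma cabsM z w : cabs (z * w) = cabs z * cabs w.
Proof. by apply: complexI; rewrite rmorphM /= -!normr_cabs normrM. Qed.

Lemma cabsD z w : cabs (z + w) <= cabs z + cabs w.
Proof.
by rewrite -lecR rmorphD /= -!normr_cabs; exact: ler_normD.
Qed.

Lemma cabs0 : cabs (0 : R[i]) = 0.
Proof. by apply: complexI; rewrite -normr_cabs normr0. Qed.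

Lemma cabs1 : cabs (1 : R[i]) = 1.
Proof. by apply: complexI; rewrite -normr_cabs normr1. Qed.

Lemma cabs_eq0 z : (cabs z == 0) = (z == 0).
Proof. by rewrite -(normr_eq0 z) normr_cabs eq_complex /= eqxx andbT. Qed.

Lemma cabs_gt0 z : (0 < cabs z) = (z != 0).
Proof. by rewrite lt_neqAle cabs_ge0 andbT eq_sym cabs_eq0. Qed.

Lemma cabsN z : cabs (- z) = cabs z.
Proof. by apply: complexI; rewrite -!normr_cabs normrN. Qed.

Lemma cabs_conj z : cabs z^* = cabs z.
Proof. by apply: complexI; rewrite -!normr_cabs norm_conjC. Qed.

Lemma cabsV z : cabs z^-1 = (cabs z)^-1.
Proof.
have [->|z0] := eqVneq z 0; first by rewrite !(invr0, cabs0).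
have c0 : cabs z != 0 by rewrite cabs_eq0.
by apply: (mulfI c0); rewrite -cabsM !divff// cabs1.
Qed.

Lemma cabsX z n : cabs (z ^+ n) = cabs z ^+ n.
Proof. by elim: n => [|n ih]; rewrite ?expr0 ?cabs1// !exprS cabsM ih. Qed.

Lemma cabs_real (x : R) : cabs x%:C%C = `|x|.
Proof. by rewrite cabs_sqrt /= expr0n /= addr0 sqrtr_sqr. Qed.

Lemma cabs_nat n : cabs (n%:R : R[i]) = n%:R.
Proof. by rewrite -(rmorph_nat (real_complex R)) cabs_real normr_nat. Qed.

Lemma conjC_complex (a b : R) : (Complex a b)^* = Complex a (- b).
Proof. by []. Qed.

Lemma conjC_real_complex (x : R) : (x%:C%C : R[i])^* = x%:C%C.
Proof. by rewrite /= conjC_complex /= oppr0. Qed.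

Lemma cabs_ger0 z : 0 <= z -> z = (cabs z)%:C%C.
Proof. by move=> z0; rewrite -normr_cabs ger0_norm. Qed.

Lemma normCK_cabs z : z * z^* = (cabs z ^+ 2)%:C%C.
Proof. by rewrite -normCK normr_cabs rmorphXn. Qed.

Lemma Re_le_cabs z : `|complex.Re z| <= cabs z.
Proof. by rewrite cabs_sqrt -sqrtr_sqr ler_wsqrtr// lerDl sqr_ge0. Qed.

Lemma Im_le_cabs z : `|complex.Im z| <= cabs z.
Proof. by rewrite cabs_sqrt -sqrtr_sqr ler_wsqrtr// lerDr sqr_ge0. Qed.

Lemma cabs_le_ReIm z : cabs z <= `|complex.Re z| + `|complex.Im z|.
Proof.
rewrite cabs_sqrt -[leRHS]ger0_norm ?addr_ge0// -sqrtr_sqr ler_wsqrtr//.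
by rewrite sqrrD !real_normK ?num_real// lerD2r lerDl mulrn_wge0// mulr_ge0.
Qed.

Lemma circle_cos_sin z : cabs z = 1 ->
  exists2 t : R, t \in `[- pi, pi] & z = Complex (cos t) (sin t).
Proof.
case: z => a b; rewrite cabs_sqrt /= => h.
have h1 : a ^+ 2 + b ^+ 2 = 1.
  by rewrite -[LHS]sqr_sqrtr ?addr_ge0 ?sqr_ge0// h expr1n.
have a1 : -1 <= a <= 1.
  by rewrite -ler_norml -(expr_le1 (n := 2))// real_normK ?num_real// -h1
    lerDl sqr_ge0.
have ac : cos (acos a) = a by rewrite acosK// in_itv.
have as_ : sin (acos a) = `|b|.
  by rewrite sin_acos// -h1 addrAC subrr add0r sqrtr_sqr.
have p0 := pi_ge0 R.
have [a0 ap] := (acos_ge0 a1, acos_lepi a1).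
have [b0|b0] := leP 0 b.
  exists (acos a); first by rewrite in_itv /= ap andbT (le_trans _ a0)// oppr_le0.
  by rewrite ac as_ ger0_norm.
exists (- acos a); last by rewrite cosN sinN ac as_ ltr0_norm// opprK.
by rewrite in_itv /= lerN2 ap /= (le_trans _ p0)// oppr_le0.
Qed.

End complex_modulus.

(** * Complete normed algebras *)

Notation invertible x := (ainvertible *%R 1 x).

Section invertible.
Variables (R : realType) (B : algType R[i]).
Implicit Types x y a b : B.

Lemma invertibleM x y : invertible x -> invertible y -> invertible (x * y).
Proof.
move=> [x' [xx' x'x]] [y' [yy' y'y]]; exists (y' * x'); split.
  by rewrite mulrA -(mulrA x) yy' mulr1.
by rewrite mulrA -(mulrA y') x'x mulr1.
Qed.

Lemma invertible_lr x a b : a * x = 1 -> x * b = 1 -> invertible x.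
Proof.
move=> ax xb; exists b; split => //.
by rewrite -[b]mul1r -ax -(mulrA a) xb mulr1.
Qed.

Lemma invertible_commM x y : x * y = y * x -> invertible (x * y) -> invertible x.
Proof.
move=> xy [b [h1 h2]]; apply: (@invertible_lr x (b * y) (y * b)).
- by rewrite -mulrA -xy h2.
- by rewrite mulrA h1.
Qed.

Lemma invertibleZ z x : z != 0 -> invertible x -> invertible (z *: x).
Proof.
move=> z0 [b [h1 h2]]; exists (z^-1 *: b).
by rewrite -!scalerAl -!scalerAr !scalerA h1 h2 mulfV// mulVf// !scale1r.
Qed.

Lemma invertibleZE z x : z != 0 -> invertible (z *: x) <-> invertible x.
Proof.
move=> z0; split=> [h|]; last exact: invertibleZ.
by rewrite -[x]scale1r -(mulVf z0) -scalerA; apply: invertibleZ; rewrite ?invr_eq0.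
Qed.

Lemma invertibleN x : invertible x -> invertible (- x).
Proof. by move=> h; rewrite -scaleN1r; apply: invertibleZ => //; rewrite oppr_eq0 oner_eq0. Qed.

(** Away from [0], [x * y] and [y * x] have the same spectrum: if [c] inverts
    [z - x y] then [z^-1 (1 + y c x)] inverts [z - y x]. *)
Lemma invertible_swap z x y : z != 0 ->
  invertible (x * y - z%:A) -> invertible (y * x - z%:A).
Proof.
move=> z0 [c [h1 h2]].
have e1 : x * y * c = 1 + z *: c.
  by rewrite -h1 mulrBl -scalerAl mul1r subrK.
have e2 : c * (x * y) = 1 + z *: c.
  by rewrite -h2 mulrBr -scalerAr mulr1 subrK.
exists (z^-1 *: (y * c * x - 1)); split.
- rewrite -scalerAr mulrBl !mulrBr mulr1 -scalerAl mul1r.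
  have -> : y * x * (y * c * x) = y * x + z *: (y * c * x).
    rewrite !mulrA -(mulrA y x) -(mulrA y (x * y)) e1 mulrDr mulr1 mulrDl.
    by rewrite -scalerAr -scalerAl.
  rewrite (addrAC (y * x)) subrr add0r opprB addrC subrK mulr1 scalerA.
  by rewrite mulVf// scale1r.
- rewrite -scalerAl mulrBr !mulrBl !mul1r -scalerAr mulr1.
  have -> : y * c * x * (y * x) = y * x + z *: (y * c * x).
    rewrite -!mulrA (mulrA x y) (mulrA c (x * y)) e2 mulrDl mul1r mulrDr.
    by rewrite -!scalerAl -scalerAr.
  rewrite (addrAC (y * x)) subrr add0r opprB addrC subrK scalerA.
  by rewrite mulVf// scale1r.
Qed.

(** The spectral radius of [x] is at most [q]. *)
Definition spr_le x (q : R) := forall z : R[i], q < cabs z -> invertible (x - z%:A).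

Lemma spr_le_trans x q q' : q <= q' -> spr_le x q -> spr_le x q'.
Proof. by move=> qq' h z hz; apply: h; exact: le_lt_trans hz. Qed.

Lemma spr_le_swap x y q : 0 <= q -> spr_le (x * y) q -> spr_le (y * x) q.
Proof.
move=> q0 h z hz; apply: invertible_swap; last exact: h.
by rewrite -cabs_gt0; exact: le_lt_trans hz.
Qed.

Lemma spr_leZ w x q : 0 <= q -> spr_le x q -> spr_le (w *: x) (cabs w * q).
Proof.
move=> q0 h z; have [->|w0] := eqVneq w 0.
  rewrite scale0r sub0r cabs0 mul0r cabs_gt0 => z0.
  by apply: invertibleN; apply: invertibleZ => //; exists 1; rewrite mulr1.
move=> hz; have -> : w *: x - z%:A = w *: (x - (w^-1 * z)%:A).
  by rewrite scalerBr scalerA mulrA divff// mul1r.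
apply: invertibleZ => //; apply: h.
by rewrite cabsM cabsV mulrC ltr_pdivlMr ?cabs_gt0// mulrC.
Qed.

Lemma subr_sqr_scalar x z : x ^+ 2 - (z ^+ 2)%:A = (x - z%:A) * (x + z%:A).
Proof.
rewrite mulrBl !mulrDr -!scalerAr -!scalerAl mulr1 mul1r scalerA -!expr2.
by rewrite expr1n opprD addrA addrK.
Qed.

Lemma spr_le_sqr x q : 0 <= q -> spr_le (x ^+ 2) (q ^+ 2) -> spr_le x q.
Proof.
move=> q0 h z hz.
have : invertible (x ^+ 2 - (z ^+ 2)%:A).
  by apply: h; rewrite cabsX ltr_pXn2r// nnegrE ?cabs_ge0.
rewrite subr_sqr_scalar; apply: invertible_commM.
by rewrite mulrBl mulrBr !mulrDr !mulrDl -!scalerAr -!scalerAl mulr1 mul1r.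
Qed.

Lemma sqr_spr_le x q : 0 <= q -> spr_le x q -> spr_le (x ^+ 2) (q ^+ 2).
Proof.
move=> q0 h z hz.
have w2 := sqr_sqrtc z; set w := sqrtc z in w2.
have qw : q < cabs w.
  by rewrite -(ltr_pXn2r (n := 2)) ?nnegrE ?cabs_ge0// -cabsX w2.
have -> : x ^+ 2 - z%:A = (x - w%:A) * (x - (- w)%:A).
  by rewrite scaleNr opprK -w2 subr_sqr_scalar.
by apply: invertibleM; apply: h; rewrite ?cabsN.
Qed.

End invertible.

Record complete_norm (R : realType) (B : algType R[i]) (nrm : B -> R) : Prop :=
  CompleteNorm {
  cnrmD : forall x y, nrm (x + y) <= nrm x + nrm y;
  cnrmZ : forall z x, nrm (z *: x) = cabs z * nrm x;
  cnrm_eq0 : forall x, nrm x = 0 -> x = 0;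
  cnrmM : forall x y, nrm (x * y) <= nrm x * nrm y;
  cnrm_complete : forall u : nat -> B,
    (exists S, forall n, \sum_(i < n) nrm (u i) <= S) ->
    exists l, (fun n => nrm (\sum_(i < n) u i - l)) @ \oo --> (0 : R) }.

Section complete_norm.
Variables (R : realType) (B : algType R[i]) (nrm : B -> R).
Hypothesis Hnrm : complete_norm nrm.
Implicit Types (x y l : B) (u v : nat -> B).

Definition nlim u l := (fun n => nrm (u n - l)) @ \oo --> (0 : R).

Lemma cnrm0 : nrm 0 = 0.
Proof. by rewrite -(scale0r 0) (cnrmZ Hnrm) cabs0 mul0r. Qed.

Lemma cnrmN x : nrm (- x) = nrm x.
Proof. by rewrite -scaleN1r (cnrmZ Hnrm) cabsN cabs1 mul1r. Qed.

Lemma cnrm_ge0 x : 0 <= nrm x.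
Proof.
have := cnrmD Hnrm x (- x); rewrite subrr cnrm0 cnrmN -mulr2n.
by rewrite -mulr_natr pmulr_lge0.
Qed.

Lemma cnrmB x y : nrm (x - y) <= nrm x + nrm y.
Proof. by rewrite -(cnrmN y); exact: (cnrmD Hnrm). Qed.

Lemma nlim_squeeze u l (e : nat -> R) :
  (forall n, nrm (u n - l) <= e n) -> e @ \oo --> (0 : R) -> nlim u l.
Proof.
move=> h he; apply: (squeeze_cvgr _ (cvg_cst 0) he).
by apply: nearW => n; rewrite cnrm_ge0 h.
Qed.

Lemma nlim_uniq u l l' : nlim u l -> nlim u l' -> l = l'.
Proof.
move=> h h'; apply/eqP; rewrite -subr_eq0; apply/eqP/(cnrm_eq0 Hnrm)/eqP.
rewrite eq_le cnrm_ge0 andbT.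
have hD : nrm (u n - l) + nrm (u n - l') @[n --> \oo] --> (0 : R).
  by rewrite -(addr0 (0 : R)); apply: cvgD.
apply: (ler_cvg_to (cvg_cst _) hD); apply: nearW => n; rewrite -cnrmN (_ : - (l - l') = (u n - l) - (u n - l')).
  exact: cnrmB.
by rewrite !opprB [RHS]addrC addrA subrK.
Qed.

Lemma nlim_cst l : nlim (fun=> l) l.
Proof. by rewrite /nlim subrr cnrm0; exact: cvg_cst. Qed.

Lemma nlimD u v l l' : nlim u l -> nlim v l' -> nlim (fun n => u n + v n) (l + l').
Proof.
move=> h h'; apply: (@nlim_squeeze _ _ (fun n => nrm (u n - l) + nrm (v n - l'))); last first.
  by rewrite -(addr0 (0 : R)); apply: cvgD.
move=> n; rewrite opprD addrACA; exact: (cnrmD Hnrm).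
Qed.

Lemma nlimMl a u l : nlim u l -> nlim (fun n => a * u n) (a * l).
Proof.
move=> h; apply: (@nlim_squeeze _ _ (fun n => nrm a * nrm (u n - l))).
  by move=> n; rewrite -mulrBr (cnrmM Hnrm).
by rewrite -(mulr0 (nrm a)); apply: cvgMr; exact: h.
Qed.

Lemma nlimMr a u l : nlim u l -> nlim (fun n => u n * a) (l * a).
Proof.
move=> h; apply: (@nlim_squeeze _ _ (fun n => nrm (u n - l) * nrm a)).
  by move=> n; rewrite -mulrBl (cnrmM Hnrm).
by rewrite -(mul0r (nrm a)); apply: cvgMl; exact: h.
Qed.

Definition pow_le x q := exists C, forall n, nrm (x ^+ n) <= C * q ^+ n.

Lemma pow_leW x q q' : 0 <= q <= q' -> pow_le x q -> pow_le x q'.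
Proof.
move=> /andP[q0 qq'] [C h]; exists `|C| => n; apply: (le_trans (h n)).
apply: (le_trans (ler_norm _)); rewrite normrM ler_wpM2l//.
by rewrite ger0_norm ?exprn_ge0// lerXn2r// nnegrE// (le_trans q0).
Qed.

Lemma cnrmX x n : nrm (x ^+ n.+1) <= nrm x ^+ n.+1.
Proof.
elim: n => [|n ih]; first by rewrite !expr1.
rewrite exprS [leRHS]exprS; apply: (le_trans (cnrmM Hnrm _ _)).
by rewrite ler_wpM2l ?cnrm_ge0.
Qed.

Lemma cnrm1_gt0 : 0 < nrm 1.
Proof.
rewrite lt_neqAle cnrm_ge0 andbT eq_sym; apply/eqP => /(cnrm_eq0 Hnrm)/eqP.
by rewrite oner_eq0.
Qed.

Lemma cnrm1_ge1 : 1 <= nrm 1.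
Proof.
have := cnrmM Hnrm 1 1; rewrite mul1r -{1}[nrm 1]mulr1 ler_pM2l//.
exact: cnrm1_gt0.
Qed.

Lemma pow_le_nrm x : pow_le x (nrm x).
Proof.
exists (nrm 1) => -[|n]; first by rewrite !expr0 mulr1.
apply: (le_trans (cnrmX _ _)).
by rewrite ler_peMl ?exprn_ge0 ?cnrm_ge0 ?cnrm1_ge1.
Qed.

Lemma sum_geometric_le (q : R) n : 0 <= q < 1 ->
  \sum_(i < n) q ^+ i <= (1 - q)^-1.
Proof.
move=> /andP[q0 q1]; have h : 0 < 1 - q by rewrite subr_gt0.
rewrite -[leRHS]mul1r ler_pdivlMr// mulrC.
by rewrite -opprB mulNr -subrX1 opprB lerBlDl lerDr exprn_ge0.
Qed.

Lemma neumann x q : 0 <= q < 1 -> pow_le x q -> invertible (1 - x).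
Proof.
move=> q01 [C hC]; have [q0 q1] := andP q01.
have [l hl] : exists l, nlim (fun n => \sum_(i < n) x ^+ i) l.
  apply: (cnrm_complete Hnrm); exists (`|C| * (1 - q)^-1) => n.
  apply: (@le_trans _ _ (\sum_(i < n) C * q ^+ i)).
    by apply: ler_sum => i _; exact: hC.
  rewrite -mulr_sumr; apply: (le_trans (ler_norm _)); rewrite normrM ler_wpM2l//.
  by rewrite ger0_norm ?sum_geometric_le// sumr_ge0// => i _; rewrite exprn_ge0.
have x0 : nlim (fun n => 1 - x ^+ n) 1.
  apply: (@nlim_squeeze _ _ (fun n => C * q ^+ n)).
    by move=> n; rewrite addrC addKr cnrmN.
  by apply: cvg_geometric; rewrite ger0_norm.
exists l; split.
- apply: nlim_uniq x0; have := nlimMl (1 - x) hl; congr nlim; apply/funext => n.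
  by rewrite -opprB mulNr -subrX1 opprB.
- apply: nlim_uniq x0; have := nlimMr (1 - x) hl; congr nlim; apply/funext => n.
  rewrite -opprB mulrN (_ : _ * (x - 1) = x ^+ n - 1) ?opprB//.
  rewrite subrX1 mulrBr mulr1 mulrBl mul1r mulr_suml mulr_sumr.
  by congr (_ - _); apply: eq_bigr => i _; rewrite -exprSr -exprS.
Qed.

Lemma pow_le_spr x q : 0 <= q -> pow_le x q -> spr_le x q.
Proof.
move=> q0 [C hC] z hz; have z0 : 0 < cabs z by exact: le_lt_trans hz.
have zN0 : z != 0 by rewrite -cabs_gt0.
have -> : x - z%:A = (- z) *: (1 - z^-1 *: x).
  by rewrite scalerBr scalerA mulNr divff// scaleN1r scaleNr opprK addrC.
apply: invertibleZ; first by rewrite oppr_eq0.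
apply: (@neumann _ (q / cabs z)).
  by rewrite divr_ge0 ?(ltW z0)//= ltr_pdivrMr// mul1r.
exists C => n; rewrite exprZn (cnrmZ Hnrm) cabsX cabsV exprMn mulrA mulrC.
by rewrite ler_pM2r ?exprn_gt0 ?invr_gt0.
Qed.

Lemma spr_le_nrm x : spr_le x (nrm x).
Proof. by apply: pow_le_spr; [exact: cnrm_ge0|exact: pow_le_nrm]. Qed.

Lemma pow_leZ (s : R) x q : 0 <= s -> pow_le x q -> pow_le (s%:C%C *: x) (s * q).
Proof.
move=> s0 [C h]; exists C => n.
rewrite exprZn (cnrmZ Hnrm) cabsX cabs_real ger0_norm// exprMn mulrCA.
by rewrite ler_wpM2l ?exprn_ge0.
Qed.

Lemma pow_le_root x q m : (0 < m)%N -> 0 < q -> nrm (x ^+ m) <= q ^+ m ->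
  pow_le x q.
Proof.
move=> m0 q0 h; exists (\sum_(b < m) nrm (x ^+ b) / q ^+ b) => n.
have key a b : nrm (x ^+ (a * m + b)) <= q ^+ (a * m) * nrm (x ^+ b).
  elim: a => [|a ih]; first by rewrite mul0n add0n expr0 mul1r.
  rewrite mulSn -addnA exprD; apply: (le_trans (cnrmM Hnrm _ _)).
  by rewrite (exprD q) -mulrA ler_pM ?cnrm_ge0.
rewrite {1 2}(divn_eq n m); apply: (le_trans (key _ _)).
rewrite (exprD q) mulrCA ler_wpM2l ?exprn_ge0 ?(ltW q0)//.
rewrite -ler_pdivrMr ?exprn_gt0// (bigD1 (Ordinal (ltn_pmod n m0)))//= lerDl.
by apply: sumr_ge0 => i _; rewrite divr_ge0 ?cnrm_ge0 ?exprn_ge0 ?(ltW q0).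
Qed.

Let isinv x y := x * y = 1 /\ y * x = 1.

Let isinv_near x s0 s J0 J : isinv (1 - s0 *: x) J0 -> isinv (1 - s *: x) J ->
  nrm (J - J0) <= cabs (s - s0) * (nrm J * nrm x * nrm J0).
Proof.
move=> [h0 h0'] [h h'].
have -> : J - J0 = (s - s0) *: (J * x * J0).
  transitivity (J * ((1 - s0 *: x) - (1 - s *: x)) * J0).
    by rewrite mulrBr mulrBl h' mul1r -mulrA h0 mulr1.
  have -> : 1 - s0 *: x - (1 - s *: x) = (s - s0) *: x.
    by rewrite scalerBl opprB addrC addrA subrK.
  by rewrite -scalerAr -scalerAl.
rewrite (cnrmZ Hnrm) ler_wpM2l ?cabs_ge0//.
apply: (le_trans (cnrmM Hnrm _ _)); rewrite ler_wpM2r ?cnrm_ge0//.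
exact: (cnrmM Hnrm).
Qed.

Let isinv_bound x s0 s J0 J : isinv (1 - s0 *: x) J0 -> isinv (1 - s *: x) J ->
  cabs (s - s0) * (nrm x * nrm J0) <= 2^-1 -> nrm J <= 2 * nrm J0.
Proof.
move=> h0 h hs; have := isinv_near h0 h; rewrite -mulrA mulrCA => k.
have := cnrmD Hnrm (J - J0) J0; rewrite subrK.
have : nrm J * (cabs (s - s0) * (nrm x * nrm J0)) <= nrm J * 2^-1.
  by rewrite ler_wpM2l ?cnrm_ge0.
lra.
Qed.

(** Compactness of the circle bounds the resolvent on it. *)
Let resolvent_bound x (r : R) : 0 < r ->
  (forall s, cabs s = r -> invertible (1 - s *: x)) ->
  exists K, forall s J, cabs s = r -> isinv (1 - s *: x) J -> nrm J <= K.
Proof.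
move=> r0 hinv; pose e (t : R) : R[i] := r%:C%C * Complex (cos t) (sin t).
have ce t : cabs (e t) = r.
  rewrite cabsM cabs_real gtr0_norm// cabs_sqrt /= cos2Dsin2 sqrtr1 mulr1//.
pose P (K t : R) := forall J, isinv (1 - e t *: x) J -> nrm J <= K.
have /compact_near_coveringP nc := @segment_compact R (- pi) pi.
have [K hK] : exists K, `[- pi, pi]%classic `<=` P K.
  apply: (@filter_ex _ (pinfty_nbhs R)); apply: (nc _ (pinfty_nbhs R) P) => t _.
  have [J0 hJ0] := hinv _ (ce t).
  pose c := nrm x * nrm J0.
  have c0 : 0 <= c by rewrite mulr_ge0 ?cnrm_ge0.
  pose d := (4 * (r * (c + 1)))^-1.
  have d0 : 0 < d by rewrite invr_gt0 !mulr_gt0// ltr_wpDl.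
  near=> t' K => /= J hJ.
  apply: (@le_trans _ _ (2 * nrm J0)); last by near: K; apply: nbhs_pinfty_ge; rewrite num_real.
  apply: isinv_bound hJ0 hJ _; rewrite -mulrBr cabsM cabs_real gtr0_norm//.
  have hc : `|cos t' - cos t| <= d.
    near: t'; have := @continuous_cos R t; move/cvgrPdist_le/(_ d d0).
    by apply: filterS => u; rewrite distrC.
  have hs : `|sin t' - sin t| <= d.
    near: t'; have := @continuous_sin R t; move/cvgrPdist_le/(_ d d0).
    by apply: filterS => u; rewrite distrC.
  apply: (@le_trans _ _ (r * (d + d) * c)).
    rewrite ler_wpM2r// ler_wpM2l ?(ltW r0)//.
    by apply: (le_trans (cabs_le_ReIm _)); exact: lerD.
  have -> : r * (d + d) * c = 2^-1 * (c / (c + 1)).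
    by rewrite /d; field; rewrite !gt_eqF// ltr_wpDl.
  by rewrite ler_piMr// ler_pdivrMr ?ltr_wpDl// mul1r lerDl.
exists K => s J hs hJ; have rN0 : r%:C%C != 0 :> R[i].
  by rewrite eq_complex /= gt_eqF.
have [|t tpi ht] := @circle_cos_sin _ ((r%:C%C)^-1 * s).
  by rewrite cabsM cabsV cabs_real gtr0_norm// hs mulVf// gt_eqF.
by apply: (hK t) => //; rewrite /e -ht mulrA divff// mul1r.
Unshelve. all: by end_near. Qed.

(** Averaging over the two square roots of a scalar turns a modulus of
    continuity of the resolvent of [x] on a circle into the same modulus for
    [x ^+ 2], hence for all the [x ^+ (2 ^ k)] at once. *)
Let dyadic_resolvent x (s s' e : R) :
  (forall w, cabs w = 1 -> exists J J',
    [/\ isinv (1 - (w * s%:C%C) *: x) J, isinv (1 - (w * s'%:C%C) *: x) J' &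
        nrm (J - J') <= e]) ->
  forall k w, cabs w = 1 -> exists J J',
    [/\ isinv (1 - (w * (s ^+ (2 ^ k))%:C%C) *: x ^+ (2 ^ k)) J,
        isinv (1 - (w * (s' ^+ (2 ^ k))%:C%C) *: x ^+ (2 ^ k)) J' &
        nrm (J - J') <= e].
Proof.
move=> h0; elim=> [|k ih] w hw; first by rewrite expn0 !expr1; exact: h0.
set m := (2 ^ k)%N in ih *.
have em : (2 ^ k.+1 = m * 2)%N by rewrite expnSr.
have [z vw] : exists z : R[i], z ^+ 2 = w by exists (sqrtc w); rewrite sqr_sqrtc.
have hv : cabs z = 1.
  apply/eqP; rewrite -(@pexpr_eq1 _ _ 2) ?cabs_ge0// -cabsX vw.
  by apply/eqP.
have [J1 [J1' [a1 a1' n1]]] := ih z hv.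
have [J2 [J2' [a2 a2' n2]]] := ih (- z) (etrans (cabsN z) hv).
have avg (t : R) A1 A2 : isinv (1 - (z * (t ^+ m)%:C%C) *: x ^+ m) A1 ->
    isinv (1 - (- z * (t ^+ m)%:C%C) *: x ^+ m) A2 ->
    isinv (1 - (w * (t ^+ (2 ^ k.+1))%:C%C) *: x ^+ (2 ^ k.+1))
          (2^-1 *: (A1 + A2)).
  set y := (z * (t ^+ m)%:C%C) *: x ^+ m => -[b1 b1'].
  rewrite mulNr scaleNr opprK => -[b2 b2'].
  have -> : (w * (t ^+ (2 ^ k.+1))%:C%C) *: x ^+ (2 ^ k.+1) = y ^+ 2.
    by rewrite exprZn exprMn em !exprM -vw -rmorphXn.
  have f1 : 1 - y ^+ 2 = (1 - y) * (1 + y).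
    by rewrite mulrBl !mulrDr !mul1r !mulr1 -expr2 opprD addrA addrK.
  have f2 : 1 - y ^+ 2 = (1 + y) * (1 - y).
    by rewrite mulrBr !mulrDl !mul1r !mulr1 -expr2 opprD addrA addrK.
  have e2 : (1 - y) + (1 + y) = 1 + 1 :> B by rewrite addrACA addNr addr0.
  have e3 : 2^-1 *: (1 + 1) = 1 :> B.
    have -> : 1 + 1 = (2 : R[i]) *: 1 :> B by rewrite scaler_nat mulr2n.
    by rewrite scalerA mulVf ?scale1r// pnatr_eq0.
  split.
  - rewrite -scalerAr mulrDr {1}f2 f1 -!mulrA b1 b2 !mulr1 addrC e2 e3//.
  - rewrite -scalerAl mulrDl {1}f1 f2 !mulrA b1' b2' !mul1r addrC e2 e3//.
exists (2^-1 *: (J1 + J2)), (2^-1 *: (J1' + J2')); split; [exact: avg|exact: avg|].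
rewrite -scalerBr (cnrmZ Hnrm) cabsV opprD addrACA.
have -> : cabs (2 : R[i]) = 2.
  exact: cabs_nat.
have := cnrmD Hnrm (J1 - J1') (J2 - J2'); lra.
Qed.

(** Gelfand's spectral radius formula, without complex function theory. If the
    growth rate [r] of the powers of [x] exceeded [q], the resolvent would be
    uniformly continuous near the circle of radius [r]; by averaging,
    [(1 - (x / r) ^+ (2 ^ k))^-1] would be uniformly close to
    [(1 - (x / r') ^+ (2 ^ k))^-1], which tends to [1] for [r' > r]. Hence
    [(x / r) ^+ (2 ^ k)] would be small for some [k], against the choice of
    [r]. *)
Lemma gelfand x q q' : 0 <= q < q' -> spr_le x q -> pow_le x q'.
Proof.
move=> /andP[q0 qq'] hx; have q'0 : 0 < q' by exact: le_lt_trans qq'.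
apply: contrapT => nx.
pose E := [set r : R | 0 < r /\ pow_le x r].
have lbE : lbound E q'.
  move=> r [r0 xr]; rewrite leNgt; apply/negP => rq'; apply: nx.
  by apply: pow_leW xr; rewrite !ltW.
have E0 : E !=set0.
  exists (nrm x + 1); split; first by rewrite ltr_wpDl ?cnrm_ge0.
  by apply: pow_leW (pow_le_nrm x); rewrite cnrm_ge0 lerDl ler01.
have hE : has_inf E by split=> //; exists q'.
pose r := inf E; have rq' : q' <= r by exact: lb_le_inf.
have r0 : 0 < r by exact: lt_le_trans rq'.
have qr : q < r by exact: lt_le_trans rq'.
pose s := r^-1; have s0 : 0 < s by rewrite invr_gt0.
have hinv z : cabs z <= s -> invertible (1 - z *: x).
  move=> zs; have [->|z0] := eqVneq z 0.
    by rewrite scale0r subr0; exists 1; rewrite mulr1.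
  have -> : 1 - z *: x = (- z) *: (x - (z^-1)%:A).
    by rewrite scalerBr scalerA !mulNr divff// !scaleNr scale1r opprK addrC.
  apply: invertibleZ; first by rewrite oppr_eq0.
  apply: hx; apply: (lt_le_trans qr); rewrite cabsV -[r]invrK.
  by rewrite lef_pV2 ?posrE// cabs_gt0.
have [z zs|K hK] := resolvent_bound s0 (x := x).
  by apply: hinv; rewrite zs.
have K0 : 0 <= K.
  have [|J hJ] := hinv s%:C%C; first by rewrite cabs_real gtr0_norm.
  by apply: le_trans (hK _ _ _ hJ); rewrite ?cnrm_ge0// cabs_real gtr0_norm.
have N1 := cnrm1_ge1; pose e := (8 * nrm 1)^-1.
have e0 : 0 < e by rewrite invr_gt0 mulr_gt0// (lt_le_trans _ N1).
pose D := (2 * K + 1) * (nrm x + 1) * (K + 1).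
have D0 : 0 < D by rewrite !mulr_gt0 ?ltr_wpDl ?mulr_ge0 ?cnrm_ge0.
pose d := Num.min (e / D) (Num.min (2^-1 / D) (s / 2)).
have d0 : 0 < d by rewrite /d !lt_min !divr_gt0.
have [dD dD2 ds] : [/\ d * D <= e, d * D <= 2^-1 & d < s].
  rewrite /d -!ler_pdivlMr// !ge_min !lexx !orbT; split => //.
  have ss : s / 2 < s by lra.
  by rewrite !gt_min ss !orbT.
pose s' := s - d; have s'0 : 0 < s' by rewrite subr_gt0.
have base w : cabs w = 1 -> exists J J',
    [/\ isinv (1 - (w * s%:C%C) *: x) J, isinv (1 - (w * s'%:C%C) *: x) J' &
        nrm (J - J') <= e].
  move=> w1.
  have cw t : 0 <= t -> cabs (w * t%:C%C) = t.
    by move=> t0; rewrite cabsM w1 mul1r cabs_real ger0_norm.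
  have [|J hJ] := hinv (w * s%:C%C); first by rewrite cw ?(ltW s0).
  have [|J' hJ'] := hinv (w * s'%:C%C).
    by rewrite cw ?(ltW s'0)// lerBlDr lerDl ltW.
  have JK : nrm J <= K by apply: hK hJ; rewrite cw ?(ltW s0).
  have cd : cabs (w * s%:C%C - w * s'%:C%C) = d.
    by rewrite -mulrBr -rmorphB /= /s' subKr cw ?(ltW d0).
  have x0 := cnrm_ge0 x; have J0 := cnrm_ge0 J.
  have J'K : nrm J' <= 2 * K.
    apply: (@le_trans _ _ (2 * nrm J)); last by rewrite ler_wpM2l.
    apply: isinv_bound hJ hJ' _; rewrite -cabsN opprB cd.
    apply: (le_trans _ dD2); rewrite ler_wpM2l ?(ltW d0)//.
    apply: (@le_trans _ _ (nrm x * K)); first by rewrite ler_wpM2l.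
    rewrite /D; have : 0 <= K * nrm x * K by rewrite !mulr_ge0.
    have : 0 <= K * nrm x by rewrite !mulr_ge0.
    have : 0 <= K * K by rewrite !mulr_ge0.
    nra.
  exists J, J'; split => //; apply: (le_trans (isinv_near hJ' hJ)).
  rewrite cd; apply: (le_trans _ dD); rewrite ler_wpM2l ?(ltW d0)//.
  have J'0 := cnrm_ge0 J'.
  apply: (@le_trans _ _ (K * nrm x * (2 * K))).
    by rewrite ler_pM ?mulr_ge0// ler_pM.
  rewrite /D; have : 0 <= K * nrm x * K by rewrite !mulr_ge0.
  have : 0 <= K * nrm x by rewrite !mulr_ge0.
  have : 0 <= K * K by rewrite !mulr_ge0.
  nra.
have [p Ep ps'] : exists2 p, E p & p < s'^-1.
  apply/inf_lt => //.
  by rewrite -[ltLHS]invrK ltf_pV2 ?posrE ?invr_gt0// ltrBlDr ltrDl.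
have {Ep} [p0 [C hC]] := Ep.
have sp1 : s' * p < 1 by rewrite mulrC -ltr_pdivlMr// div1r.
pose t := (16 * (nrm 1 * nrm 1))^-1.
have t0 : 0 < t by rewrite invr_gt0 !mulr_gt0 ?(lt_le_trans _ N1).
have [k hk] : exists k, nrm ((s' ^+ (2 ^ k))%:C%C *: x ^+ (2 ^ k)) <= t.
  have /cvgrPdist_le/(_ t t0) : geometric C (s' * p) @ \oo --> 0.
    by apply: cvg_geometric; rewrite ger0_norm// mulr_ge0 ?ltW.
  move=> [k _ hk]; exists k; have /= := hk (2 ^ k)%N (ltnW (ltn_expl k (ltnSn 1))).
  rewrite sub0r normrN => h; apply: le_trans h; apply: le_trans (ler_norm _).
  rewrite (cnrmZ Hnrm) cabs_real ger0_norm ?exprn_ge0 ?(ltW s'0)// exprMn mulrCA.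
  by rewrite ler_wpM2l ?exprn_ge0 ?(ltW s'0).
have [J [J']] := dyadic_resolvent base k (cabs1 R).
rewrite !mul1r => -[[hJ1 hJ2] [hJ1' _] JJ'].
set v := (s' ^+ _)%:C%C *: _ in hk hJ1'.
set u := (s ^+ _)%:C%C *: _ in hJ1 hJ2.
have N0 : 0 < nrm 1 by exact: lt_le_trans N1.
have J'1 : nrm (J' - 1) <= e.
  have h : nrm (J' - 1) <= t * (nrm 1 + nrm (J' - 1)).
    rewrite -{1}hJ1' mulrBl mul1r opprB addrC subrK.
    apply: (le_trans (cnrmM Hnrm _ _)).
    apply: ler_pM; rewrite ?cnrm_ge0//.
    by rewrite -{1}(subrK 1 J') [leRHS]addrC (cnrmD Hnrm).
  have t1 : t <= 2^-1.
    by rewrite lef_pV2 ?posrE ?mulr_gt0//; nra.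
  have := cnrm_ge0 (J' - 1); set a := nrm (J' - 1) in h *.
  have et : 2 * t * nrm 1 = e by rewrite /t /e; field; rewrite gt_eqF.
  rewrite -et; nra.
have J1 : nrm (J - 1) <= 2 * e.
  have := cnrmD Hnrm (J - J') (J' - 1); rewrite addrA subrK; lra.
have hu : nrm u <= 2^-1.
  have h : nrm u <= 2 * e * (nrm 1 + nrm u).
    have {1}-> : u = (J - 1) * (1 - u).
      by rewrite mulrBl hJ2 mul1r opprB addrC subrK.
    apply: (le_trans (cnrmM Hnrm _ _)).
    by apply: ler_pM; rewrite ?cnrm_ge0// (cnrmB).
  have e1 : 2 * e * nrm 1 = 4^-1 by rewrite /e; field; rewrite gt_eqF.
  have e2 : 2 * e <= 4^-1 by rewrite -e1 ler_peMr// mulr_ge0// ltW.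
  have := cnrm_ge0 u; nra.
pose m := (2 ^ k)%N; have m0 : (0 < m)%N by rewrite expn_gt0.
pose h := 1 - (2 * m%:R)^-1 : R.
have m1 : 1 <= m%:R :> R by rewrite ler1n.
have mm : m%:R * (2 * m%:R)^-1 = 2^-1 :> R.
  by field; rewrite gt_eqF// (lt_le_trans _ m1).
have m2 : 0 < (2 * m%:R : R)^-1 <= 2^-1.
  by rewrite invr_gt0 lef_pV2 ?posrE ?mulr_gt0// ?ltr0n//= ler_peMr.
have [h0 h1] : 0 < h /\ h < 1 by rewrite /h; split; lra.
have um : (s%:C%C *: x) ^+ m = u by rewrite exprZn -rmorphXn.
have hm : nrm ((s%:C%C *: x) ^+ m) <= h ^+ m.
  rewrite um; apply: (le_trans hu); rewrite -[leLHS]/(2^-1).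
  suff : forall n, 1 - n%:R * (2 * m%:R)^-1 <= h ^+ n.
    by move=> /(_ m); rewrite mm; lra.
  elim=> [|n ih]; first by rewrite mul0r subr0 expr0.
  rewrite exprS; apply: (@le_trans _ _ (h * (1 - n%:R * (2 * m%:R)^-1))).
    have n0 : 0 <= n%:R * ((2 * m%:R)^-1 * (2 * m%:R)^-1) :> R.
      by rewrite mulr_ge0// mulr_ge0// ltW//; case/andP: m2.
    by rewrite /h -natr1; nra.
  by rewrite ler_wpM2l ?(ltW h0).
have xr : pow_le x (r * h).
  have := pow_leZ (ltW r0) (pow_le_root m0 h0 hm).
  by rewrite scalerA -rmorphM /= /s mulfV ?gt_eqF// scale1r.
have : r <= r * h by apply: ge_inf; [exists q'|split => //; rewrite mulr_gt0].
by rewrite -[leLHS]mulr1 ler_pM2l// leNgt h1.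
Qed.

(** The square root of [1 - x] is [1 - y], where [y] is the limit of the
    iteration [y := (x + y ^+ 2) / 2]. Its properties follow from those of the
    iterates by the closure property [P]. *)
Lemma sqrt_iteration x q : 0 <= q < 1 -> pow_le x q ->
  exists2 y, y *+ 2 = x + y ^+ 2 &
  forall P : B -> Prop, P 0 -> (forall b, P b -> P (2^-1 *: (x + b ^+ 2))) ->
    (forall u l, (forall n, P (u n)) -> nlim u l -> P l) -> P y.
Proof.
move=> /andP[q0 q1] [C hC].
pose y n := iter n (fun b => 2^-1 *: (x + b ^+ 2)) 0.
pose t n := iter n (fun b => 2^-1 * (q + b ^+ 2)) 0.
pose dom (b : B) (a : R) := forall (w : B) c, (forall m, nrm (w * x ^+ m) <= c * q ^+ m) ->
  forall m, nrm (w * b * x ^+ m) <= a * c * q ^+ m.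
have dom0 : dom 0 0.
  by move=> w c h m; rewrite mulr0 mul0r cnrm0 !mul0r.
have domx : dom x q.
  by move=> w c h m; rewrite -mulrA -exprS (le_trans (h _))// exprS mulrCA mulrA.
have domM b b' a a' : dom b a -> dom b' a' -> dom (b * b') (a * a').
  move=> h h' w c k m; rewrite mulrA (mulrC a) -(mulrA a').
  by apply: h' => ?; apply: h.
have domD b b' a a' : dom b a -> dom b' a' -> dom (b + b') (a + a').
  move=> h h' w c k m; rewrite mulrDr !mulrDl; apply: (le_trans (cnrmD Hnrm _ _)).
  by apply: lerD; [exact: h|exact: h'].
have dom2 b a : dom b a -> dom (2^-1 *: b) (2^-1 * a).
  move=> h w c k m; rewrite -scalerAr -scalerAl (cnrmZ Hnrm) cabsV cabs_nat.
  by rewrite -2!(mulrA 2^-1) ler_wpM2l//; apply: h.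
have domy n : dom (y n) (t n).
  elim: n => [|n ih]; first exact: dom0.
  by rewrite /y /t !iterS; apply: dom2; apply: domD => //; exact: domM.
have commy n : y n * x = x * y n.
  elim: n => [|n ih]; first by rewrite mul0r mulr0.
  rewrite /y iterS -/(y n) -scalerAl -scalerAr mulrDl mulrDr expr2.
  by rewrite -mulrA ih !mulrA ih.
have commyy n : y n * y n.+1 = y n.+1 * y n.
  rewrite /y iterS -/(y n) -scalerAl -scalerAr mulrDl mulrDr expr2.
  by rewrite commy !mulrA.
have diffy n : dom (y n.+1 - y n) (t n.+1 - t n).
  elim: n => [|n ih].
    by rewrite /y /t /= !subr0; apply: dom2; rewrite expr0n expr2 mulr0 !addr0.
  have -> : y n.+2 - y n.+1 = 2^-1 *: ((y n.+1 - y n) * (y n.+1 + y n)).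
    rewrite {1 2}/y !iterS -/(y n) -/(y n.+1) -scalerBr opprD addrACA subrr add0r.
    by rewrite mulrBl !mulrDr commyy -!expr2 opprD addrA addrK.
  have -> : t n.+2 - t n.+1 = 2^-1 * ((t n.+1 - t n) * (t n.+1 + t n)).
    have tS k : t k.+1 = 2^-1 * (q + t k ^+ 2) by [].
    by rewrite (tS n.+1) [X in _ - X = _]tS; ring.
  by apply: dom2; apply: domM => //; apply: domD.
have t01 n : 0 <= t n <= 1.
  elim: n => [|n]; first by rewrite /t /= lexx ler01.
  by rewrite /t iterS -/(t n) => /andP[? ?]; apply/andP; split; nra.
have C0 : 0 <= C by have := hC 0%N; rewrite expr0 mulr1; exact/le_trans/cnrm_ge0.
have domnrm b a : dom b a -> nrm b <= a * C.
  move=> /(_ 1 C); rewrite mul1r => h.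
  have := h _ 0%N; rewrite expr0 !mulr1; apply => m; rewrite mul1r; exact: hC.
have [l hl] : exists l, nlim y l.
  have [|l hl] := cnrm_complete Hnrm (u := fun n => y n.+1 - y n).
    exists C => n; apply: (@le_trans _ _ (\sum_(i < n) (t i.+1 - t i) * C)).
      by apply: ler_sum => i _; apply: domnrm.
    rewrite -mulr_suml -(big_mkord xpredT (fun i => t i.+1 - t i)).
    by rewrite telescope_sumr// subr0 ler_piMl//; case/andP: (t01 n).
  have sumy n : \sum_(i < n) (y i.+1 - y i) = y n.
    by rewrite -(big_mkord xpredT (fun i => y i.+1 - y i)) telescope_sumr// subr0.
  by exists l; move: hl; under eq_cvg do rewrite sumy.
have hl1 : nlim (fun n => y n.+1) l.
  by move: hl; rewrite /nlim -(cvg_shiftS (fun n => nrm (y n - l))).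
exists l; last first.
  move=> P P0 PS Pl; apply: (Pl y) => // n; elim: n => // n ih; exact: PS.
have hs : nlim (fun n => y n ^+ 2) (l ^+ 2).
  have nb : nlim (fun n => (y n - l) * y n + l * y n) (0 * l + l * l).
    apply: nlimD; last exact: nlimMl.
    rewrite mul0r; apply: (@nlim_squeeze _ _ (fun n => nrm (y n - l) * C)).
      move=> n; rewrite subr0; apply: (le_trans (cnrmM Hnrm _ _)).
      rewrite ler_wpM2l ?cnrm_ge0//; apply: (le_trans (domnrm _ _ (domy n))).
      by rewrite ler_piMl//; case/andP: (t01 n).
    by rewrite -(mul0r C); apply: cvgMl; exact: hl.
  move: nb; rewrite mul0r add0r -expr2; congr nlim; apply/funext => n.
  by rewrite -mulrDl subrK expr2.
have h2 : nlim (fun n => y n.+1 + y n.+1) (l + l) by apply: nlimD.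
rewrite mulr2n; apply: nlim_uniq h2 _.
have := nlimD (nlim_cst x) hs; congr nlim; apply/funext => n.
rewrite /y iterS -/(y n) -scalerDl.
have -> : 2^-1 + 2^-1 = 1 :> R[i] by rewrite [RHS]splitr div1r.
by rewrite scale1r.
Qed.

End complete_norm.

(** * Hermitian Banach *-algebras *)

Record involution (R : realType) (B : algType R[i]) (star : B -> B) : Prop :=
  Involution {
  invoD : forall x y, star (x + y) = star x + star y;
  invoZ : forall z x, star (z *: x) = z^* *: star x;
  invoM : forall x y, star (x * y) = star y * star x;
  invoK : forall x, star (star x) = x }.

Section hermitian.
Variables (R : realType) (B : algType R[i]) (nrm : B -> R) (star : B -> B).
Hypothesis Hnrm : complete_norm nrm.
Hypothesis Hstar : involution star.
Hypothesis nrm_star : forall x, nrm (star x) = nrm x.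
Hypothesis herm : forall h, star h = h ->
  forall z : R[i], complex.Im z != 0 -> invertible (h - z%:A).
Implicit Types (x y a h k : B) (z : R[i]) (q : R).

Local Notation "x ^#" := (star x) (at level 2, format "x ^#").

Lemma invo1 : 1^# = 1.
Proof. by rewrite -{2}(invoK Hstar 1) -{2}[1^#]mulr1 (invoM Hstar) (invoK Hstar) mulr1. Qed.

Lemma invo0 : 0^# = 0.
Proof. by rewrite -(scale0r 0) (invoZ Hstar) conjC0 !scale0r. Qed.

Lemma invoN x : (- x)^# = - x^#.
Proof. by rewrite -scaleN1r (invoZ Hstar) rmorphN1 scaleN1r. Qed.

Lemma invoB x y : (x - y)^# = x^# - y^#.
Proof. by rewrite (invoD Hstar) invoN. Qed.

Lemma invo_real (r : R) x : (r%:C%C *: x)^# = r%:C%C *: x^#.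
Proof. by rewrite (invoZ Hstar) conjC_real_complex. Qed.

Lemma invoX x n : (x ^+ n)^# = x^# ^+ n.
Proof. by elim: n => [|n ih]; rewrite ?expr0 ?invo1// exprS (invoM Hstar) ih -exprSr. Qed.

Lemma invo_inv x y : x * y = 1 -> y * x = 1 -> x^# = x -> y^# = y.
Proof.
move=> xy yx xx; have : y^# * x = 1 by rewrite -{1}xx -(invoM Hstar) xy invo1.
by move=> h; rewrite -[LHS]mulr1 -xy mulrA h mul1r.
Qed.

(** With [k ^+ 2 = 1 - a^# * a] and [k] self-adjoint,
    [(1 + a^#) * (1 - a) = k * (1 + s) * k] for a skew-adjoint [s], and [1 + s]
    is invertible in a hermitian algebra. *)
Let ptak_left a q : 0 <= q < 1 -> pow_le nrm (a^# * a) q ->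
  exists b, b * (1 - a) = 1.
Proof.
move=> q01 hq; set x := a^# * a in hq *.
have xx : x^# = x by rewrite /x (invoM Hstar) (invoK Hstar).
have [y hy Py] := sqrt_iteration Hnrm q01 hq.
have yy : y^# = y.
  apply: (Py (fun y => y^# = y)); first exact: invo0.
    move=> b bb; rewrite (invoZ Hstar) (invoD Hstar) xx invoX bb.
    by rewrite rmorphV ?unitfE ?pnatr_eq0// rmorph_nat.
  move=> u l hu hl; apply: (nlim_uniq Hnrm _ hl).
  apply: (nlim_squeeze Hnrm _ hl) => n.
  by rewrite -{1}hu -invoB nrm_star.
set k := 1 - y.
have kk : k^# = k by rewrite /k invoB invo1 yy.
have k2 : k * k = 1 - x.
  rewrite /k mulrBl !mulrBr mul1r mulr1 mul1r -expr2.
  by rewrite opprB addrA addrAC -(addrA 1) -opprD -mulr2n hy opprD addrA subrK.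
clearbody k; have [g [g1 g2]] : invertible k.
  by apply: (@invertible_commM _ _ _ k) => //; rewrite k2; exact: (neumann Hnrm q01 hq).
have gg := invo_inv g1 g2 kk.
set s := g * (a^# - a) * g.
have ss : s^# = - s.
  rewrite /s !(invoM Hstar) gg invoB (invoK Hstar) mulrA.
  by rewrite -mulNr -mulrN opprB.
have [c [_ c2]] : invertible (1 + s).
  have : invertible ('i%C *: s - (- 'i%C)%:A).
    apply: herm; last by rewrite /= oppr_eq0 oner_eq0.
    rewrite (invoZ Hstar) ss scalerN -scaleNr; congr (_ *: _).
    by apply/eqP; rewrite eq_complex /= oppr0 opprK !eqxx.
  rewrite scaleNr opprK addrC -scalerDr; apply: (iffLR (invertibleZE _ _)).
  by rewrite eq_complex /= oner_eq0 andbF.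
have e : (1 + a^#) * (1 - a) = k * (1 + s) * k.
  have -> : k * (1 + s) * k = 1 - x + (a^# - a).
    by rewrite mulrDr mulr1 mulrDl k2 /s !mulrA g1 mul1r -!mulrA g2 mulr1.
  by rewrite mulrBr mulr1 mulrDl mul1r -/x opprD addrA [RHS]addrAC addrA.
exists (g * c * g * (1 + a^#)).
by rewrite -(mulrA _ (1 + _)) e -!mulrA (mulrA g k) g2 mul1r (mulrA c) c2 mul1r g2.
Qed.

Lemma ptak_invertible a q : 0 <= q < 1 -> spr_le (a^# * a) q -> invertible (1 - a).
Proof.
move=> /andP[q0 q1] hq.
pose p := (q + 1) / 2.
have [p01 qp] : 0 <= p < 1 /\ q < p by rewrite /p; split; lra.
have hp : pow_le nrm (a^# * a) p by apply: (gelfand Hnrm) hq; rewrite q0.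
have hp' : pow_le nrm (a^#^# * a^#) p.
  rewrite (invoK Hstar); apply: (gelfand Hnrm) (spr_le_swap q0 hq).
  by rewrite q0.
have [b hb] := ptak_left p01 hp; have [c hc] := ptak_left p01 hp'.
apply: (invertible_lr hb (b := c^#)).
by have := congr1 star hc; rewrite (invoM Hstar) invoB (invoK Hstar) invo1.
Qed.

Lemma ptak_spr_le a q : 0 <= q -> spr_le (a^# * a) (q ^+ 2) -> spr_le a q.
Proof.
move=> q0 h z hz; have z0 : 0 < cabs z by exact: le_lt_trans hz.
have zN0 : z != 0 by rewrite -cabs_gt0.
have -> : a - z%:A = (- z) *: (1 - z^-1 *: a).
  by rewrite scalerBr scalerA mulNr divff// scaleN1r scaleNr opprK addrC.
apply: invertibleZ; first by rewrite oppr_eq0.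
apply: (@ptak_invertible _ ((q / cabs z) ^+ 2)).
  rewrite sqr_ge0 expr_lt1// ?divr_ge0 ?cabs_ge0//.
  by rewrite ltr_pdivrMr// mul1r.
rewrite (invoZ Hstar) -scalerAl -scalerAr scalerA.
have -> : (q / cabs z) ^+ 2 = cabs ((z^-1)^* * z^-1) * q ^+ 2.
  by rewrite cabsM cabs_conj cabsV exprMn -expr2 mulrC.
by apply: spr_leZ => //; rewrite sqr_ge0.
Qed.

(** Iterating [ptak_spr_le], with [u * v] and [u ^+ 2 * v ^+ 2] in place of [a]
    and [a^# * a] up to a cyclic permutation, reduces the claim to the obvious
    bound on [u ^+ (2 ^ n) * v ^+ (2 ^ n)]. *)
Lemma spr_leM u v p q : 0 <= p -> 0 <= q -> u^# = u -> v^# = v ->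
  spr_le u p -> spr_le v q -> spr_le (u * v) (p * q).
Proof.
move=> p0 q0 uu vv hu hv z hz.
have [p' [q' [pp' qq' pqz]]] : exists p' q', [/\ p < p', q < q' & p' * q' < cabs z].
  pose e := (cabs z - p * q) / (2 * (p + q + cabs z - p * q + 1)).
  have D0 : 0 < 2 * (p + q + cabs z - p * q + 1) by lra.
  have zpq : 0 < cabs z - p * q by rewrite subr_gt0.
  have e0 : 0 < e by rewrite divr_gt0.
  have e1 : e <= 1 by rewrite ler_pdivrMr//; lra.
  exists (p + e), (q + e); rewrite !ltrDl e0; split => //.
  have he : e * (2 * (p + q + cabs z - p * q + 1)) = cabs z - p * q.
    by rewrite /e divfK// gt_eqF.
  nra.
have p'0 : 0 < p' by exact: le_lt_trans pp'.
have q'0 : 0 < q' by exact: le_lt_trans qq'.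
have [|C hC] := gelfand Hnrm _ hu (q' := p'); first by rewrite p0.
have [|D hD] := gelfand Hnrm _ hv (q' := q'); first by rewrite q0.
pose w := p' * q'; have w0 : 0 < w by rewrite mulr_gt0.
pose W := (w + cabs z) / 2.
have [wW Wz] : w < W /\ W < cabs z by rewrite /W /w; split; lra.
have W0 : 0 < W by exact: lt_trans wW.
have [n hn] : exists n, nrm (u ^+ (2 ^ n) * v ^+ (2 ^ n)) <= W ^+ (2 ^ n).
  have : geometric (C * D) (w / W) @ \oo --> (0 : R).
    have r0 : 0 <= w / W by apply: divr_ge0; exact: ltW.
    by apply: cvg_geometric; rewrite ger0_norm// ltr_pdivrMr// mul1r.
  move=> /cvgrPdist_le/(_ 1 ltr01)[n _ hn]; exists n.
  have /= := hn (2 ^ n)%N (ltnW (ltn_expl n (ltnSn 1))).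
  rewrite sub0r normrN => h.
  apply: (le_trans (cnrmM Hnrm _ _)).
  apply: (@le_trans _ _ ((C * p' ^+ (2 ^ n)) * (D * q' ^+ (2 ^ n)))).
    by apply: ler_pM; rewrite ?(cnrm_ge0 Hnrm).
  have -> : C * p' ^+ (2 ^ n) * (D * q' ^+ (2 ^ n)) =
      C * D * (w / W) ^+ (2 ^ n) * W ^+ (2 ^ n).
    by rewrite -[RHS]mulrA -exprMn divfK ?gt_eqF// /w exprMn; ring.
  rewrite -[leRHS]mul1r ler_wpM2r ?exprn_ge0 ?(ltW W0)//.
  by apply: le_trans h; exact: ler_norm.
have base : spr_le (u ^+ (2 ^ n) * v ^+ (2 ^ n)) (W ^+ (2 ^ n)).
  apply: (spr_le_trans hn); exact: (spr_le_nrm Hnrm).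
suff : spr_le (u * v) W by apply.
elim: n base {hn} => [|n ih]; first by rewrite expn0 !expr1.
set m := (2 ^ n)%N in ih *; have -> : (2 ^ n.+1 = m * 2)%N by rewrite expnSr.
rewrite !exprM => h; apply: ih; apply: ptak_spr_le; first by rewrite exprn_ge0 ?ltW.
rewrite (invoM Hstar) !invoX uu vv -mulrA (mulrA (u ^+ m)) -expr2.
apply: spr_le_swap; first by rewrite sqr_ge0.
by rewrite -mulrA -expr2.
Qed.

Definition pos h := forall z, ~~ (0 <= z) -> invertible (h - z%:A).

Lemma posZ (r : R) h : 0 < r -> pos h -> pos (r%:C%C *: h).
Proof.
move=> r0 hh z z0; have rN0 : r%:C%C != 0 :> R[i] by rewrite eq_complex /= gt_eqF.
have -> : r%:C%C *: h - z%:A = r%:C%C *: (h - (r%:C%C^-1 * z)%:A).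
  by rewrite scalerBr scalerA mulrA divff// mul1r.
apply: invertibleZ => //; apply: hh; apply: contra z0 => h0.
by rewrite -(@pmulr_rge0 _ (r%:C%C^-1))// invr_gt0 ltcR.
Qed.

Lemma herm_pos h : h^# = h -> (forall t : R, 0 < t -> invertible (h + t%:C%C%:A)) -> pos h.
Proof.
move=> hh hp z z0; have [zr|] := eqVneq (complex.Im z) 0; last exact: herm.
have -> : z = - (- complex.Re z)%:C%C.
  by move: zr; case: z {z0} => a b /= ->; rewrite rmorphN opprK.
rewrite scaleNr opprK; apply: hp; rewrite oppr_gt0 ltNge; apply: contra z0.
by rewrite lecE zr eqxx.
Qed.

Lemma spr_le_pos h (r : R) : 0 <= r -> pos h -> pos (r%:C%C%:A - h) -> spr_le h r.
Proof.
move=> r0 h0 hr z hz; have [z0|/h0//] := boolP (0 <= z).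
have zE := cabs_ger0 z0.
have -> : h - z%:A = - ((r%:C%C%:A - h) - (r%:C%C - z)%:A).
  by rewrite !opprB scalerBl [RHS]addrC addrA subrK.
apply: invertibleN; apply: hr.
by rewrite zE -rmorphB lecR subr_ge0 -ltNge.
Qed.

Lemma spr_le_posB h (r : R) : 0 <= r -> h^# = h -> spr_le h r ->
  pos (r%:C%C%:A - h).
Proof.
move=> r0 hh hr; apply: herm_pos.
  by rewrite invoB invo_real invo1 hh.
move=> t t0.
have -> : r%:C%C%:A - h + t%:C%C%:A = - (h - (r + t)%:C%C%:A).
  by rewrite opprB rmorphD scalerDl addrAC.
apply: invertibleN; apply: hr; rewrite cabs_real gtr0_norm ?ltrDl//.
by rewrite ltr_wpDl.
Qed.

Let pos_quotient h : h^# = h -> pos h -> exists g q,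
  [/\ (1 + h) * g = 1, g * (1 + h) = 1, 0 <= q < 1,
      (h * g)^# = h * g & spr_le (h * g) q].
Proof.
move=> hh h0.
have [g [g1 g2]] : invertible (1 + h).
  have := h0 (-1); rewrite scaleN1r opprK addrC; apply.
  by rewrite oppr_ge0 ler10.
have gg := invo_inv g1 g2 _.
have {}gg : g^# = g by apply: gg; rewrite (invoD Hstar) invo1 hh.
have hg : h * g = g * h.
  have e : h * (1 + h) = (1 + h) * h by rewrite mulrDr mulrDl mulr1 mul1r.
  by rewrite -[LHS]mul1r -g2 -mulrA (mulrA _ h) -e -!mulrA g1 mulr1.
pose r := nrm h; have r0 : 0 <= r by exact: (cnrm_ge0 Hnrm).
exists g, (r / (1 + r)); split => //.
- by rewrite divr_ge0 ?addr_ge0//= ltr_pdivrMr ?ltr_wpDr// mul1r ltrDr.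
- by rewrite (invoM Hstar) gg hh hg.
move=> z hz.
have -> : h * g - z%:A = ((1 - z) *: h - z%:A) * g.
  have {1}-> : z%:A = z *: (1 + h) * g by rewrite -scalerAl g1.
  rewrite -mulrBl; congr (_ * g).
  by rewrite scalerDr scalerBl scale1r opprD addrA addrAC.
have ig : invertible g by exists (1 + h).
apply: invertibleM => //; have [->|z1] := eqVneq z 1.
  rewrite subrr scale0r sub0r scale1r; apply: invertibleN.
  by exists 1; rewrite mulr1.
have z1' : 1 - z != 0 by rewrite subr_eq0 eq_sym.
have -> : (1 - z) *: h - z%:A = (1 - z) *: (h - (z / (1 - z))%:A).
  by rewrite scalerBr scalerA mulrC divfK.
apply: invertibleZ => //; set w := z / (1 - z).
have [w0|/h0//] := boolP (0 <= w).
apply: (spr_le_nrm Hnrm); rewrite -/r.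
have zw : z * (1 + w) = w by rewrite /w; field.
have wE := cabs_ger0 w0; move: (cabs_ge0 w) zw wE; set t := cabs w => t0 zw wE.
have : cabs z * (1 + t) = t.
  have := congr1 (@cabs R) zw; rewrite cabsM {2}wE cabs_real ger0_norm//.
  by rewrite wE -[1 in X in X = _ -> _](rmorph1 (real_complex R)) -rmorphD cabs_real ger0_norm// addr_ge0.
move: hz; rewrite ltr_pdivrMr ?ltr_wpDr//.
move=> h1 h2; rewrite ltNge; apply/negP.
move: (cabs_ge0 z) r0 t0 h1 h2; move: (cabs z) r t {wE} => c r' t' {}; clear.
move=> c0 r0 t0 h1 h2 tr; have c1 : c < 1 by nra.
nra.
Qed.

(** [1 + h + k = (1 + h) * (1 - u * v) * (1 + k)] with [u = (1 + h)^-1 * h] and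
    [v = k * (1 + k)^-1], both of spectral radius less than [1]. *)
Lemma posD h k : h^# = h -> k^# = k -> pos h -> pos k -> pos (h + k).
Proof.
move=> hh kk h0 k0.
have key h' k' : h'^# = h' -> k'^# = k' -> pos h' -> pos k' ->
    invertible (1 + (h' + k')).
  move=> hh' kk' h0' k0'.
  have [g [q [g1 g2 /andP[q0 q1] gg hq]]] := pos_quotient hh' h0'.
  have [f [p [f1 f2 /andP[p0 p1] ff hp]]] := pos_quotient kk' k0'.
  have ghg : g * h' = h' * g.
    have e : h' * (1 + h') = (1 + h') * h' by rewrite mulrDr mulrDl mulr1 mul1r.
    by rewrite -[RHS]mul1r -g2 -mulrA (mulrA _ h') -e -!mulrA g1 mulr1.
  have -> : 1 + (h' + k') = (1 + h') * (1 - h' * g * (k' * f)) * (1 + k').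
    rewrite -ghg mulrBr mulr1 !mulrA g1 mul1r mulrBl.
    rewrite -(mulrA (h' * k')) f2 mulr1 mulrDl mul1r (mulrDr h') mulr1.
    by rewrite (addrA (1 + k')) addrK addrAC -addrA.
  apply: invertibleM; last by exists f.
  apply: invertibleM; first by exists g.
  have := spr_leM q0 p0 gg ff hq hp; move/(_ 1); rewrite cabs1 scale1r => H.
  by rewrite -opprB; apply: invertibleN; apply: H; nra.
apply: herm_pos; first by rewrite (invoD Hstar) hh kk.
move=> t t0; have tN0 : t%:C%C != 0 :> R[i] by rewrite eq_complex /= gt_eqF.
have -> : h + k + t%:C%C%:A =
    t%:C%C *: (1 + ((t^-1)%:C%C *: h + (t^-1)%:C%C *: k)).
  rewrite -scalerDr (scalerDr t%:C%C) scalerA -rmorphM /= divff ?gt_eqF//.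
  by rewrite scale1r addrC.
apply: invertibleZ => //; apply: key.
- by rewrite invo_real hh.
- by rewrite invo_real kk.
- by apply: posZ; rewrite ?invr_gt0.
- by apply: posZ; rewrite ?invr_gt0.
Qed.

End hermitian.

(** * Operators on Hilbert spaces *)

Section hilbert.
Variables (R : realType) (H : hilbertType R).
Implicit Types (u v w : H) (S T : bop H).

(** The norm of [H] takes its values in the nonnegative reals of [R[i]]. *)
Definition hnorm u : R := cabs `|u|.

Lemma normr_hnorm u : `|u| = (hnorm u)%:C%C.
Proof. exact: cabs_ger0. Qed.

Lemma hnorm_ge0 u : 0 <= hnorm u.
Proof. exact: cabs_ge0. Qed.

Lemma hnormD u v : hnorm (u + v) <= hnorm u + hnorm v.
Proof. by rewrite -lecR rmorphD /= -!normr_hnorm ler_normD. Qed.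

Lemma hnormZ z u : hnorm (z *: u) = cabs z * hnorm u.
Proof. by apply: complexI; rewrite rmorphM /= -!normr_hnorm normrZ normr_cabs. Qed.

Lemma hnorm0 : hnorm 0 = 0.
Proof. by rewrite /hnorm normr0 cabs0. Qed.

Lemma hnorm_eq0 u : (hnorm u == 0) = (u == 0).
Proof. by rewrite /hnorm cabs_eq0 normr_eq0. Qed.

Lemma innerE u : inner u u = (hnorm u ^+ 2)%:C%C.
Proof. by rewrite inner_norm normr_hnorm rmorphXn. Qed.

Lemma innerDl u v w : inner (u + v) w = inner u w + inner v w.
Proof. by rewrite -{1}[u]scale1r inner_linear mul1r. Qed.

Lemma inner0l w : inner 0 w = 0.
Proof. by apply: (addrI (inner 0 w)); rewrite -innerDl !addr0. Qed.

Lemma innerZl z u w : inner (z *: u) w = z * inner u w.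
Proof. by rewrite -{1}[z *: u]addr0 inner_linear inner0l addr0. Qed.

Lemma innerBl u v w : inner (u - v) w = inner u w - inner v w.
Proof. by rewrite innerDl -scaleN1r innerZl mulN1r. Qed.

Lemma innerDr u v w : inner w (u + v) = inner w u + inner w v.
Proof. by rewrite inner_conj innerDl rmorphD /= -!inner_conj. Qed.

Lemma innerZr z u w : inner w (z *: u) = z^* * inner w u.
Proof. by rewrite inner_conj innerZl rmorphM /= -!inner_conj. Qed.

Lemma cauchy_schwarz u v : cabs (inner u v) <= hnorm u * hnorm v.
Proof.
have [->|v0] := eqVneq v 0.
  by rewrite inner_conj inner0l conjC0 cabs0 hnorm0 mulr0.
have hv : 0 < hnorm v by rewrite lt_neqAle hnorm_ge0 andbT eq_sym hnorm_eq0.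
set t := inner u v; set n := hnorm v.
have : inner (n%:C%C ^+ 2 *: u - t *: v) (n%:C%C ^+ 2 *: u - t *: v) =
   (n ^+ 2 * (n ^+ 2 * hnorm u ^+ 2 - cabs t ^+ 2))%:C%C.
  have nn : (n%:C%C ^+ 2 : R[i])^* = n%:C%C ^+ 2.
    by rewrite rmorphXn /= conjC_real_complex.
  rewrite innerBl !innerZl -[- (t *: v)]scaleNr !innerDr !innerZr !innerE.
  rewrite (inner_conj u v) -/t -/n nn (rmorphN Num.conj).
  rewrite [RHS](rmorphM (real_complex R)) [in RHS](rmorphB (real_complex R)).
  rewrite [X in _ = _ * (X - _)](rmorphM (real_complex R)) /= -(normCK_cabs t).
  by rewrite !rmorphXn /=; ring.
rewrite innerE => /complexI h.
have : 0 <= n ^+ 2 * (n ^+ 2 * hnorm u ^+ 2 - cabs t ^+ 2) by rewrite -h sqr_ge0.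
rewrite pmulr_rge0 ?exprn_gt0// subr_ge0 -exprMn ler_pXn2r ?nnegrE ?cabs_ge0//.
  by rewrite mulrC.
by rewrite mulr_ge0 ?hnorm_ge0.
Qed.

Lemma bop_linear T : linear T.
Proof. by have /asboolP[] := bop_valP T. Qed.

Lemma bop_continuous T : continuous T.
Proof. by have /asboolP[] := bop_valP T. Qed.

Lemma bopD T u v : T (u + v) = T u + T v.
Proof. by rewrite -{1}[u]scale1r bop_linear scale1r. Qed.

Lemma bop0 T : T 0 = 0.
Proof. by apply: (addrI (T 0)); rewrite -bopD !addr0. Qed.

Lemma bopZ T z u : T (z *: u) = z *: T u.
Proof. by rewrite -{1}[z *: u]addr0 bop_linear bop0 addr0. Qed.

Lemma bop_ext S T : S =1 T -> S = T.
Proof. by move=> h; apply: val_inj; apply/funext. Qed.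

Lemma bop_bounded T : exists2 C, 0 <= C & forall u, hnorm (T u) <= C * hnorm u.
Proof.
have /cvgrPdist_lt/(_ 1 ltr01) := @bop_continuous T 0.
rewrite bop0 => /nbhs_norm0P[/= e e0 he].
have eE := cabs_ger0 (ltW e0); set d := cabs e in eE.
have d0 : 0 < d by rewrite -ltcR -eE.
exists (2 / d) => [|u]; first by rewrite divr_ge0// ltW.
have [->|u0] := eqVneq u 0; first by rewrite bop0 !hnorm0 mulr0.
have hu : 0 < hnorm u by rewrite lt_neqAle hnorm_ge0 andbT eq_sym hnorm_eq0.
have /= := he ((d / 2 / hnorm u)%:C%C *: u).
rewrite sub0r normrN !normr_hnorm eE !hnormZ bopZ hnormZ cabs_real.
rewrite ger0_norm ?divr_ge0 ?(ltW d0) ?(ltW hu)// divfK ?gt_eqF// ltcR.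
rewrite ltr_pdivrMr// ltr_pMr// ltrDl ltr01 => /(_ isT)/ltW.
rewrite -(rmorph1 (real_complex R)) lecR mulrAC ler_pdivrMr// mul1r => h.
by rewrite mulrAC ler_pdivlMr//; lra.
Qed.

Let has_sup_opnorm T : has_sup [set cabs `|T u| | u in [set u : H | `|u| <= 1]].
Proof.
split; first by exists (hnorm (T 0)), 0; rewrite //= normr0 ler01.
have [C C0 hC] := bop_bounded T; exists C => _ [u /= u1 <-].
rewrite -/(hnorm _); apply: (le_trans (hC u)); rewrite ler_piMr// -lecR -normr_hnorm.
by rewrite (rmorph1 (real_complex R)).
Qed.

Lemma opnorm_ge0 T : 0 <= opnorm T.
Proof.
apply: (@le_trans _ _ (hnorm (T 0))); first exact: hnorm_ge0.
by apply: ub_le_sup; [exact: (has_sup_opnorm T).2|exists 0; rewrite //= normr0 ler01].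
Qed.

Lemma le_opnorm T u : hnorm (T u) <= opnorm T * hnorm u.
Proof.
have [->|u0] := eqVneq u 0; first by rewrite bop0 !hnorm0 mulr0.
have hu : 0 < hnorm u by rewrite lt_neqAle hnorm_ge0 andbT eq_sym hnorm_eq0.
rewrite -ler_pdivrMr//; apply: ub_le_sup; first exact: (has_sup_opnorm T).2.
exists (((hnorm u)^-1)%:C%C *: u) => /=.
  rewrite normr_hnorm hnormZ cabs_real ger0_norm ?invr_ge0 ?(ltW hu)//.
  by rewrite mulVf ?gt_eqF.
by rewrite -/(hnorm _) bopZ hnormZ cabs_real ger0_norm ?invr_ge0 ?(ltW hu)// mulrC.
Qed.

Lemma opnorm_le T C : 0 <= C -> (forall u, hnorm (T u) <= C * hnorm u) ->
  opnorm T <= C.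
Proof.
move=> C0 hC; apply: sup_le_ub; first exact: (has_sup_opnorm T).1.
move=> _ [u /= u1 <-]; rewrite -/(hnorm _); apply: (le_trans (hC u)).
by rewrite ler_piMr// -lecR -normr_hnorm (rmorph1 (real_complex R)).
Qed.

Lemma opnorm0_eq0 T : opnorm T = 0 -> T = 0.
Proof.
move=> h; apply: bop_ext => u; apply/eqP.
rewrite -[X in _ == X]/(0 : H) -hnorm_eq0.
by rewrite eq_le hnorm_ge0 andbT; have := le_opnorm T u; rewrite h mul0r.
Qed.

Lemma opnormD S T : opnorm (S + T) <= opnorm S + opnorm T.
Proof.
apply: opnorm_le => [|u]; first by rewrite addr_ge0 ?opnorm_ge0.
rewrite -[(S + T) u]/(S u + T u); apply: (le_trans (hnormD _ _)).
by rewrite mulrDl lerD ?le_opnorm.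
Qed.

Lemma opnormZ z T : opnorm (z *: T) = cabs z * opnorm T.
Proof.
have le (w : R[i]) (S : bop H) : opnorm (w *: S) <= cabs w * opnorm S.
  apply: opnorm_le => [|u]; first by rewrite mulr_ge0 ?cabs_ge0 ?opnorm_ge0.
  by rewrite -[(w *: S) u]/(w *: S u) hnormZ -mulrA ler_wpM2l ?cabs_ge0 ?le_opnorm.
apply/eqP; rewrite eq_le le /=; have [->|z0] := eqVneq z 0.
  by rewrite cabs0 mul0r opnorm_ge0.
rewrite -ler_pdivlMl ?cabs_gt0// -cabsV; have := le z^-1 (z *: T).
by rewrite scalerA mulVf// scale1r.
Qed.

Lemma opnormM S T : opnorm (bop_comp S T) <= opnorm S * opnorm T.
Proof.
apply: opnorm_le => [|u]; first by rewrite mulr_ge0 ?opnorm_ge0.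
apply: (le_trans (le_opnorm S (T u))); rewrite -mulrA.
by rewrite ler_wpM2l ?opnorm_ge0 ?le_opnorm.
Qed.

Definition adjoint S T := forall u v, inner (S u) v = inner u (T v).

Lemma adjointC S T : adjoint S T -> adjoint T S.
Proof. by move=> h u v; rewrite inner_conj -h -inner_conj. Qed.

Lemma adjoint_norm S T : adjoint S T -> opnorm S <= opnorm T.
Proof.
move=> h; apply: opnorm_le => [|u]; first exact: opnorm_ge0.
have [S0|S0] := eqVneq (hnorm (S u)) 0.
  by rewrite S0 mulr_ge0 ?opnorm_ge0 ?hnorm_ge0.
have hS : 0 < hnorm (S u) by rewrite lt_neqAle hnorm_ge0 andbT eq_sym.
rewrite -(ler_pM2r hS) -expr2.
have := cauchy_schwarz u (T (S u)); rewrite -h innerE cabs_real ger0_norm ?sqr_ge0//.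
move=> k; apply: (le_trans k); rewrite mulrC mulrAC ler_wpM2r ?hnorm_ge0//.
exact: le_opnorm.
Qed.

Lemma adjoint_sqr S T u : adjoint S T ->
  hnorm (T u) ^+ 2 = cabs (inner (S (T u)) u) /\
  inner (S (T u)) u = (hnorm (T u) ^+ 2)%:C%C.
Proof.
by move=> h; rewrite h innerE; split => //; rewrite cabs_real ger0_norm ?sqr_ge0.
Qed.

Lemma opnorm_cstar S T : adjoint S T -> opnorm (bop_comp S T) = opnorm T ^+ 2.
Proof.
move=> h; apply/eqP; rewrite eq_le; apply/andP; split.
  apply: (le_trans (opnormM S T)).
  by rewrite expr2 ler_wpM2r ?opnorm_ge0 ?adjoint_norm.
have ST0 := opnorm_ge0 (bop_comp S T).
have : opnorm T <= Num.sqrt (opnorm (bop_comp S T)).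
  apply: opnorm_le => [|u]; first by rewrite sqrtr_ge0.
  rewrite -(ler_pXn2r (n := 2)) ?nnegrE ?hnorm_ge0//; last first.
    by rewrite mulr_ge0 ?sqrtr_ge0 ?hnorm_ge0.
  rewrite (adjoint_sqr u h).1 exprMn sqr_sqrtr// expr2 mulrA.
  apply: (le_trans (cauchy_schwarz _ _)); rewrite ler_wpM2r ?hnorm_ge0//.
  exact: (le_opnorm (bop_comp S T)).
by rewrite -(ler_pXn2r (n := 2)) ?nnegrE ?opnorm_ge0 ?sqrtr_ge0// sqr_sqrtr.
Qed.

(** For a unit vector [u] with [hnorm (T u)] close to [opnorm T], [u] is almost
    an eigenvector of [S T] for the value [opnorm T ^+ 2]. *)
Lemma opnorm_spectrum S T : adjoint S T ->
  ainvertible (@bop_comp R H) (bop_id H)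
    (bop_comp S T - (opnorm T ^+ 2)%:C%C *: bop_id H) ->
  opnorm T = 0.
Proof.
move=> h [W [_ hW]]; apply/eqP; rewrite -[_ == 0]negbK; apply/negP => T0.
have hT : 0 < opnorm T by rewrite lt_neqAle opnorm_ge0 andbT eq_sym.
set C := opnorm T ^+ 2 in hW; have C0 : 0 < C by rewrite exprn_gt0.
pose D := (opnorm W ^+ 2 + 1) * C; have D0 : 0 < D by rewrite mulr_gt0// ltr_wpDl ?sqr_ge0.
have key u : hnorm u ^+ 2 <= D * (C * hnorm u ^+ 2 - hnorm (T u) ^+ 2).
  set v := S (T u) - C%:C%C *: u.
  have uv : hnorm u <= opnorm W * hnorm v.
    have <- : W v = u by have := congr1 (fun f : bop H => f u) hW.
    exact: le_opnorm.
  have hv : hnorm v ^+ 2 <= C * (C * hnorm u ^+ 2 - hnorm (T u) ^+ 2).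
    have sw : hnorm (S (T u)) ^+ 2 <= C * hnorm (T u) ^+ 2.
      rewrite -exprMn ler_pXn2r ?nnegrE ?hnorm_ge0 ?mulr_ge0 ?opnorm_ge0 ?hnorm_ge0//.
      apply: (le_trans (le_opnorm _ _)); rewrite ler_wpM2r ?hnorm_ge0//.
      exact: adjoint_norm.
    have : hnorm v ^+ 2 = hnorm (S (T u)) ^+ 2 - 2 * C * hnorm (T u) ^+ 2 + C ^+ 2 * hnorm u ^+ 2.
      apply: complexI; rewrite -innerE /v -[- (_ *: _)]scaleNr.
      rewrite !innerDl !innerDr !innerZl !innerZr (inner_conj (S (T u)) u).
      rewrite (adjoint_sqr u h).2 !innerE conjC_real_complex.
      rewrite (rmorphN Num.conj) /= conjC_real_complex.
      by apply/eqP; rewrite eq_complex /=; apply/andP; split; apply/eqP; ring.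
    by nra.
  have : hnorm u ^+ 2 <= opnorm W ^+ 2 * hnorm v ^+ 2.
    by rewrite -exprMn ler_pXn2r ?nnegrE ?mulr_ge0 ?hnorm_ge0 ?opnorm_ge0.
  move=> /le_trans; apply.
  apply: (@le_trans _ _ ((opnorm W ^+ 2 + 1) * hnorm v ^+ 2)).
    by rewrite ler_wpM2r ?sqr_ge0// lerDl.
  by rewrite /D -mulrA ler_wpM2l// addr_ge0 ?sqr_ge0.
have {}key u : hnorm (T u) ^+ 2 <= (C - D^-1) * hnorm u ^+ 2.
  have := key u; rewrite mulrC -ler_pdivrMr// mulrBl; lra.
have CD : 0 <= C - D^-1.
  rewrite leNgt; apply/negP => CD0.
  have : opnorm T <= 0.
    apply: opnorm_le => // u; rewrite mul0r.
    rewrite -(ler_pXn2r (n := 2)) ?nnegrE ?hnorm_ge0// expr0n /=.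
    have := key u; have := sqr_ge0 (hnorm (T u)); have := sqr_ge0 (hnorm u).
    nra.
  by rewrite leNgt hT.
have : opnorm T <= Num.sqrt (C - D^-1).
  apply: opnorm_le => [|u]; first exact: sqrtr_ge0.
  rewrite -(ler_pXn2r (n := 2)) ?nnegrE ?hnorm_ge0//; last first.
    by rewrite mulr_ge0 ?sqrtr_ge0 ?hnorm_ge0.
  by rewrite exprMn sqr_sqrtr.
rewrite -(ler_pXn2r (n := 2)) ?nnegrE ?opnorm_ge0 ?sqrtr_ge0// sqr_sqrtr// -/C.
by rewrite leNgt ltrBlDr ltrDl invr_gt0 D0.
Qed.

End hilbert.

(** The space on which a representation whose unit acts as a projection [p]
    becomes unital. *)
Section fixed_space.
Variables (R : realType) (H : hilbertType R) (p : bop H).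

Definition fixed_pred : {pred H} := fun v => p v == v.

Fact fixed_submod_closed : submod_closed fixed_pred.
Proof.
split=> [|z u v /eqP hu /eqP hv]; rewrite unfold_in; first by rewrite bop0.
by rewrite bopD bopZ hu hv.
Qed.

HB.instance Definition _ := GRing.isSubmodClosed.Build R[i] H
  fixed_pred fixed_submod_closed.

Record fixed_space := FixedSpace {
  fixed_val :> H;
  fixed_valP : fixed_val \in fixed_pred }.

HB.instance Definition _ := [isSub for fixed_val].
HB.instance Definition _ := [Choice of fixed_space by <:].
HB.instance Definition _ := [SubChoice_isSubLmodule of fixed_space by <:].

Definition fixed_norm (v : fixed_space) : R[i] := `|fixed_val v|.

Fact fixed_normD u v : fixed_norm (u + v) <= fixed_norm u + fixed_norm v.
Proof. exact: ler_normD. Qed.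
Fact fixed_normZ z v : fixed_norm (z *: v) = `|z| * fixed_norm v.
Proof. exact: normrZ. Qed.
Fact fixed_norm0_eq0 v : fixed_norm v = 0 -> v = 0.
Proof. by move=> /normr0_eq0 h; apply: val_inj. Qed.

HB.instance Definition _ := Lmodule_isNormed.Build R[i] fixed_space
  fixed_normD fixed_normZ fixed_norm0_eq0.

Lemma fixed_val_continuous : continuous (fixed_val : fixed_space -> H).
Proof.
move=> u; apply/(@cvgrPdist_lt _ _ _ (nbhs u) (nbhs_filter u)) => e e0.
have /(@cvgrPdist_lt _ _ _ (nbhs u) (nbhs_filter u))/(_ e e0) :=
  @cvg_id _ (nbhs u).
exact.
Qed.

Fact fixed_complete (F : set_system fixed_space) :
  ProperFilter F -> cauchy F -> cvg F.
Proof.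
move=> FF /cauchy_ballP cF.
have : cvg ((fixed_val : fixed_space -> H) @ F).
  apply: cauchy_cvg; apply/cauchy_ballP => e e0.
  have /= := cF e e0; rewrite !near_simpl /=.
  move=> h; apply: filterS h => -[u v] /=.
  by rewrite -!ball_normE.
move=> /cvg_ex[l hl].
have pl : l \in fixed_pred.
  rewrite unfold_in; apply/eqP; have pF : p (fixed_val v) @[v --> F] --> p l.
    have pc : {for l, continuous p} by exact: bop_continuous.
    exact: (continuous_cvg _ pc hl).
  apply: (cvg_unique (@norm_hausdorff _ H) pF); apply: cvg_trans hl.
  apply: near_eq_cvg; apply: nearW => v.
  by have := fixed_valP v; rewrite unfold_in => /eqP/esym.
apply/cvg_ex; exists (FixedSpace pl).
apply/cvgrPdist_lt => e e0.
by move/cvgrPdist_lt: hl => /(_ e e0).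
Qed.

HB.instance Definition _ := Uniform_isComplete.Build fixed_space fixed_complete.

Definition fixed_inner (u v : fixed_space) := inner (fixed_val u) (fixed_val v).

Fact fixed_inner_linear z u v w :
  fixed_inner (z *: u + v) w = z * fixed_inner u w + fixed_inner v w.
Proof. exact: inner_linear. Qed.
Fact fixed_inner_conj u v : fixed_inner v u = (fixed_inner u v)^*.
Proof. exact: inner_conj. Qed.
Fact fixed_inner_norm (u : fixed_space) : fixed_inner u u = `|u| ^+ 2.
Proof. exact: inner_norm. Qed.

HB.instance Definition _ := isHilbert.Build R fixed_space
  fixed_inner_linear fixed_inner_conj fixed_inner_norm.

End fixed_space.

(** * Algebras with a faithful *-representation *)

Record star_axioms (R : realType) (A : starAlg R) : Prop := StarAxioms {
  amulA : forall a b c : A, amul a (amul b c) = amul (amul a b) c;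
  amulDl : forall a b c : A, amul (a + b) c = amul a c + amul b c;
  amulDr : forall a b c : A, amul a (b + c) = amul a b + amul a c;
  amulZl : forall z (a b : A), amul (z *: a) b = z *: amul a b;
  amulZr : forall z (a b : A), amul a (z *: b) = z *: amul a b;
  astarD : forall a b : A, astar (a + b) = astar a + astar b;
  astarZ : forall z (a : A), astar (z *: a) = z^* *: astar a;
  astarM : forall a b : A, astar (amul a b) = amul (astar b) (astar a);
  astarK : forall a : A, astar (astar a) = a;
  astar_mul_eq0 : forall a : A, amul (astar a) a = 0 -> a = 0 }.

Section faithful.
Variables (R : realType) (A : starAlg R) (H : hilbertType R) (pi : starRep A H).
Hypothesis pi_inj : injective pi.

Let adj_inj (S T S' : bop H) : adjoint S T -> adjoint S' T -> S = S'.
Proof.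
move=> h h'; apply: bop_ext => u; apply/eqP; rewrite -subr_eq0 -hnorm_eq0.
rewrite -sqrf_eq0 -(inj_eq (@complexI R)) -innerE innerBl h h'.
by rewrite -innerBl subrr inner0l.
Qed.

Let piadj a : adjoint (pi (astar a)) (pi a).
Proof. by move=> u v; exact: starRep_adj. Qed.

Lemma faithful_star_axioms : star_axioms A.
Proof.
split=> [a b c|a b c|a b c|z a b|z a b|a b|z a|a b|a|a h]; apply: pi_inj.
- by rewrite !starRepM; apply: bop_ext.
- by rewrite starRepM !raddfD /= !starRepM; apply: bop_ext.
- rewrite starRepM !raddfD /= !starRepM; apply: bop_ext => u.
  by rewrite /= -[RHS]/(_ + _) bopD.
- by rewrite starRepM !linearZ /= starRepM; apply: bop_ext.
- rewrite starRepM !linearZ /= starRepM; apply: bop_ext => u.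
  by rewrite /= bopZ.
- apply: adj_inj (piadj _) _ => u v; rewrite !raddfD /=.
  by rewrite -[X in inner X _]/(_ + _) innerDl !piadj -innerDr.
- apply: adj_inj (piadj _) _ => u v; rewrite !linearZ /=.
  by rewrite -[X in inner X _]/(_ *: _) innerZl piadj -[RHS]/(inner u (_ *: _)) innerZr.
- apply: adj_inj (piadj _) _ => u v; rewrite !starRepM /=.
  by rewrite !piadj.
- by apply: adj_inj (piadj _) (adjointC (piadj _)).
- rewrite raddf0; apply: opnorm0_eq0.
  apply/eqP; rewrite -sqrf_eq0 -(opnorm_cstar (piadj _)) -starRepM h raddf0.
  rewrite eq_le opnorm_ge0 andbT; apply: opnorm_le => // u.
  by rewrite hnorm0 mul0r.
Qed.

End faithful.

Section star_axioms.
Variables (R : realType) (A : starAlg R) (HA : star_axioms A).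

Lemma amul0l (a : A) : amul 0 a = 0.
Proof. by have := amulZl HA 0 0 a; rewrite !scale0r. Qed.

Lemma amul0r (a : A) : amul a 0 = 0.
Proof. by have := amulZr HA 0 a 0; rewrite !scale0r. Qed.

Lemma amulBl (a b c : A) : amul (a - b) c = amul a c - amul b c.
Proof. by rewrite (amulDl HA) -scaleN1r (amulZl HA) scaleN1r. Qed.

Lemma amulBr (a b c : A) : amul a (b - c) = amul a b - amul a c.
Proof. by rewrite (amulDr HA) -scaleN1r (amulZr HA) scaleN1r. Qed.

Lemma astarB (a b : A) : astar (a - b) = astar a - astar b.
Proof.
by rewrite (astarD HA) -scaleN1r (astarZ HA) rmorphN1 scaleN1r.
Qed.

Lemma amul_inj (a b : A) : (forall c, amul c a = amul c b) -> a = b.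
Proof.
move=> h; apply/eqP; rewrite -subr_eq0; apply/eqP/(astar_mul_eq0 HA).
by rewrite amulBr h subrr.
Qed.

Lemma unity_uniq (e e' : A) : is_unity (@amul R A) e ->
  is_unity (@amul R A) e' -> e = e'.
Proof. by move=> h h'; rewrite -(h' e).1 (h e').2. Qed.

Lemma unity_star (e : A) : is_unity (@amul R A) e -> astar e = e.
Proof.
move=> h; apply: unity_uniq (h) => a; split; rewrite -[a in RHS](astarK HA).
  by rewrite -{1}[a](astarK HA) -(astarM HA) (h _).2.
by rewrite -{1}[a](astarK HA) -(astarM HA) (h _).1.
Qed.

End star_axioms.

Section cstar_norm.
Variables (R : realType) (A : starAlg R) (N : A -> R).
Hypothesis HN : cstar_norm N.

Lemma cstar_norm0 : N 0 = 0.
Proof. by rewrite -(scale0r 0) (cstar_normZ HN) cabs0 mul0r. Qed.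

Lemma cstar_norm_ge0 a : 0 <= N a.
Proof.
have := cstar_normD HN a (- a); rewrite subrr cstar_norm0 -scaleN1r.
by rewrite (cstar_normZ HN) cabsN cabs1 mul1r -mulr2n -mulr_natr pmulr_lge0.
Qed.

End cstar_norm.

Lemma opnorm_cstar_norm (R : realType) (A : starAlg R) (H : hilbertType R)
    (pi : starRep A H) : injective pi -> cstar_norm (fun a => opnorm (pi a)).
Proof.
move=> pi_inj; split=> [a b|z a|a|a b|a].
- by rewrite raddfD opnormD.
- by rewrite linearZ opnormZ.
- by move=> /opnorm0_eq0 h; apply: pi_inj; rewrite h raddf0.
- by rewrite starRepM opnormM.
- by rewrite starRepM opnorm_cstar// => u v; exact: starRep_adj.
Qed.

(** * Retracts of *-algebras *)

(** [j] embeds [A] as the ideal of [A'] that is the image of the projection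
    [j \o Q]; the last two hypotheses express this with the fewest products. *)
Section retract.
Variables (R : realType) (A A' : starAlg R).
Variables (j : {linear A -> A'}) (Q : {linear A' -> A}).
Hypothesis jK : cancel j Q.
Hypothesis mulj : forall F g, amul F (j g) = j (amul (Q F) g).
Hypothesis starj : forall f, astar (j f) = j (astar f).
Hypothesis HA' : star_axioms A'.

Let j_inj : injective j := can_inj jK.

Let jM f g : j (amul f g) = amul (j f) (j g).
Proof. by rewrite mulj jK. Qed.

Lemma retract_star_axioms : star_axioms A.
Proof.
split=> [a b c|a b c|a b c|z a b|z a b|a b|z a|a b|a|a h]; apply: j_inj.
- by rewrite !jM (amulA HA').
- by rewrite jM !raddfD /= !jM (amulDl HA').
- by rewrite jM !raddfD /= !jM (amulDr HA').
- by rewrite jM !linearZ /= !jM (amulZl HA').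
- by rewrite jM !linearZ /= !jM (amulZr HA').
- by rewrite -starj !raddfD /= (astarD HA') !starj.
- by rewrite -starj !linearZ /= (astarZ HA') !starj.
- by rewrite -starj !jM (astarM HA') !starj.
- by rewrite -!starj (astarK HA').
- rewrite raddf0; apply: (astar_mul_eq0 HA').
  by rewrite starj -jM h raddf0.
Qed.
Let HA := retract_star_axioms.

(** Taking adjoints in [mulj] gives the other side of the ideal property with
    [Q' G := (Q G^* )^*] in place of [Q], and computing [h * F * g] in two ways
    shows that [Q' = Q]. *)
Let mulj_star f G : amul (j f) G = j (amul f (astar (Q (astar G)))).
Proof.
rewrite -[LHS](astarK HA') (astarM HA') starj mulj starj (astarM HA).
by rewrite (astarK HA).
Qed.

Lemma retract_star F : Q (astar F) = astar (Q F).
Proof.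
suff h : Q F = astar (Q (astar F)) by rewrite h (astarK HA).
have key h g : amul h (amul (Q F) g) = amul h (amul (astar (Q (astar F))) g).
  apply: j_inj; rewrite jM -mulj (amulA HA') mulj_star -jM.
  by rewrite (amulA HA).
have key2 g : amul (Q F) g = amul (astar (Q (astar F))) g.
  by apply: (amul_inj HA) => h; exact: key.
rewrite -[LHS](astarK HA) -[RHS](astarK HA); congr astar.
apply: (amul_inj HA) => h; rewrite -[h](astarK HA) -!(astarM HA); congr astar.
by rewrite key2 (astarM HA).
Qed.

Lemma jmul f G : amul (j f) G = j (amul f (Q G)).
Proof. by rewrite mulj_star retract_star (astarK HA). Qed.

Lemma retractM F G : Q (amul F G) = amul (Q F) (Q G).
Proof.
apply: (amul_inj HA) => h; apply: j_inj.
by rewrite -jmul (amulA HA') jmul jmul (amulA HA).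
Qed.

Let unity_retract e : is_unity (@amul R A') e -> is_unity (@amul R A) (Q e).
Proof.
move=> h a; split; apply: j_inj; first by rewrite -mulj (h _).1.
by rewrite -jmul (h _).2.
Qed.

Lemma starRep_retract (H : hilbertType R) (pi : starRep A H) :
  exists Pi : starRep A' H, forall F, Pi F = pi (Q F).
Proof.
have PM F G : (pi \o Q) (amul F G) = bop_comp ((pi \o Q) F) ((pi \o Q) G).
  by rewrite /= retractM starRepM.
have PA F u v : inner ((pi \o Q) (astar F) u) v = inner u ((pi \o Q) F v).
  by rewrite /= retract_star starRep_adj.
have P1 e : is_unity (@amul R A') e -> (pi \o Q) e = bop_id H.
  by move=> /unity_retract /(starRep1 pi).
by exists (StarRep PM PA P1).
Qed.

(** When [A] has a unit [e], the operator [Pi (j e)] is a projection, and the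
    representation [Pi \o j] lives on its range. *)
Lemma starRep_restrict (H : hilbertType R) (Pi : starRep A' H) :
  exists (H0 : hilbertType R) (pi : starRep A H0),
    forall f, opnorm (pi f) = opnorm (Pi (j f)).
Proof.
have [[e he]|ne] := pselect (exists e, is_unity (@amul R A) e); last first.
  have PM f g : (Pi \o j) (amul f g) = bop_comp ((Pi \o j) f) ((Pi \o j) g).
    by rewrite /= jM starRepM.
  have PA f u v : inner ((Pi \o j) (astar f) u) v = inner u ((Pi \o j) f v).
    by rewrite /= -starj starRep_adj.
  have P1 e : is_unity (@amul R A) e -> (Pi \o j) e = bop_id H.
    by move=> h; case: ne; exists e.
  by exists H, (StarRep PM PA P1).
pose p := Pi (j e).
have pT f u : p (Pi (j f) u) = Pi (j f) u.
  by rewrite -[LHS]/(bop_comp p _ u) -starRepM -jM (he f).1.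
have Tp f u : Pi (j f) (p u) = Pi (j f) u.
  by rewrite -[LHS]/(bop_comp _ p u) -starRepM -jM (he f).2.
have p1 : opnorm p <= 1.
  have : opnorm p = opnorm p ^+ 2.
    rewrite -(@opnorm_cstar _ _ p p) -?starRepM -?jM ?(he e).1// => u v.
    by rewrite /p -{1}(unity_star HA he) -starj starRep_adj.
  by have := opnorm_ge0 p; nra.
have fixP f (v : fixed_space p) : Pi (j f) (fixed_val v) \in fixed_pred p.
  by rewrite unfold_in pT.
pose res f (v : fixed_space p) : fixed_space p := FixedSpace (fixP f v).
have resP f : res f \in @bop_pred R (fixed_space p).
  apply/asboolP; split.
    by move=> z u v; apply: val_inj; rewrite /= -bop_linear.
  move=> v; apply/(@cvgrPdist_lt _ _ _ (nbhs v) (nbhs_filter v)) => d d0.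
  have := continuous_comp (@fixed_val_continuous _ _ p v) (@bop_continuous _ _ (Pi (j f)) (fixed_val v)).
  by move=> /(@cvgrPdist_lt _ _ _ (nbhs v) (nbhs_filter v))/(_ d d0).
pose rep f : bop (fixed_space p) := Bop (resP f).
have repE f v : fixed_val (rep f v) = Pi (j f) (fixed_val v) by [].
have rep_lin : linear rep.
  move=> z f g; apply: bop_ext => v; apply: val_inj; rewrite /= !linearP.
  by [].
pose repl : {linear A -> bop (fixed_space p)} :=
  HB.pack rep (GRing.isLinear.Build _ _ _ _ rep rep_lin).
have PM f g : repl (amul f g) = bop_comp (repl f) (repl g).
  apply: bop_ext => v; apply: val_inj.
  by rewrite /= jM starRepM.
have PA f u v : inner (repl (astar f) u) v = inner u (repl f v).
  transitivity (inner (Pi (j (astar f)) (fixed_val u)) (fixed_val v)) => //.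
  by rewrite -starj starRep_adj.
have P1 e' : is_unity (@amul R A) e' -> repl e' = bop_id (fixed_space p).
  move=> he'; rewrite (unity_uniq he' he); apply: bop_ext => v; apply: val_inj.
  by have := fixed_valP v; rewrite unfold_in => /eqP.
exists (fixed_space p), (StarRep PM PA P1) => f.
have hE (v : fixed_space p) : hnorm v = hnorm (fixed_val v) by [].
apply/eqP; rewrite eq_le; apply/andP; split.
  apply: opnorm_le => [|v]; first exact: opnorm_ge0.
  by rewrite !hE; exact: le_opnorm.
apply: opnorm_le => [|u]; first exact: opnorm_ge0.
have pu : p u \in fixed_pred p by rewrite unfold_in pT.
rewrite -Tp; have := le_opnorm (rep f) (FixedSpace pu); rewrite !hE /= => h.
apply: (le_trans h); rewrite ler_wpM2l ?opnorm_ge0//.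
apply: (le_trans (le_opnorm _ _)); rewrite -[leRHS]mul1r.
by rewrite ler_wpM2r ?hnorm_ge0.
Qed.

Lemma max_norm_retract f : max_norm f = max_norm (j f).
Proof.
congr sup; apply/seteqP; split=> [r [H [pi ->]]|r [H [Pi ->]]].
  by have [Pi hPi] := starRep_retract pi; exists H, Pi; rewrite hPi jK.
by have [H0 [pi hpi]] := starRep_restrict Pi; exists H0, pi; rewrite hpi.
Qed.

Lemma cstar_norm_retract (N : A' -> R) : cstar_norm N -> cstar_norm (N \o j).
Proof.
move=> hN; split=> [f g|z f|f|f g|f] /=.
- by rewrite raddfD (cstar_normD hN).
- by rewrite linearZ (cstar_normZ hN).
- by move=> /(cstar_norm0_eq0 hN) h; apply: j_inj; rewrite h raddf0.
- by rewrite jM (cstar_normM hN).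
- by rewrite jM -starj (cstar_norm_star hN).
Qed.

(** A C*-norm on the ideal and one on [A'] are glued along the projection onto
    the ideal and its complement. *)
Let cstar_norm_glue (N : A -> R) (M : A' -> R) : cstar_norm N -> cstar_norm M ->
  cstar_norm (fun F => Num.max (N (Q F)) (M (F - j (Q F)))).
Proof.
move=> hN hM; have [hN0 hM0] := (cstar_norm_ge0 hN, cstar_norm_ge0 hM).
have RM F G : amul F G - j (Q (amul F G)) =
    amul (F - j (Q F)) (G - j (Q G)).
  rewrite (amulBl HA') !(amulBr HA') !jmul !mulj jK retractM.
  by rewrite subrr subr0.
have RS F : astar F - j (Q (astar F)) = astar (F - j (Q F)).
  by rewrite (astarB HA') starj retract_star.
split=> [F G|z F|F|F G|F].
- rewrite !raddfD /= ge_max; apply/andP; split.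
    by apply: (le_trans (cstar_normD hN _ _)); rewrite lerD// le_max lexx.
  rewrite addrACA; apply: (le_trans (cstar_normD hM _ _)).
  by rewrite lerD// le_max lexx orbT.
- have -> : z *: F - j (Q (z *: F)) = z *: (F - j (Q F)).
    by rewrite scalerBr linearZ /= linearZ.
  rewrite linearZ /= (cstar_normZ hN) (cstar_normZ hM).
  by rewrite maxr_pMr ?cabs_ge0.
- move=> h; have := hN0 (Q F); have := hM0 (F - j (Q F)).
  have : N (Q F) <= 0 by rewrite -h le_max lexx.
  have : M (F - j (Q F)) <= 0 by rewrite -h le_max lexx orbT.
  move=> h1 h2 h3 h4.
  have /(cstar_norm0_eq0 hN) QF : N (Q F) = 0 by apply/eqP; rewrite eq_le h2.
  have /(cstar_norm0_eq0 hM) : M (F - j (Q F)) = 0 by apply/eqP; rewrite eq_le h1.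
  by rewrite QF raddf0 subr0.
- rewrite RM retractM ge_max; apply/andP; split.
    apply: (le_trans (cstar_normM hN _ _)).
    by rewrite ler_pM// le_max lexx.
  apply: (le_trans (cstar_normM hM _ _)).
  by rewrite ler_pM// le_max lexx orbT.
- rewrite RM retractM RS retract_star (cstar_norm_star hN) (cstar_norm_star hM).
  have [h|h] := leP (N (Q F)) (M (F - j (Q F))).
    by rewrite max_r// ler_pXn2r// nnegrE.
  by rewrite max_l// ler_pXn2r// ?nnegrE// ltW.
Qed.

Theorem cstar_unique_retract : cstar_unique A' -> cstar_unique A.
Proof.
move=> [[H [Pi Pi_inj]] [hM uM]].
have maxE : @max_norm R A = @max_norm R A' \o j.
  by apply/funext => f; exact: max_norm_retract.
split; last split.
- have [H0 [pi hpi]] := starRep_restrict Pi; exists H0, pi.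
  apply: raddf_inj => f pf0; apply: j_inj; apply: Pi_inj; rewrite !raddf0.
  by apply: opnorm0_eq0; rewrite -hpi pf0; apply/eqP; rewrite eq_le opnorm_ge0 andbT; apply: opnorm_le => // u; rewrite hnorm0 mul0r.
- by rewrite maxE; exact: cstar_norm_retract.
- move=> N hN; rewrite maxE -(uM _ (cstar_norm_glue hN hM)); apply/funext => f /=.
  by rewrite jK subrr (cstar_norm0 hM) max_l// (cstar_norm_ge0 hN).
Qed.

End retract.

(** * The unitization *)

Section unitization.
Variables (R : realType) (A : starAlg R) (HA : star_axioms A).

Definition unitization (HA : star_axioms A) : Type := (A * R[i])%type.
Local Notation B := (unitization HA).

HB.instance Definition _ := GRing.Lmodule.copy B (A * R[i]^o)%type.

Let mulB : B -> B -> B := unitization_mul (@amul R A).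

Let eqB (x y : B) : x.1 = y.1 -> x.2 = y.2 -> x = y.
Proof. by case: x y => [a s] [b t] /= -> ->. Qed.

Fact unitization_mulA : associative mulB.
Proof.
move=> [a s] [b t] [c r]; apply: eqB; last by rewrite /= mulrA.
rewrite /= !(amulDl HA) !(amulDr HA) !(amulZl HA) !(amulZr HA) (amulA HA).
rewrite !scalerDr !scalerA !addrA (mulrC r s) (mulrC r t).
rewrite -!addrA; congr (_ + _); rewrite addrCA; congr (_ + _).
by rewrite (addrCA (_ *: a)) (addrCA (_ *: amul a b)).
Qed.

Fact unitization_mul1 : left_id ((0, 1) : B) mulB.
Proof.
move=> [a s]; apply: eqB; last by rewrite /= mul1r.
by rewrite /= (amul0l HA) scaler0 scale1r !add0r.
Qed.

Fact unitization_mulr1 : right_id ((0, 1) : B) mulB.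
Proof.
move=> [a s]; apply: eqB; last by rewrite /= mulr1.
by rewrite /= (amul0r HA) scaler0 scale1r addr0 add0r.
Qed.

Fact unitization_mulDl : left_distributive mulB +%R.
Proof.
move=> [a s] [b t] [c r]; apply: eqB; last by rewrite /= mulrDl.
rewrite /= (amulDl HA) scalerDr scalerDl.
by rewrite (addrACA (amul a c)) (addrACA (amul a c + _)).
Qed.

Fact unitization_mulDr : right_distributive mulB +%R.
Proof.
move=> [a s] [b t] [c r]; apply: eqB; last by rewrite /= mulrDr.
rewrite /= (amulDr HA) scalerDr scalerDl.
by rewrite (addrACA (amul a b)) (addrACA (amul a b + _)).
Qed.

Fact unitization_oner_neq0 : ((0, 1) : B) != 0.
Proof. by apply/eqP => -[/eqP]; rewrite oner_eq0. Qed.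

HB.instance Definition _ := GRing.Zmodule_isNzRing.Build B unitization_mulA
  unitization_mul1 unitization_mulr1 unitization_mulDl unitization_mulDr
  unitization_oner_neq0.

Fact unitization_scalerAl (z : R[i]) (x y : B) : z *: (x * y) = (z *: x) * y.
Proof.
apply: eqB; last by rewrite /= -mulrA.
by rewrite /= (amulZl HA) !scalerDr !scalerA (mulrC z y.2).
Qed.

HB.instance Definition _ := GRing.Lmodule_isLalgebra.Build R[i] B
  unitization_scalerAl.

Fact unitization_scalerAr (z : R[i]) (x y : B) : z *: (x * y) = x * (z *: y).
Proof.
apply: eqB; last by rewrite /= mulrCA.
by rewrite /= (amulZr HA) !scalerDr !scalerA (mulrC z x.2).
Qed.

HB.instance Definition _ := GRing.Lalgebra_isAlgebra.Build R[i] B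
  unitization_scalerAr.

Lemma unitization_scalar (z : R[i]) : (z%:A : B) = (0, z).
Proof. by apply: eqB; [exact: scaler0|exact: mulr1]. Qed.

Definition uinj (a : A) : B := (a, 0).

Lemma uinjD a b : uinj (a + b) = uinj a + uinj b.
Proof. by apply: eqB => //; exact/esym/addr0. Qed.

Lemma uinjZ z a : uinj (z *: a) = z *: uinj a.
Proof. by apply: eqB => //; exact/esym/mulr0. Qed.

Lemma uinjN a : uinj (- a) = - uinj a.
Proof. by apply: eqB => //; exact/esym/oppr0. Qed.

Lemma uinjM a b : uinj (amul a b) = uinj a * uinj b.
Proof. by apply: eqB; rewrite /= ?mulr0// !scale0r !addr0. Qed.

Lemma uinjB_scalar a (z : R[i]) : uinj a - z%:A = (a, - z).
Proof. by rewrite unitization_scalar; apply: eqB; rewrite /= ?subr0 ?sub0r. Qed.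

Lemma uinj_decomp (x : B) (z : R[i]) : x - z%:A = uinj x.1 - (z - x.2)%:A.
Proof.
rewrite !unitization_scalar; apply: eqB; first by rewrite /= !subr0.
by rewrite /= sub0r opprB.
Qed.

Lemma uinj_fst (x : B) : x.2 = 0 -> x = uinj x.1.
Proof. by move=> h; apply: eqB. Qed.

(** [snd] is a character, whose kernel is [A]. *)
Lemma sndM (x y : B) : (x * y).2 = x.2 * y.2.
Proof. by []. Qed.

Lemma sndX (x : B) n : (x ^+ n).2 = x.2 ^+ n.
Proof. by elim: n => [|n ih]; rewrite ?expr0// !exprS sndM ih. Qed.

Lemma snd_scalar (z : R[i]) : (z%:A : B).2 = z.
Proof. by rewrite unitization_scalar. Qed.

Lemma sndD (x y : B) : (x + y).2 = x.2 + y.2.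
Proof. by []. Qed.

Lemma sndN (x : B) : (- x).2 = - x.2.
Proof. by []. Qed.

Lemma sndZ z (x : B) : (z *: x).2 = z * x.2.
Proof. by []. Qed.

Definition ustar (x : B) : B := (astar x.1, x.2^*).

Lemma ustar_involution : involution ustar.
Proof.
split=> [x y|z x|x y|x]; apply: eqB; rewrite /=.
- exact: (astarD HA).
- by rewrite rmorphD.
- exact: (astarZ HA).
- by rewrite rmorphM.
- by rewrite !(astarD HA) !(astarZ HA) (astarM HA) addrAC.
- by rewrite rmorphM mulrC.
- exact: (astarK HA).
- exact: conjCK.
Qed.

Lemma ustar_uinj a : ustar (uinj a) = uinj (astar a).
Proof. by apply: eqB; rewrite //= conjC0. Qed.

End unitization.

(** Complete algebra norms, with completeness expressed by absolutely convergent
    series as this is what convolution algebras provide. *)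
Record complete_anorm (R : realType) (A : starAlg R) (nrm : A -> R) : Prop :=
  CompleteAnorm {
  anrmD : forall a b, nrm (a + b) <= nrm a + nrm b;
  anrmZ : forall z a, nrm (z *: a) = cabs z * nrm a;
  anrm_eq0 : forall a, nrm a = 0 -> a = 0;
  anrmM : forall a b, nrm (amul a b) <= nrm a * nrm b;
  anrm_complete : forall u : nat -> A,
    (exists S, forall n, \sum_(i < n) nrm (u i) <= S) ->
    exists l, (fun n => nrm (\sum_(i < n) u i - l)) @ \oo --> (0 : R) }.

Section unitization_norm.
Variables (R : realType) (A : starAlg R) (HA : star_axioms A) (nrm : A -> R).
Hypothesis Hn : complete_anorm nrm.

Definition unorm (x : unitization HA) : R := nrm x.1 + cabs x.2.

Let nrm0 : nrm 0 = 0.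
Proof. by rewrite -(scale0r (0 : A)) (anrmZ Hn) cabs0 mul0r. Qed.

Let nrm_ge0 a : 0 <= nrm a.
Proof.
have := anrmD Hn a (- a); rewrite subrr nrm0 -scaleN1r.
by rewrite (anrmZ Hn) cabsN cabs1 mul1r -mulr2n -mulr_natr pmulr_lge0.
Qed.

Lemma unorm_uinj a : unorm (uinj HA a) = nrm a.
Proof. by rewrite /unorm /= cabs0 addr0. Qed.

Let complex_series (u : nat -> R[i]) :
  (exists S, forall n, \sum_(i < n) cabs (u i) <= S) ->
  exists l, (fun n => cabs (\sum_(i < n) u i - l)) @ \oo --> (0 : R).
Proof.
move=> [S hS].
have key (f : R[i] -> R) : (forall z, `|f z| <= cabs z) ->
    exists l, (fun n => \sum_(i < n) f (u i)) @ \oo --> (l : R).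
  move=> hf; have /normed_cvg : cvgn [normed series (f \o u)].
    apply: nondecreasing_is_cvgn.
      move=> m n mn; rewrite -subr_ge0 /series /= sub_series_geq//.
      by apply: sumr_ge0.
    exists S => _ [n _ <-]; apply: le_trans (hS n).
    by rewrite /= seriesEord; apply: ler_sum => i _; exact: hf.
  move=> /cvg_ex[l hl]; exists l; move: hl; apply: cvg_trans.
  by apply: near_eq_cvg; apply: nearW => n; rewrite /= seriesEord.
have [a ha] := key _ (@Re_le_cabs R).
have [b hb] := key _ (@Im_le_cabs R).
exists (Complex a b).
have h : `|\sum_(i < n) complex.Re (u i) - a| + `|\sum_(i < n) complex.Im (u i) - b|
    @[n --> \oo] --> (0 : R).
  rewrite -[0 in X in _ --> X](addr0 (0 : R)); apply: cvgD.
    by apply/norm_cvg0P; apply/subr_cvg0.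
  by apply/norm_cvg0P; apply/subr_cvg0.
apply: (squeeze_cvgr _ (cvg_cst 0) h); apply: nearW => n.
rewrite cabs_ge0 /=; apply: (le_trans (cabs_le_ReIm _)).
by rewrite !raddfB /= !raddf_sum.
Qed.

Lemma unorm_complete : complete_norm unorm.
Proof.
split=> [x y|z x|x h|x y|u [S hS]].
- by rewrite /unorm /= addrACA lerD ?(anrmD Hn) ?cabsD.
- by rewrite /unorm /= (anrmZ Hn) cabsM mulrDr.
- have h1 : nrm x.1 = 0 by apply/eqP; rewrite eq_le nrm_ge0 andbT -h lerDl cabs_ge0.
  have h2 : cabs x.2 = 0 by apply/eqP; rewrite eq_le cabs_ge0 andbT -h lerDr nrm_ge0.
  move/eqP: h2; rewrite cabs_eq0 => /eqP h2; move/(anrm_eq0 Hn): h1.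
  by move: h2; case: x {h} => a s /= -> ->.
- rewrite /unorm /= cabsM.
  apply: (@le_trans _ _ (nrm x.1 * nrm y.1 + cabs y.2 * nrm x.1 +
      cabs x.2 * nrm y.1 + cabs x.2 * cabs y.2)).
    rewrite lerD2r; apply: (le_trans (anrmD Hn _ _)); rewrite (anrmZ Hn) lerD2r.
    apply: (le_trans (anrmD Hn _ _)); rewrite (anrmZ Hn) lerD2r.
    exact: (anrmM Hn).
  by rewrite le_eqVlt; apply/orP; left; apply/eqP; ring.
- have [a ha] : exists l, (fun n => nrm (\sum_(i < n) (u i).1 - l)) @ \oo --> (0 : R).
    apply: (anrm_complete Hn (u := fun i => (u i).1)); exists S => n.
    apply: le_trans (hS n).
    by apply: ler_sum => i _; rewrite lerDl cabs_ge0.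
  have [s hs] : exists l, (fun n => cabs (\sum_(i < n) (u i).2 - l)) @ \oo --> (0 : R).
    apply: (complex_series (u := fun i => (u i).2)); exists S => n.
    apply: le_trans (hS n).
    by apply: ler_sum => i _; rewrite lerDr nrm_ge0.
  exists ((a, s) : unitization HA).
  have -> : (fun n => unorm (\sum_(i < n) u i - (a, s))) =
    (fun n => nrm (\sum_(i < n) (u i).1 - a) + cabs (\sum_(i < n) (u i).2 - s)).
    apply/funext => n; rewrite /unorm /=; congr (nrm (_ - _) + cabs (_ - _)).
      exact: (big_morph (fun x : unitization HA => x.1) (id1 := 0) (op1 := +%R)).
    exact: (big_morph (fun x : unitization HA => x.2) (id1 := 0) (op1 := +%R)).
  by rewrite -(addr0 (0 : R)); apply: cvgD.
Qed.

End unitization_norm.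

(** * Symmetric C*-unique algebras *)

(** [|u - S T u / C|^2 <= |u|^2 - |T u|^2 / C] as soon as [C >= |T|^2], and [T] is
    bounded below. *)
Lemma adjoint_contraction (R : realType) (H : hilbertType R) (S T : bop H) (K : R) :
  adjoint S T -> (forall u, hnorm u <= K * hnorm (T u)) ->
  exists C q, [/\ 0 < C, 0 <= q < 1 &
    forall u, hnorm (u - C^-1%:C%C *: S (T u)) <= q * hnorm u].
Proof.
move=> adj hK; pose C := opnorm T ^+ 2 + 1; pose D := C * (K ^+ 2 + 1).
have C1 : 1 <= C by rewrite lerDr sqr_ge0.
have K1 : 1 <= K ^+ 2 + 1 by rewrite lerDr sqr_ge0.
have D1 : 1 <= D by rewrite -[1]mulr1 ler_pM.
have [C0 D0] : 0 < C /\ 0 < D by split; exact: lt_le_trans ltr01 _.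
have q0 : 0 <= 1 - D^-1 by rewrite subr_ge0 invf_le1.
exists C, (Num.sqrt (1 - D^-1)); split=> //.
  rewrite sqrtr_ge0 -(ltr_pXn2r (n := 2)) ?nnegrE ?sqrtr_ge0//.
  by rewrite sqr_sqrtr// expr1n ltrBlDr ltrDl invr_gt0.
move=> u; rewrite -(ler_pXn2r (n := 2)) ?nnegrE ?mulr_ge0 ?hnorm_ge0 ?sqrtr_ge0//.
rewrite exprMn sqr_sqrtr//.
have sw : hnorm (S (T u)) ^+ 2 <= C * hnorm (T u) ^+ 2.
  apply: (@le_trans _ _ (opnorm T ^+ 2 * hnorm (T u) ^+ 2)); last first.
    by rewrite ler_wpM2r ?sqr_ge0// lerDl.
  rewrite -exprMn ler_pXn2r ?nnegrE ?hnorm_ge0 ?mulr_ge0 ?opnorm_ge0 ?hnorm_ge0//.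
  apply: (le_trans (le_opnorm _ _)); rewrite ler_wpM2r ?hnorm_ge0//.
  exact: adjoint_norm.
have -> : hnorm (u - C^-1%:C%C *: S (T u)) ^+ 2 =
    hnorm u ^+ 2 - 2 * C^-1 * hnorm (T u) ^+ 2 + C^-1 ^+ 2 * hnorm (S (T u)) ^+ 2.
  apply: complexI; rewrite -innerE -[- (_ *: _)]scaleNr.
  rewrite !innerDl !innerDr !innerZl !innerZr (inner_conj (S (T u)) u).
  rewrite (adjoint_sqr u adj).2 !innerE conjC_real_complex.
  rewrite (rmorphN Num.conj) /= conjC_real_complex.
  by apply/eqP; rewrite eq_complex /=; apply/andP; split; apply/eqP; ring.
have uT : hnorm u ^+ 2 <= (K ^+ 2 + 1) * hnorm (T u) ^+ 2.
  apply: (@le_trans _ _ (K ^+ 2 * hnorm (T u) ^+ 2)).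
    rewrite -exprMn ler_pXn2r ?nnegrE ?hnorm_ge0//.
    by apply: le_trans (hK u); exact: hnorm_ge0.
  by rewrite ler_wpM2r ?sqr_ge0// lerDl.
have h1 : C^-1 ^+ 2 * hnorm (S (T u)) ^+ 2 <= C^-1 * hnorm (T u) ^+ 2.
  by rewrite expr2 -mulrA ler_wpM2l ?invr_ge0 ?(ltW C0)// ler_pdivrMl.
have h2 : D^-1 * hnorm u ^+ 2 <= C^-1 * hnorm (T u) ^+ 2.
  rewrite /D invfM -mulrA ler_wpM2l ?invr_ge0 ?(ltW C0)// ler_pdivrMl//.
  exact: lt_le_trans K1.
by rewrite mulrBl mul1r; lra.
Qed.

Lemma zmod_glue (V : zmodType) (al be x tx y ty w z : V) :
  al + be - (x + w + (z + y)) =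
  al - (x + tx) + (be - (y + ty)) + (tx - w - z + ty).
Proof.
rewrite (addrACA al) -[RHS]addrA; congr (_ + _).
rewrite !opprD !addrA [RHS](ACl (1*6*7*3*2*5*4*8)) /=.
by rewrite !subrK.
Qed.

Lemma sqr_le_add (R : realType) (x a b : R) : 0 <= x -> 0 <= a -> 0 <= b ->
  (forall t, 0 < t -> x ^+ 2 <= (1 + t) * a ^+ 2 + (1 + t^-1) * b ^+ 2) ->
  x <= a + b.
Proof.
move=> x0 a0 b0 h; apply/ler_addgt0Pr => e e0.
pose p := a + e / 2; pose q := b + e / 2.
have [p0 q0] : 0 < p /\ 0 < q by rewrite /p /q; split; lra.
have {}h := h _ (divr_gt0 q0 p0).
rewrite -(ler_pXn2r (n := 2)) ?nnegrE ?addr_ge0 ?(ltW e0)//.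
apply: (le_trans h); rewrite invf_div.
have -> : a + b + e = p + q by rewrite /p /q; field.
apply: (@le_trans _ _ ((1 + q / p) * p ^+ 2 + (1 + p / q) * q ^+ 2)).
  by apply: lerD; rewrite ler_wpM2l ?addr_ge0 ?divr_ge0 ?(ltW p0) ?(ltW q0)//
    ler_pXn2r ?nnegrE ?(ltW p0) ?(ltW q0)// lerDl; lra.
by rewrite le_eqVlt; apply/orP; left; apply/eqP; field; rewrite !gt_eqF.
Qed.

Lemma le_of_sqr (R : realType) (x y : R) : 0 <= y -> x ^+ 2 <= y ^+ 2 -> x <= y.
Proof.
move=> y0 h; have [x0|/ltW x0] := leP 0 x; last exact: le_trans y0.
by rewrite -(ler_pXn2r (n := 2)).
Qed.

Lemma eq_of_sqr (R : realType) (x y : R) : 0 <= x -> 0 <= y ->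
  x ^+ 2 = y ^+ 2 -> x = y.
Proof. by move=> x0 y0 h; apply/eqP; rewrite -(eqrXn2 (n := 2)) ?h. Qed.

Section rep_unitization.
Variables (R : realType) (A : starAlg R) (HA : star_axioms A).
Variables (H : hilbertType R) (pi : starRep A H).
Local Notation B := (unitization HA).
Local Notation "a %:U" := (uinj HA a) (at level 2, format "a %:U").

Lemma rep_adj a : adjoint (pi (astar a)) (pi a).
Proof. by move=> u v; exact: starRep_adj. Qed.

Definition urep (x : B) : bop H := pi x.1 + x.2 *: bop_id H.

Lemma urepE (x : B) u : urep x u = pi x.1 u + x.2 *: u.
Proof. by []. Qed.

Lemma urepM x y : urep (x * y) = bop_comp (urep x) (urep y).
Proof.
have e : pi (x * y).1 =
    bop_comp (pi x.1) (pi y.1) + y.2 *: pi x.1 + x.2 *: pi y.1.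
  by rewrite -starRepM -!linearZ -!raddfD.
apply: bop_ext => u; rewrite -[RHS]/(urep x (urep y u)) !urepE e.
rewrite -[LHS]/(pi x.1 (pi y.1 u) + y.2 *: pi x.1 u + x.2 *: pi y.1 u +
  (x.2 * y.2) *: u).
by rewrite bopD bopZ scalerDr scalerA !addrA.
Qed.

Lemma urep1 : urep 1 = bop_id H.
Proof. by rewrite /urep /= raddf0 add0r scale1r. Qed.

Lemma urepD x y : urep (x + y) = urep x + urep y.
Proof. by rewrite /urep /= raddfD scalerDl addrACA. Qed.

Lemma urepZ z x : urep (z *: x) = z *: urep x.
Proof. by rewrite /urep /= linearZ scalerDr scalerA. Qed.

Lemma urepB x y : urep (x - y) = urep x - urep y.
Proof. by rewrite urepD -scaleN1r urepZ scaleN1r. Qed.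

Lemma urep_uinj a : urep a%:U = pi a.
Proof. by rewrite /urep /= scale0r addr0. Qed.

Lemma urep_adj x : adjoint (urep (ustar x)) (urep x).
Proof.
by move=> u v; rewrite !urepE innerDl innerDr innerZl innerZr starRep_adj.
Qed.

Lemma urep_invertible x : invertible x -> ainvertible (@bop_comp R H) (bop_id H) (urep x).
Proof. by move=> [y [h1 h2]]; exists (urep y); rewrite -!urepM h1 h2 urep1. Qed.

End rep_unitization.

Section symmetric.
Variables (R : realType) (A : starAlg R) (nrm0 : A -> R).
Variables (H : hilbertType R) (pi : starRep A H).
Hypothesis Hnrm0 : complete_anorm nrm0.
Hypothesis pi_inj : injective pi.
Hypothesis HU : cstar_unique A.
Hypothesis Hsym : forall (a : A) (z : R[i]), ~~ (0 <= z) ->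
  ainvertible (unitization_mul (@amul R A)) (0, 1) (amul (astar a) a, - z).

Hypothesis HA : star_axioms A.
Local Notation B := (unitization HA).
Local Notation "a %:U" := (uinj HA a) (at level 2, format "a %:U").

Let spr_pi a q : 0 <= q -> spr_le (amul (astar a) a)%:U q -> opnorm (pi a) ^+ 2 <= q.
Proof.
move=> q0 h; rewrite leNgt; apply/negP => hq.
have : opnorm (pi a) = 0.
  apply: (opnorm_spectrum (rep_adj pi a)).
  have := h (opnorm (pi a) ^+ 2)%:C%C; rewrite cabs_real ger0_norm ?sqr_ge0//.
  move=> /(_ hq)/(urep_invertible pi).
  by rewrite urepB urepZ urep1 urep_uinj starRepM.
by move=> h0; move: hq; rewrite h0 expr0n ltNge q0.
Qed.

(** The norm [nrm0] need not be preserved by the involution; the larger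
    [nrm] is, and it is still complete: by [opnorm_nrm0] the graph of the
    involution is closed. *)
Let opnorm_nrm0 a : opnorm (pi a) ^+ 2 <= nrm0 (amul (astar a) a).
Proof.
have Hu := unorm_complete HA Hnrm0.
rewrite -(unorm_uinj HA); apply: spr_pi; first exact: (cnrm_ge0 Hu).
exact: (spr_le_nrm Hu).
Qed.

Let nrm a := Num.max (nrm0 a) (nrm0 (astar a)).

Let nrm0_ge0 a : 0 <= nrm0 a.
Proof.
by have := cnrm_ge0 (unorm_complete HA Hnrm0) a%:U; rewrite unorm_uinj.
Qed.

Let astar_closed (u : nat -> A) l l' :
  (fun n => nrm0 (u n - l)) @ \oo --> (0 : R) ->
  (fun n => nrm0 (astar (u n) - l')) @ \oo --> (0 : R) -> l' = astar l.
Proof.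
have key (v : nat -> A) k k' : (fun n => nrm0 (v n - k)) @ \oo --> (0 : R) ->
    (fun n => nrm0 (astar (v n) - k')) @ \oo --> (0 : R) ->
    (fun n => opnorm (pi (v n - k)) ^+ 2) @ \oo --> (0 : R).
  move=> h h'; pose M n := nrm0 (astar (v n) - k') + nrm0 (k' - astar k).
  have hM : M n * nrm0 (v n - k) @[n --> \oo] --> (0 : R).
    by rewrite -(mulr0 (0 + nrm0 (k' - astar k))); apply: cvgM => //;
      apply: cvgD => //; exact: cvg_cst.
  apply: (squeeze_cvgr _ (cvg_cst 0) hM); apply: nearW => n.
  rewrite sqr_ge0 /=; apply: (le_trans (opnorm_nrm0 _)).
  apply: (le_trans (anrmM Hnrm0 _ _)); rewrite ler_wpM2r// (astarB HA).
  rewrite -(subrK k' (astar (v n))) -addrA; exact: (anrmD Hnrm0).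
move=> h h'; have h1 := key _ _ _ h h'.
have h2 : (fun n => opnorm (pi (astar (u n) - l')) ^+ 2) @ \oo --> (0 : R).
  apply: (key (fun n => astar (u n)) l' l) => //.
  by under eq_cvg do rewrite (astarK HA).
apply: pi_inj; apply: bop_ext => v; apply/eqP; rewrite -subr_eq0 -hnorm_eq0.
set w := pi l' v - pi (astar l) v.
pose x n := opnorm (pi (astar (u n) - l')); pose y n := opnorm (pi (u n - l)).
have hw n : hnorm w ^+ 4 <=
    (x n ^+ 2 + y n ^+ 2) * (2 * (hnorm v * hnorm w) ^+ 2).
  have e : inner w w =
      inner v (pi (u n - l) w) - inner (pi (astar (u n) - l') v) w.
    rewrite !raddfB /=.
    rewrite -[X in _ = inner v X - _]/(pi (u n) w - pi l w).
    rewrite -[X in _ = _ - inner X w]/(pi (astar (u n)) v - pi l' v).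
    rewrite innerBl [X in _ = X - _]inner_conj innerBl rmorphB /= -!inner_conj.
    by rewrite {1}/w innerBl !starRep_adj opprB [RHS]addrC addrA subrK.
  have h3 : hnorm w ^+ 2 <= (x n + y n) * (hnorm v * hnorm w).
    have -> : hnorm w ^+ 2 = cabs (inner w w).
      by rewrite innerE cabs_real ger0_norm ?sqr_ge0.
    rewrite e; apply: (le_trans (cabsD _ _)); rewrite cabsN mulrDl addrC.
    apply: lerD.
      apply: (le_trans (cauchy_schwarz _ _)); rewrite mulrA ler_wpM2r ?hnorm_ge0//.
      exact: le_opnorm.
    apply: (le_trans (cauchy_schwarz _ _)); rewrite mulrCA ler_wpM2l ?hnorm_ge0//.
    exact: le_opnorm.
  have x0 : 0 <= x n by exact: opnorm_ge0.
  have y0 : 0 <= y n by exact: opnorm_ge0.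
  have vw0 : 0 <= hnorm v * hnorm w by rewrite mulr_ge0 ?hnorm_ge0.
  rewrite (exprM _ 2 2); apply: (@le_trans _ _ (((x n + y n) * (hnorm v * hnorm w)) ^+ 2)).
    by rewrite ler_pXn2r ?nnegrE ?sqr_ge0 ?mulr_ge0 ?addr_ge0 ?hnorm_ge0.
  rewrite exprMn [leRHS]mulrA ler_wpM2r ?sqr_ge0//.
  by have := sqr_ge0 (x n - y n); nra.
have hl : (x n ^+ 2 + y n ^+ 2) * (2 * (hnorm v * hnorm w) ^+ 2) @[n --> \oo] --> (0 : R).
  rewrite -(mul0r (2 * (hnorm v * hnorm w) ^+ 2)); apply: cvgMl.
  by rewrite -(addr0 (0 : R)); apply: cvgD.
have w4 : hnorm w ^+ 4 <= 0.
  by apply: (ler_cvg_to (cvg_cst _) hl); apply: nearW => n; exact: hw.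
by rewrite -[_ == 0]/((0 < 4)%N && (hnorm w == 0)) -expf_eq0 eq_le w4 exprn_ge0
  ?hnorm_ge0.
Qed.

Let nrmP : complete_anorm nrm.
Proof.
split=> [a b|z a|a|a b|u [S hS]].
- rewrite /nrm ge_max; apply/andP; split.
    by apply: (le_trans (anrmD Hnrm0 _ _)); rewrite lerD// le_max lexx.
  rewrite (astarD HA); apply: (le_trans (anrmD Hnrm0 _ _)).
  by rewrite lerD// le_max lexx orbT.
- rewrite /nrm (astarZ HA) !(anrmZ Hnrm0) cabs_conj.
  by rewrite maxr_pMr ?cabs_ge0.
- move=> h; apply: (anrm_eq0 Hnrm0); apply/eqP.
  by rewrite eq_le nrm0_ge0 andbT -h le_max lexx.
- rewrite /nrm ge_max; apply/andP; split.
    apply: (le_trans (anrmM Hnrm0 _ _)).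
    by rewrite ler_pM// le_max lexx.
  rewrite (astarM HA); apply: (le_trans (anrmM Hnrm0 _ _)); rewrite mulrC.
  by rewrite ler_pM// le_max lexx orbT.
- have [l hl] : exists l, (fun n => nrm0 (\sum_(i < n) u i - l)) @ \oo --> (0 : R).
    apply: (anrm_complete Hnrm0 (u := u)); exists S => n; apply: le_trans (hS n).
    by apply: ler_sum => i _; rewrite le_max lexx.
  have [l' hl'] : exists l, (fun n => nrm0 (\sum_(i < n) astar (u i) - l)) @ \oo --> (0 : R).
    apply: (anrm_complete Hnrm0 (u := fun i => astar (u i))).
    exists S => n; apply: le_trans (hS n).
    by apply: ler_sum => i _; rewrite le_max lexx orbT.
  have sE n : \sum_(i < n) astar (u i) = astar (\sum_(i < n) u i).
    have a0 : astar (0 : A) = 0 by rewrite -(subrr (0 : A)) (astarB HA) !subrr.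
    by rewrite (big_morph _ (astarD HA) a0).
  have ll' : l' = astar l.
    by apply: astar_closed hl _; move: hl'; under eq_cvg do rewrite sE.
  exists l; have hD : nrm0 (\sum_(i < n) u i - l) + nrm0 (\sum_(i < n) astar (u i) - l') @[n --> \oo] --> (0 : R).
    by rewrite -(addr0 (0 : R)); apply: cvgD.
  apply: (squeeze_cvgr _ (cvg_cst 0) hD); apply: nearW => n.
  rewrite /nrm le_max nrm0_ge0 /= (astarB HA) -sE -ll' ge_max lerDl lerDr.
  by rewrite !nrm0_ge0.
Qed.

Let nrm_star a : nrm (astar a) = nrm a.
Proof. by rewrite /nrm (astarK HA) maxC. Qed.

Let nB : B -> R := @unorm R A HA nrm.
Let HnB : complete_norm nB := unorm_complete HA nrmP.

Let nB_star x : nB (ustar x) = nB x.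
Proof. by rewrite /nB /unorm /= nrm_star cabs_conj. Qed.

Let HiB := ustar_involution HA.

Let sym (a : A) : pos (amul (astar a) a)%:U.
Proof. by move=> z z0; rewrite uinjB_scalar; exact: Hsym. Qed.

Let selfadjoint_fst (x : B) : ustar x = x -> astar x.1 = x.1.
Proof. by case: x => a s [h _]. Qed.

Let selfadjoint_snd (x : B) : ustar x = x -> x.2^* = x.2.
Proof. by case: x => a s [_ h]. Qed.

(** [Hsym] gives real spectrum to the squares of self-adjoint elements. *)
Let hermB (h : B) : ustar h = h ->
  forall z : R[i], complex.Im z != 0 -> invertible (h - z%:A).
Proof.
move=> hh z z0; pose w := z - h.2.
have hE : h - z%:A = h.1%:U - w%:A by exact: uinj_decomp.
have tr : complex.Im h.2 = 0.
  have := selfadjoint_snd hh; case: (h.2) => a b [] /eqP.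
  by rewrite eq_sym -addr_eq0 -mulr2n mulrn_eq0 /= => /eqP.
have w0 : complex.Im w != 0 by rewrite /w raddfB /= tr subr0.
rewrite hE; apply: (@invertible_commM _ _ _ (h.1%:U + w%:A)).
  by rewrite mulrBl mulrBr !mulrDr !mulrDl -!scalerAr -!scalerAl mulr1 mul1r.
rewrite -subr_sqr_scalar expr2 -uinjM -{1}(selfadjoint_fst hh); apply: sym.
apply: contra w0 => w2; move: w2 (ger0_Im w2); case: (w) => a b /=.
rewrite lecE /= => /andP[_ h2] h1.
have /eqP : a * b = 0 by lra.
rewrite mulf_eq0 => /orP[/eqP a0|//]; move: h2.
by rewrite a0 mul0r sub0r oppr_ge0 -[b == 0]sqrf_eq0 eq_le sqr_ge0 andbT.
Qed.

(** The spectral radius. *)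
Let rho (x : B) : R := inf [set q : R | 0 <= q /\ spr_le x q].

Let rho_inf (x : B) : has_inf [set q : R | 0 <= q /\ spr_le x q].
Proof.
split; last by exists 0 => q [].
by exists (nB x); split; [exact: (cnrm_ge0 HnB)|exact: (spr_le_nrm HnB)].
Qed.

Let rho_ge0 x : 0 <= rho x.
Proof. by apply: lb_le_inf; [exact: (rho_inf x).1|move=> q []]. Qed.

Let rho_le (x : B) (q : R) : 0 <= q -> spr_le x q -> rho x <= q.
Proof. by move=> q0 h; apply: ge_inf; [exact: (rho_inf x).2|]. Qed.

Let spr_rho (x : B) : spr_le x (rho x).
Proof.
move=> z hz; have [q [q0 hq] qz] : exists2 q, 0 <= q /\ spr_le x q & q < cabs z.
  by have /= := inf_lt (rho_inf x).1 hz.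
exact: hq.
Qed.

Let rho_swap x y : rho (x * y) = rho (y * x).
Proof.
by apply/eqP; rewrite eq_le; apply/andP; split; apply: rho_le; rewrite ?rho_ge0//;
  apply: spr_le_swap; rewrite ?rho_ge0//; exact: spr_rho.
Qed.

Let rhoX2 x : rho (x ^+ 2) = rho x ^+ 2.
Proof.
have r0 := rho_ge0 (x ^+ 2).
apply/eqP; rewrite eq_le; apply/andP; split.
  by apply: rho_le; rewrite ?sqr_ge0//; apply: sqr_spr_le; [exact: rho_ge0|exact: spr_rho].
rewrite -(sqr_sqrtr r0) ler_pXn2r ?nnegrE ?rho_ge0 ?sqrtr_ge0//.
apply: rho_le; rewrite ?sqrtr_ge0//; apply: spr_le_sqr; rewrite ?sqrtr_ge0//.
by rewrite sqr_sqrtr//; exact: spr_rho.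
Qed.

Let rhoZ z x : rho (z *: x) = cabs z * rho x.
Proof.
have le w y : rho (w *: y) <= cabs w * rho y.
  apply: rho_le; first by rewrite mulr_ge0 ?cabs_ge0 ?rho_ge0.
  by apply: spr_leZ; [exact: rho_ge0|exact: spr_rho].
apply/eqP; rewrite eq_le le /=; have [->|z0] := eqVneq z 0.
  by rewrite cabs0 mul0r rho_ge0.
rewrite -ler_pdivlMl ?cabs_gt0// -cabsV; have := le z^-1 (z *: x).
by rewrite scalerA mulVf// scale1r.
Qed.

Let rhoM u v : ustar u = u -> ustar v = v -> rho (u * v) <= rho u * rho v.
Proof.
move=> hu hv; apply: rho_le; first by rewrite mulr_ge0 ?rho_ge0.
apply: (spr_leM HnB HiB nB_star hermB) => //; rewrite ?rho_ge0//;
  exact: spr_rho.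
Qed.

(** Ptak's function, the largest C*-seminorm on a hermitian algebra. *)
Let ptak (a : A) : R := Num.sqrt (rho (amul (astar a) a)%:U).

Let ptak2 a : ptak a ^+ 2 = rho (amul (astar a) a)%:U.
Proof. by rewrite sqr_sqrtr ?rho_ge0. Qed.

Let ptak_ge0 a : 0 <= ptak a.
Proof. exact: sqrtr_ge0. Qed.

Let ustar_sq a : ustar (amul (astar a) a)%:U = (amul (astar a) a)%:U.
Proof. by rewrite ustar_uinj (astarM HA) (astarK HA). Qed.

Let ptak_le a (q : R) : 0 <= q -> pos (q%:C%C%:A - (amul (astar a) a)%:U) ->
  ptak a ^+ 2 <= q.
Proof.
move=> q0 h; rewrite ptak2; apply: rho_le => //.
exact: (spr_le_pos q0 (sym a) h).
Qed.

Let ptak_pos a : pos ((ptak a ^+ 2)%:C%C%:A - (amul (astar a) a)%:U).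
Proof.
apply: (spr_le_posB HiB hermB); rewrite ?sqr_ge0//.
by rewrite ptak2; exact: spr_rho.
Qed.

(** From [(1 + t) a^* a + (1 + t^-1) b^* b - (a + b)^* (a + b) = c^* c], where
    [c] is [t^(1/2) a - t^(-1/2) b]. *)
Let ptakD_aux a b (t : R) : 0 < t ->
  ptak (a + b) ^+ 2 <= (1 + t) * ptak a ^+ 2 + (1 + t^-1) * ptak b ^+ 2.
Proof.
move=> t0; pose s := Num.sqrt t; have s0 : 0 < s by rewrite sqrtr_gt0.
have st : s ^+ 2 = t by rewrite sqr_sqrtr// ltW.
have ti : 0 < 1 + t^-1 by rewrite addr_gt0// invr_gt0.
have tp : 0 < 1 + t by rewrite addr_gt0.
have sqa c : ustar (amul (astar c) c)%:U = (amul (astar c) c)%:U by exact: ustar_sq.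
apply: ptak_le.
  by rewrite addr_ge0// mulr_ge0 ?sqr_ge0// ltW.
set P := fun c => (ptak c ^+ 2)%:C%C%:A - (amul (astar c) c)%:U.
set c := s%:C%C *: a - s^-1%:C%C *: b.
have -> : ((1 + t) * ptak a ^+ 2 + (1 + t^-1) * ptak b ^+ 2)%:C%C%:A -
    (amul (astar (a + b)) (a + b))%:U =
    (1 + t)%:C%C *: P a + (1 + t^-1)%:C%C *: P b + (amul (astar c) c)%:U.
  have sK : s * s^-1 = 1 by rewrite divff// gt_eqF.
  have cc : amul (astar c) c = t%:C%C *: amul (astar a) a - amul (astar a) b -
      amul (astar b) a + t^-1%:C%C *: amul (astar b) b.
    rewrite /c (astarB HA) !(astarZ HA) !conjC_real_complex.
    rewrite (amulBl HA) !(amulBr HA) !(amulZl HA) !(amulZr HA) !scalerA.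
    rewrite -!rmorphM /= (mulrC s^-1 s) sK -invfM -expr2 st !scale1r.
    by rewrite opprD opprK addrA.
  have ab : amul (astar (a + b)) (a + b) = amul (astar a) a + amul (astar a) b +
      (amul (astar b) a + amul (astar b) b).
    by rewrite (astarD HA) (amulDl HA) !(amulDr HA).
  rewrite cc ab !(uinjD, uinjN, uinjZ) /P !scalerBr.
  have spl (r : R) (x : B) : (1 + r)%:C%C *: x = x + r%:C%C *: x.
    by rewrite rmorphD scalerDl rmorph1 scale1r.
  have spA (r r' p q : R) :
      (r * p + r' * q)%:C%C%:A = r%:C%C *: p%:C%C%:A + r'%:C%C *: q%:C%C%:A :> B.
    by rewrite rmorphD scalerDl !rmorphM /= !scalerA.
  rewrite spA [(1 + t)%:C%C *: (amul _ _)%:U]spl.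
  by rewrite [(1 + t^-1)%:C%C *: (amul _ _)%:U]spl -zmod_glue.
have saP d : ustar (P d) = P d.
  by rewrite /P (invoB HiB) (invo_real HiB) (invo1 HiB) ustar_sq.
have sarP (r : R) d : ustar (r%:C%C *: P d) = r%:C%C *: P d.
  by rewrite (invo_real HiB) saP.
have D := posD HnB HiB nB_star hermB.
have saD : ustar ((1 + t)%:C%C *: P a + (1 + t^-1)%:C%C *: P b) =
    (1 + t)%:C%C *: P a + (1 + t^-1)%:C%C *: P b.
  exact: (etrans (invoD HiB _ _) (congr2 +%R (sarP _ _) (sarP _ _))).
apply: (D _ _ saD (sqa c) _ (sym c)).
exact: (D _ _ (sarP _ _) (sarP _ _) (posZ tp (ptak_pos a)) (posZ ti (ptak_pos b))).
Qed.

Let ptak_cstar : cstar_norm ptak.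
Proof.
split=> [a b|z a|a h|a b|a].
- apply: (sqr_le_add (ptak_ge0 _) (ptak_ge0 a) (ptak_ge0 b)) => t t0.
  exact: ptakD_aux.
- apply: (eq_of_sqr (ptak_ge0 _) (mulr_ge0 (cabs_ge0 z) (ptak_ge0 a))).
  rewrite exprMn [LHS]ptak2 [X in _ = _ * X]ptak2 (astarZ HA) (amulZl HA) (amulZr HA).
  by rewrite scalerA uinjZ rhoZ cabsM cabs_conj -expr2.
- apply: pi_inj; rewrite raddf0; apply: opnorm0_eq0; apply/eqP.
  rewrite -sqrf_eq0 eq_le sqr_ge0 andbT; apply: (spr_pi (lexx 0)).
  have r0 : rho (amul (astar a) a)%:U = 0 by rewrite -ptak2 h expr0n.
  by rewrite -r0; exact: spr_rho.
- apply: (le_of_sqr (mulr_ge0 (ptak_ge0 a) (ptak_ge0 b))).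
  rewrite exprMn [leLHS]ptak2 [X in _ <= X * _]ptak2 [X in _ <= _ * X]ptak2.
  have -> : rho (amul (astar (amul a b)) (amul a b))%:U =
      rho ((amul (astar a) a)%:U * (amul b (astar b))%:U).
    rewrite (astarM HA) -(amulA HA) uinjM rho_swap -!uinjM; congr (rho _%:U).
    by rewrite !(amulA HA).
  have -> : rho (amul (astar b) b)%:U = rho (amul b (astar b))%:U.
    by rewrite uinjM rho_swap -uinjM.
  apply: rhoM; first exact: ustar_sq.
  by rewrite ustar_uinj (astarM HA) (astarK HA).
- apply: (eq_of_sqr (ptak_ge0 _) (sqr_ge0 _)).
  rewrite [LHS]ptak2 [X in _ = X ^+ 2]ptak2 (astarM HA) (astarK HA) uinjM.
  by rewrite -expr2 rhoX2.
Qed.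

(** Both sides are C*-norms. *)
Let ptakE a : ptak a = opnorm (pi a).
Proof.
have [_ [_ hu]] := HU.
by rewrite (hu _ ptak_cstar) -(hu _ (opnorm_cstar_norm pi_inj)).
Qed.

Lemma symmetric_spr_opnorm h : astar h = h -> spr_le h%:U (opnorm (pi h)).
Proof.
move=> hh; apply: spr_le_sqr; first exact: opnorm_ge0.
by rewrite -ptakE [X in spr_le _ X]ptak2 hh uinjM expr2; exact: spr_rho.
Qed.

(** The larger of the norms of an element and of its adjoint dominates [pi],
    by the C*-identity in the target. *)
Lemma symmetric_norm :
  exists2 n : A -> R, complete_anorm n & forall a, opnorm (pi a) <= n a.
Proof.
exists nrm; first exact: nrmP.
move=> a; have n0 : 0 <= nrm a by rewrite /nrm le_max nrm0_ge0.
apply: (le_of_sqr n0); apply: (le_trans (opnorm_nrm0 a)).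
apply: (le_trans (anrmM Hnrm0 _ _)); rewrite expr2.
by apply: ler_pM; rewrite ?nrm0_ge0// le_max lexx ?orbT.
Qed.

End symmetric.

(** * Spectral invariance *)

Section spectral_invariance.
Variables (R : realType) (A : starAlg R) (HA : star_axioms A).
Variables (H : hilbertType R) (pi : starRep A H) (nrm : A -> R).
Hypothesis pi_inj : injective pi.
Hypothesis Hn : complete_anorm nrm.
Hypothesis pi_nrm : forall a, opnorm (pi a) <= nrm a.
Hypothesis Hspr : forall h, astar h = h -> spr_le (uinj HA h) (opnorm (pi h)).
Local Notation B := (unitization HA).
Local Notation "a %:U" := (uinj HA a) (at level 2, format "a %:U").
Local Notation nB := (@unorm R A HA nrm).
Local Notation pit := (@urep R A HA H pi).

Let HnB : complete_norm nB := unorm_complete HA Hn.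
Let HiB := ustar_involution HA.

Let pitX x n u : pit (x ^+ n.+1) u = pit (x ^+ n) (pit x u).
Proof. by rewrite exprSr urepM. Qed.

Let pit_sub1 x u : pit (1 - x) u = u - pit x u.
Proof. by rewrite urepB urep1. Qed.

(** [w ^+ m * (w - s)] lies in [A] for [s = w.2], so its spectral radius is
    controlled by [pi] and decays like [q ^+ m]; at the point [1] of the
    spectrum of [w] it would have the constant value [1 - s]. *)
Let invertible_of_contraction (w : B) (q : R) : ustar w = w -> 0 <= q < 1 ->
  (forall u, hnorm (pit w u) <= q * hnorm u) -> w.2 != 1 -> invertible (1 - w).
Proof.
move=> ww /andP[q0 q1] hq w1; set s := w.2.
pose y m : B := w ^+ m * (w - s%:A).
have yy m : ustar (y m) = y m.
  rewrite /y (invoM HiB) (invoX HiB) (invoB HiB) (invoZ HiB) (invo1 HiB) ww.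
  have -> : s^* = s by rewrite /s -{2}ww.
  have c : GRing.comm (w - s%:A) w.
    by rewrite /GRing.comm mulrBl mulrBr -scalerAl -scalerAr mulr1 mul1r.
  exact: (commrX m c).
have y2 m : (y m).2 = 0.
  by rewrite sndM sndD sndN snd_scalar subrr mulr0.
pose K := opnorm (pit (w - s%:A)).
have hX m u : hnorm (pit (w ^+ m) u) <= q ^+ m * hnorm u.
  elim: m u => [|m ih] u; first by rewrite expr0 urep1 mul1r.
  rewrite pitX; apply: (le_trans (ih _)).
  by rewrite exprSr -mulrA ler_wpM2l ?exprn_ge0.
have hy m : opnorm (pi (y m).1) <= q ^+ m * K.
  have -> : pi (y m).1 = pit (y m) by rewrite (uinj_fst (y2 m)) urep_uinj.
  apply: opnorm_le => [|u]; first by rewrite mulr_ge0 ?exprn_ge0 ?opnorm_ge0.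
  rewrite urepM; apply: (le_trans (hX _ _)); rewrite -mulrA.
  by rewrite ler_wpM2l ?exprn_ge0 ?le_opnorm.
have s1 : 0 < cabs (1 - s) by rewrite cabs_gt0 subr_eq0 eq_sym.
have [m hm] : exists m, q ^+ m * K < cabs (1 - s).
  have /cvgrPdist_lt/(_ _ s1)[m _ hm] : geometric K q @ \oo --> (0 : R).
    by apply: cvg_geometric; rewrite ger0_norm.
  exists m; have /= := hm m (leqnn m); rewrite sub0r normrN mulrC.
  exact/le_lt_trans/ler_norm.
have iy : invertible (y m - (1 - s)%:A).
  rewrite (uinj_fst (y2 m)); apply: Hspr; last exact: le_lt_trans hm.
  by have := yy m; case: (y m) => a t [].
pose g := \sum_(i < m.+1) w ^+ i - s *: \sum_(i < m) w ^+ i.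
have cg : GRing.comm w g.
  rewrite /GRing.comm /g mulrBr mulrBl -scalerAr -scalerAl !mulr_sumr !mulr_suml.
  by congr (_ - _ *: _); apply: eq_bigr => i _; rewrite -exprS -exprSr.
have e : y m - (1 - s)%:A = (w - 1) * g.
  rewrite /g mulrBr -scalerAr -!subrX1 /y mulrBr -exprSr -scalerAr mulr1.
  rewrite scalerBl scale1r scalerBr !opprB.
  by rewrite (addrACA (w ^+ m.+1)) [RHS](addrACA (w ^+ m.+1)) (addrC (- 1)).
clearbody g; have : invertible (w - 1).
  apply: (@invertible_commM _ _ _ g); last by rewrite -e.
  by rewrite mulrBl mulrBr mul1r mulr1 cg.
by move=> /invertibleN; rewrite opprB.
Qed.

(** The preceding lemma for [w = 1 - x^* x / C]. *)
Let invertible_of_lower_bound (x : B) K : x.2 != 0 ->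
  (forall u, hnorm u <= K * hnorm (pit x u)) -> invertible (ustar x * x).
Proof.
move=> x2 hK.
have [C [q [C0 q01 hq]]] := adjoint_contraction (urep_adj pi x) hK.
have Ci0 : C^-1%:C%C != 0 :> R[i] by rewrite eq_complex /= invr_eq0 gt_eqF.
pose b := C^-1%:C%C *: (ustar x * x).
suff : invertible (1 - (1 - b)) by rewrite subKr => /(invertibleZE _ Ci0).
apply: invertible_of_contraction q01 _ _.
- by rewrite (invoB HiB) (invo1 HiB) (invo_real HiB) (invoM HiB) (invoK HiB).
- by move=> u; rewrite pit_sub1 /b urepZ urepM; exact: hq.
- rewrite sndD sndN sndZ sndM -subr_eq0 addrAC subrr add0r oppr_eq0.
  by rewrite !mulf_neq0// conjC_eq0.
Qed.

Let bop_invertible T := ainvertible (@bop_comp R H) (bop_id H) T.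

Let lower_bounds (S T : bop H) : adjoint S T -> bop_invertible T ->
  exists K, (forall u, hnorm u <= K * hnorm (T u)) /\
            (forall u, hnorm u <= K * hnorm (S u)).
Proof.
move=> adj [W [h1 h2]]; exists (opnorm W); split=> u.
  have {1}<- : W (T u) = u by have := congr1 (fun f : bop H => f u) h2.
  exact: le_opnorm.
have [->|u0] := eqVneq u 0; first by rewrite bop0 hnorm0 mulr0.
have hu : 0 < hnorm u by rewrite lt_neqAle hnorm_ge0 andbT eq_sym hnorm_eq0.
rewrite -(ler_pM2r hu) -expr2.
have -> : hnorm u ^+ 2 = cabs (inner (S u) (W u)).
  rewrite adj -[X in inner u X]/(bop_comp T W u) h1 innerE cabs_real.
  by rewrite ger0_norm ?sqr_ge0.
apply: (le_trans (cauchy_schwarz _ _)); rewrite mulrC mulrAC ler_wpM2r ?hnorm_ge0//.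
exact: le_opnorm.
Qed.

Let invertible_pit (x : B) : x.2 != 0 -> bop_invertible (pit x) -> invertible x.
Proof.
move=> x2 hx; have [K [h1 h2]] := lower_bounds (urep_adj pi x) hx.
have [c [_ c2]] := invertible_of_lower_bound x2 h1.
have s2 : (ustar x).2 != 0 by rewrite conjC_eq0.
have [d [d1 _]] := invertible_of_lower_bound s2 h2.
rewrite (invoK HiB) in d1.
by apply: (@invertible_lr _ _ x (c * ustar x) (ustar x * d)); rewrite -?mulrA// mulrA.
Qed.

(** If [pi f] is invertible, then [w = 1 - f^* f / C], with [w.2 = 1], has its
    spectrum in a small disc together with [1], and the idempotent of that disc
    belongs to [A]; [pi] maps it to the identity. It is computed from a square
    root of [(1 - 2 w) ^+ 2]. *)
Let unity_of_invertible (f : A) : bop_invertible (pi f) ->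
  exists e, is_unity (@amul R A) e.
Proof.
move=> hf; have [K [h1 _]] := lower_bounds (rep_adj pi f) hf.
have [C [q [C0 /andP[q0 q1] hq]]] := adjoint_contraction (rep_adj pi f) h1.
pose w : B := 1 - C^-1%:C%C *: (amul (astar f) f)%:U.
have ww : ustar w = w.
  by rewrite /w (invoB HiB) (invo1 HiB) (invo_real HiB) ustar_uinj (astarM HA) (astarK HA).
have w2 : w.2 = 1 by rewrite /w sndD sndN sndZ mulr0 subr0.
have hw u : hnorm (pit w u) <= q * hnorm u.
  by rewrite /w pit_sub1 urepZ urep_uinj starRepM; exact: hq.
have [n hn] : exists n, q ^+ n <= 16^-1.
  have /cvgrPdist_le/(_ 16^-1)[|n _ hn] : geometric 1 q @ \oo --> (0 : R).
  - by apply: cvg_geometric; rewrite ger0_norm.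
  - by rewrite invr_gt0.
  exists n; have /= := hn n (leqnn n); rewrite sub0r normrN mul1r.
  exact/le_trans/ler_norm.
pose v : B := w ^+ n.
have vv : ustar v = v by rewrite /v (invoX HiB) ww.
have v2 : v.2 = 1 by rewrite /v sndX w2 expr1n.
have hv u : hnorm (pit v u) <= 16^-1 * hnorm u.
  apply: (@le_trans _ _ (q ^+ n * hnorm u)); last by rewrite ler_wpM2r ?hnorm_ge0.
  rewrite /v; elim: (n) u => [|m ih] u; first by rewrite expr0 urep1 mul1r.
  rewrite pitX; apply: (le_trans (ih _)).
  by rewrite exprSr -mulrA ler_wpM2l ?exprn_ge0.
clearbody v; move=> {w ww w2 hw}.
pose x : B := (4 : R)%:C%C *: (v - v ^+ 2).
have xx : ustar x = x by rewrite /x (invo_real HiB) (invoB HiB) (invoX HiB) vv.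
have x2 : x.2 = 0 by rewrite /x sndZ sndD sndN sndX v2 expr1n subrr mulr0.
have hx u : hnorm (pit x u) <= 2^-1 * hnorm u.
  rewrite /x urepZ urepB hnormZ cabs_real normr_nat.
  have hD := hnormD (pit v u) (- (pit (v ^+ 2) u)).
  have hN : hnorm (- (pit (v ^+ 2) u)) = hnorm (pit v (pit v u)).
    by rewrite -scaleN1r hnormZ cabsN cabs1 mul1r expr2 urepM.
  have := hv u; have := hv (pit v u); rewrite hN in hD; have := hnorm_ge0 u.
  move: hD; rewrite -[hnorm (_ + - _)]/(hnorm ((pit v - pit (v ^+ 2)) u)).
  move: (hnorm ((pit v - pit (v ^+ 2)) u)) (hnorm (pit v u)) => r1 r2.
  by move: (hnorm (pit v (pit v u))) (hnorm u) => r3 r4; lra.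
have xE := uinj_fst x2.
have hsx : spr_le x 2^-1.
  rewrite xE; apply: (@spr_le_trans _ _ _ (opnorm (pi x.1))).
    by apply: opnorm_le => // u; rewrite -(urep_uinj HA) -xE.
  by apply: Hspr; move: xx; case: (x) => a t [].
have h34 : 0 <= (3 / 4 : R) < 1 by apply/andP; split; lra.
have hpx : pow_le nB x (3 / 4).
  by apply: (gelfand HnB) hsx; apply/andP; split; lra.
have [y hy Py] := sqrt_iteration HnB h34 hpx.
have cvx : GRing.comm x v.
  by rewrite /GRing.comm /x -scalerAl -scalerAr mulrBl mulrBr -exprS -exprSr.
have hpit (b : B) : opnorm (pit b) <= nB b.
  apply: opnorm_le => [|u]; first exact: (cnrm_ge0 HnB).
  rewrite urepE /unorm mulrDl; apply: (le_trans (hnormD _ _)); rewrite hnormZ.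
  rewrite lerD2r; apply: (le_trans (le_opnorm _ _)).
  by rewrite ler_wpM2r ?hnorm_ge0.
have y2 : y.2 = 0.
  apply: (Py (fun b => b.2 = 0)) => // [b b2|u l hu hl].
    by rewrite sndZ sndD sndX x2 b2 expr0n addr0 mulr0.
  apply/eqP; rewrite -cabs_eq0 eq_le cabs_ge0 andbT.
  apply: (ler_cvg_to (cvg_cst _) hl); apply: nearW => m.
  rewrite /unorm sndD hu sndN sub0r cabsN lerDr.
  exact: le_trans (opnorm_ge0 (pi _)) (pi_nrm _).
have cyv : GRing.comm y v.
  apply: (Py (fun b => GRing.comm b v)) => [|b cb|u l hu hl].
  - by rewrite /GRing.comm mul0r mulr0.
  - rewrite /GRing.comm -scalerAl -scalerAr mulrDl mulrDr cvx.
    by rewrite expr2 -mulrA cb !mulrA cb.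
  - apply: (nlim_uniq HnB (nlimMr HnB v hl)).
    by have := nlimMl HnB v hl; under eq_fun do rewrite -hu.
have hyp u : hnorm (pit y u) <= 2^-1 * hnorm u.
  apply: (le_trans (le_opnorm _ _)); rewrite ler_wpM2r ?hnorm_ge0// {u}.
  apply: (Py (fun b => opnorm (pit b) <= 2^-1)) => [|b hb|u l hu hl].
  - by apply: (le_trans (hpit _)); rewrite (cnrm0 HnB).
  - rewrite urepZ urepD expr2 urepM opnormZ cabsV cabs_nat.
    have hD := opnormD (pit x) (bop_comp (pit b) (pit b)).
    have hM := opnormM (pit b) (pit b).
    have hxo : opnorm (pit x) <= 2^-1 by apply: opnorm_le.
    have b0 := opnorm_ge0 (pit b).
    move: hD hM hb hxo b0; move: (opnorm (pit x + _)) (opnorm (bop_comp _ _)).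
    by move: (opnorm (pit b)) (opnorm (pit x)) => r1 r2 r3 r4; nra.
  - have hl' : 2^-1 + nB (u m - l) @[m --> \oo] --> (2^-1 + 0 : R).
      by apply: cvgD; [exact: cvg_cst|exact: hl].
    rewrite -[2^-1]addr0; apply: (ler_cvg_to (cvg_cst _) hl'); apply: nearW => m.
    have -> : l = u m - (u m - l) by rewrite subKr.
    rewrite urepB -scaleN1r; apply: (le_trans (opnormD _ _)).
    by rewrite opnormZ cabsN cabs1 mul1r subKr lerD.
pose k : B := 1 - y; pose r : B := 1 - v *+ 2.
have kk : k * k = 1 - x.
  rewrite /k mulrBl !mulrBr mul1r mulr1 mul1r -expr2.
  by rewrite opprB addrA addrAC -(addrA 1) -opprD -mulr2n hy opprD addrA subrK.
have rr : r * r = 1 - x.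
  have -> : x = (v - v ^+ 2) *+ 4 by rewrite /x rmorph_nat scaler_nat.
  rewrite /r mulrBl !mulrBr mul1r mulr1 mul1r mulrnAl mulrnAr -mulrnA -expr2.
  rewrite opprB addrA addrAC -(addrA 1) -opprD -mulrnDr mulrnBl.
  by rewrite (opprB (v *+ 4)) [RHS]addrA [RHS]addrAC.
have ckv : GRing.comm k v by rewrite /GRing.comm /k mulrBl mulrBr mul1r mulr1 cyv.
have k2 : k.2 = 1 by rewrite /k sndD sndN y2 subr0.
have [g [g1 g2]] : invertible k.
  by apply: (@invertible_commM _ _ _ k) => //; rewrite kk; exact: (neumann HnB h34 hpx).
have hg u : hnorm (pit g u) <= 2 * hnorm u.
  have e : u = pit g u - pit y (pit g u).
    by rewrite -pit_sub1 -/k -[RHS]/(bop_comp (pit k) (pit g) u) -urepM g1 urep1.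
  have := hnormD u (pit y (pit g u)); rewrite {1}e subrK.
  by have := hyp (pit g u); lra.
have crk : GRing.comm r k.
  by rewrite /GRing.comm /r mulrBl (mulrBr k) mul1r mulr1 mulrnAl mulrnAr ckv.
have cgr : GRing.comm g r.
  rewrite /GRing.comm -[RHS]mul1r -g2 -mulrA (mulrA k) -crk -!mulrA g1 mulr1.
  by [].
pose t : B := r * g.
have tt : t * t = 1.
  by rewrite /t mulrA -(mulrA r g r) cgr mulrA rr -kk -!mulrA (mulrA k g) g1 mul1r.
pose p : B := 2^-1 *: (1 + t); pose e : B := 2^-1 *: (1 - t).
have g22 : g.2 = 1.
  by have := congr1 snd g1; rewrite sndM k2 mul1r.
have r2 : r.2 = -1.
  by rewrite /r mulr2n sndD sndN sndD v2 opprD addrA subrr sub0r.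
have p2 : p.2 = 0.
  by rewrite /p sndZ sndD /t sndM r2 g22 mulr1 subrr mulr0.
have half2 : 2^-1 + 2^-1 = 1 :> R[i] by rewrite [RHS]splitr div1r.
have ep : p + e = 1.
  rewrite /p /e -scalerDr addrACA subrr addr0 scalerDr -scalerDl half2 scale1r.
  by [].
have ee : e * e = e.
  have idem (b : B) : b * b = 1 ->
      (2^-1 *: (1 - b)) * (2^-1 *: (1 - b)) = 2^-1 *: (1 - b).
    move=> bb; have bb2 : (1 - b) * (1 - b) = (1 - b) *+ 2.
      by rewrite mulrBl mul1r mulrBr mulr1 bb opprB mulr2n.
    rewrite -(scalerAl 2^-1) -(scalerAr 2^-1) bb2 -(scaler_nat 2 (1 - b)).
    rewrite (scalerA 2^-1 2).
    by rewrite mulVf ?scale1r// pnatr_eq0.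
  exact: idem.
have eE : e = 2^-1 *: ((v *+ 2 - y) * g).
  rewrite /e /t -g1 -mulrBl /k /r; congr (_ *: (_ * _)).
  by rewrite opprB addrC addrA subrK.
have pe u : hnorm (pit e u) <= 5 / 8 * hnorm u.
  rewrite eE urepZ urepM -[X in hnorm X]/(2^-1 *: pit (v *+ 2 - y) (pit g u)).
  rewrite hnormZ cabsV cabs_nat urepB (mulr2n v) urepD.
  have := hv (pit g u); have := hyp (pit g u); have := hg u.
  move: (pit g u) => u' hg' hy' hv'.
  have := hnormD (pit v u' + pit v u') (- (pit y u')).
  have := hnormD (pit v u') (pit v u').
  have -> : hnorm (- (pit y u')) = hnorm (pit y u').
    by rewrite -scaleN1r hnormZ cabsN cabs1 mul1r.
  rewrite -[X in _ <= _ -> hnorm X <= _ -> _]/((pit v + pit v - pit y) u').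
  move: hg' hy' hv'; move: (hnorm u) (hnorm u') (hnorm (pit v u')) (hnorm (pit y u')).
  move=> r1 r2' r3 r4.
  move: (hnorm (pit v u' + pit v u')) (hnorm ((pit v + pit v - pit y) u')).
  by move=> r5 r6; lra.
have pe0 u : pit e u = 0.
  apply/eqP; rewrite -hnorm_eq0; have := pe (pit e u).
  have -> : pit e (pit e u) = pit e u.
    by rewrite -[LHS]/(bop_comp (pit e) (pit e) u) -urepM ee.
  by have := hnorm_ge0 (pit e u); move=> h1' h2'; apply/eqP; lra.
exists p.1 => a.
have pid : pi p.1 = bop_id H.
  rewrite -(urep_uinj HA) -(uinj_fst p2) -[p](addrK e) ep urepB urep1.
  by apply: bop_ext => u; rewrite -[LHS]/(u - pit e u) pe0 subr0.
by split; apply: pi_inj; rewrite starRepM pid; apply: bop_ext.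
Qed.

(** The scalar part of [f - z] in the unitization is [- z]. In a unital algebra it
    is made nonzero by adding the difference of the two units; otherwise the value
    [z = 0] is excluded by [unity_of_invertible]. *)
Theorem spectral_invariance f :
  spectrum (@amul R A) f = spectrum (@bop_comp R H) (pi f).
Proof.
have bop_unity T : is_unity (@bop_comp R H) T -> T = bop_id H.
  by move=> hT; rewrite -(hT (bop_id H)).1; apply: bop_ext.
have idU : is_unity (@bop_comp R H) (bop_id H).
  by move=> T; split; apply: bop_ext.
have RHSE z : spectrum (@bop_comp R H) (pi f) z <->
    ~ bop_invertible (pi f - z *: bop_id H).
  split=> [[[T /bop_unity -> //]|[[]]]|h]; first by exists (bop_id H).
  by left; exists (bop_id H).
have pitf z : pit (f%:U - z%:A) = pi f - z *: bop_id H.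
  by rewrite urepB urepZ urep1 urep_uinj.
apply/seteqP; split=> z.
- move=> hz; apply/RHSE => hpi; case: hz => [[e he]|[ne]]; apply.
  + have hg : invertible ((f - z *: e + e)%:U - 1%:A).
      apply: invertible_pit.
        by rewrite sndD sndN snd_scalar sub0r oppr_eq0 oner_eq0.
      have piE : pi (f - z *: e + e) = pi f - z *: pi e + pi e.
        by rewrite raddfD raddfB /= linearZ.
      by rewrite urepB urepZ urep1 urep_uinj scale1r piE (starRep1 pi he) addrK.
    move: hg => [[a t]]; rewrite uinjB_scalar => -[[h1 h1'] [h2 h2']].
    have {h1'} tE : t = -1 by move: h1'; rewrite mulN1r => <-; rewrite opprK.
    move: h1 h2; rewrite /= tE !scaleN1r => h1 h2.
    exists (a - e); split.
    * rewrite (amulBr HA) (he _).2; move: h1; rewrite (amulDl HA) (he a).1.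
      rewrite addrAC addrK opprD addrA => /eqP; rewrite subr_eq0 => /eqP -> //.
    * rewrite (amulBl HA) (he _).1; move: h2; rewrite (amulDr HA) (he a).2.
      by rewrite addrK opprD addrA => /eqP; rewrite subr_eq0 => /eqP.
  + have [z0|z0] := eqVneq z 0.
      case: ne; apply: (unity_of_invertible (f := f)).
      by move: hpi; rewrite z0 scale0r subr0.
    have : invertible (f%:U - z%:A).
      apply: invertible_pit; first by rewrite sndD sndN snd_scalar sub0r oppr_eq0.
      by rewrite pitf.
    by rewrite uinjB_scalar.
- move=> /RHSE hz.
  have [[e he]|ne] := pselect (exists e, is_unity (@amul R A) e).
    left; exists e => // -[b [h1 h2]]; apply: hz; exists (pi b).
    by rewrite -(starRep1 pi he) -linearZ -raddfB -!starRepM h1 h2.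
  right; split=> // hi; apply: hz; rewrite -pitf; apply: urep_invertible.
  by rewrite uinjB_scalar.
Qed.

End spectral_invariance.

(** * Haar measures *)

Lemma open_borel (X : ptopologicalType) (U : set X) :
  open U -> measurable (U : set (borel X)).
Proof. exact: sub_sigma_algebra. Qed.

Lemma closed_borel (X : ptopologicalType) (U : set X) :
  closed U -> measurable (U : set (borel X)).
Proof.
move=> cU; rewrite -[U]setCK; apply: measurableC; apply: open_borel.
exact: closed_openC.
Qed.

Lemma continuous_borel (X Y : ptopologicalType) (f : X -> Y) :
  continuous f -> measurable_fun [set: borel X] (f : borel X -> borel Y).
Proof.
move=> cf; apply: (@measurability _ _ (borel X) (borel Y) _ _ (@open Y)) => //.
move=> _ [U oU <-]; rewrite setTI; apply: open_borel.
by move/continuousP: cf; apply.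
Qed.

Section translations.
Variable G : topologicalGroupType.
Implicit Types (x y : G) (A B : set G).

Lemma mulgl_continuous x : continuous (fun y : G => (x * y)%g).
Proof.
move=> y; apply: (@continuous_comp _ _ _ (fun y : G => (x, y))
  (fun p : G * G => (p.1 * p.2)%g)); last exact: mulg_continuous.
by apply: cvg_pair; [exact: cvg_cst|exact: cvg_id].
Qed.

Lemma mulgr_continuous x : continuous (fun y : G => (y * x)%g).
Proof.
move=> y; apply: (@continuous_comp _ _ _ (fun y : G => (y, x))
  (fun p : G * G => (p.1 * p.2)%g)); last exact: mulg_continuous.
by apply: cvg_pair; [exact: cvg_id|exact: cvg_cst].
Qed.

Lemma ldiv_continuous : continuous (fun p : G * G => (p.1^-1 * p.2)%g).
Proof.
move=> p; apply: (@continuous_comp _ _ _ (fun p : G * G => (p.1^-1%g, p.2))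
  (fun p : G * G => (p.1 * p.2)%g)); last exact: mulg_continuous.
apply: cvg_pair; last exact: cvg_snd.
apply: (@continuous_comp _ _ _ fst (fun y : G => y^-1%g)); first exact: cvg_fst.
exact: invg_continuous.
Qed.

Lemma ldivl_continuous x : continuous (fun y : G => (y^-1 * x)%g).
Proof.
move=> y; apply: (@continuous_comp _ _ _ (fun y : G => y^-1%g)
  (fun y : G => (y * x)%g)); first exact: invg_continuous.
exact: mulgr_continuous.
Qed.

Lemma image_mulgl x A : [set (x * y)%g | y in A] = [set y | A (x^-1 * y)%g].
Proof.
apply/seteqP; split => [_ [y Ay <-] /=|y Ay]; first by rewrite mulKg.
by exists (x^-1 * y)%g => //; rewrite mulVKg.
Qed.

Lemma image_mulgr x A : [set (y * x)%g | y in A] = [set y | A (y * x^-1)%g].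
Proof.
apply/seteqP; split => [_ [y Ay <-] /=|y Ay]; first by rewrite mulgK.
by exists (y * x^-1)%g => //; rewrite mulgVK.
Qed.

End translations.

Section haar.
Variables (R : realType) (G : topologicalGroupType).
Hypothesis hausdorffG : hausdorff_space G.
Variable mu : {measure set (borel G) -> \bar R}.
Hypothesis Hmu : left_haar mu.

Lemma compact_borel (K : set G) : compact K -> measurable (K : set (borel G)).
Proof. by move=> cK; apply: closed_borel; exact: compact_closed. Qed.

Lemma haar_transl x (A : set G) : measurable (A : set (borel G)) ->
  mu [set y | A (x^-1 * y)%g] = mu A.
Proof. by move=> mA; rewrite -image_mulgl; exact: left_haar_invariant Hmu _ _ mA. Qed.

Lemma haar_le (A B : set G) : measurable (A : set (borel G)) ->
  measurable (B : set (borel G)) -> A `<=` B -> (mu A <= mu B)%E.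
Proof. by move=> mA mB AB; apply: le_measure; rewrite ?inE. Qed.

Lemma haar_inner (U : set G) (t : \bar R) : open U -> (t < mu U)%E ->
  exists K : set G, [/\ compact K, K `<=` U & (t < mu K)%E].
Proof.
move=> oU; rewrite (left_haar_inner Hmu oU) => /ereal_sup_gt[_ [K [cK KU] <-] tK].
by exists K.
Qed.

Lemma haar_outer (A : set G) (t : \bar R) : measurable (A : set (borel G)) ->
  (mu A < t)%E -> exists U : set G, [/\ open U, A `<=` U & (mu U < t)%E].
Proof.
move=> mA; rewrite (left_haar_outer Hmu mA) => /ereal_inf_lt[_ [U [oU AU] <-] tU].
by exists U.
Qed.

End haar.

(** * The convolution of two open sets *)

(** Lower Riemann sums of the layer cake formula. *)
Lemma layer_sum_le (R : realType) (d r : R) (n : nat) : 0 <= d -> 0 <= r ->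
  \sum_(i < n) (if d * i.+1%:R < r then d else 0) <= r.
Proof.
move=> d0 r0; elim: n => [|n IH]; first by rewrite big_ord0.
rewrite big_ord_recr /=; case: ifPn => [h|_]; last by rewrite addr0.
apply: (le_trans _ (ltW h)); rewrite -natr1 mulrDr mulr1 lerD2r.
rewrite mulr_natr -[in leRHS](card_ord n) -sumr_const ler_sum// => i _.
by case: ifP.
Qed.

Lemma layer_sum_ge (R : realType) (d r : R) (n : nat) : 0 <= d ->
  r <= d * n%:R -> r - d <= \sum_(i < n) (if d * i.+1%:R < r then d else 0).
Proof.
move=> d0; have full k : d * k%:R < r ->
    \sum_(i < k) (if d * i.+1%:R < r then d else 0) = d * k%:R.
  move=> h; rewrite (eq_bigr (fun=> d)) => [|i _].
    by rewrite sumr_const card_ord mulr_natr.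
  rewrite ifT//; apply: le_lt_trans h; rewrite ler_wpM2l// ler_nat.
  exact: ltn_ord.
elim: n => [|n IH]; first by rewrite big_ord0 mulr0; lra.
move=> h; rewrite big_ord_recr /= ltNge h /= addr0.
have [/IH//|h2] := leP r (d * n%:R).
by rewrite full//; move: h; rewrite -natr1 mulrDr mulr1; lra.
Qed.

Lemma lte_mul_shift (R : realFieldType) (b r d : R) (x : \bar R) : 0 < d ->
  (0 <= x)%E -> (b%:E < d%:E * x + r%:E)%E = (((b - r) / d)%:E < x)%E.
Proof.
move=> d0; case: x => [x _|_|//]; last first.
  by rewrite mulry gtr0_sg// mul1e addye// !ltry.
by rewrite -EFinM -EFinD !lte_fin ltr_pdivrMr// mulrC ltrBlDr.
Qed.

Section open_convolution.
Variables (R : realType) (G : topologicalGroupType).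
Hypothesis hausdorffG : hausdorff_space G.
Variable mu : {measure set (borel G) -> \bar R}.
Hypothesis Hmu : left_haar mu.
Variables U V : set G.
Hypotheses (oU : open U) (oV : open V).

(** The set over which the convolution at [x] of the indicators of [U] and [V]
    integrates. *)
Definition conv_section x : set G := U `&` [set y | V (y^-1 * x)%g].

Lemma open_conv_section x : open (conv_section x).
Proof.
apply: openI => //; rewrite -[[set y | _]]/((fun y => (y^-1 * x)%g) @^-1` V).
by move/continuousP: (@ldivl_continuous G x); apply.
Qed.

Lemma mu_conv_section x : (mu (conv_section x) <= mu U)%E.
Proof.
apply: haar_le; [apply: open_borel; exact: open_conv_section|exact: open_borel|].
exact: subIsetl.
Qed.

(** The tube lemma, for the open set of the pairs [(x, y)] with [y] in [U] and
    [y^-1 x] in [V]. *)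
Lemma conv_section_tube (K : set G) x : compact K -> K `<=` conv_section x ->
  exists A : set G, [/\ open A, A x & forall x', A x' -> K `<=` conv_section x'].
Proof.
move=> /compact_near_coveringP cK Kx.
have : \forall x' \near x, K `<=` [set y | conv_section x' y].
  apply: (cK _ (nbhs x) (fun x' y => conv_section x' y)) => y Ky.
  have [Uy Vy] := Kx _ Ky.
  have VV : \forall p \near (y, x), V (p.1^-1 * p.2)%g.
    apply: (@ldiv_continuous G (y, x)); exact: open_nbhs_nbhs.
  have UU : \forall p \near (y, x), U p.1.
    by apply: (@cvg_fst _ _ (nbhs y) (nbhs x)); exact: open_nbhs_nbhs.
  by apply: filterS2 VV UU => -[y' x'].
rewrite /prop_near1 nbhsE => -[A [oA Ax] AK]; exists A; split=> // x' Ax'; exact: AK.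
Qed.

Definition conv_level (t : R) : set G := [set x | (t%:E < mu (conv_section x))%E].

Lemma open_conv_level t : open (conv_level t).
Proof.
rewrite openE => x tx.
have [K [cK Kx tK]] := haar_inner Hmu (open_conv_section x) tx.
have [A [oA Ax AK]] := conv_section_tube cK Kx.
apply: (@filterS _ (nbhs x) _ A); last exact: open_nbhs_nbhs.
move=> x' /AK Kx'; apply: (lt_le_trans tK); apply: haar_le => //.
  exact: compact_borel.
by apply: open_borel; exact: open_conv_section.
Qed.

(** The Borel sets of [G * G] may be more than the products of Borel sets; the
    open set of the pairs [(x, y)] above is only accessible to Tonelli's theorem
    through the finite unions of rectangles inside it. *)
Definition rectangles (s : seq (set G * set G)) : set (G * G) :=
  [set p | exists2 r, r \in s & (r.1 `*` r.2) p].

Definition conv_rectangle (r : set G * set G) : Prop :=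
  [/\ open r.1, compact r.2, r.2 !=set0 & forall x, r.1 x -> r.2 `<=` conv_section x].

Lemma conv_level_cover t (C : set G) : 0 <= t :> R -> compact C -> C `<=` conv_level t ->
  exists s : seq (set G * set G), (forall r, r \in s -> conv_rectangle r) /\
    forall x, C x -> exists2 r, r \in s & r.1 x /\ (t%:E < mu r.2)%E.
Proof.
move=> t0 cC CO.
have pick x : exists r : set G * set G, C x ->
    [/\ conv_rectangle r, r.1 x & (t%:E < mu r.2)%E].
  case: (pselect (C x)) => [Cx|nCx]; last by exists (set0, set0).
  have [K [cK Kx tK]] := haar_inner Hmu (open_conv_section x) (CO _ Cx).
  have [A [oA Ax AK]] := conv_section_tube cK Kx.
  exists (A, K) => _; split=> //; split=> //=.
  apply/set0P; apply: contraTneq tK => ->.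
  by rewrite measure0 -leNgt lee_fin.
have [F HF] := choice pick.
move: (cC); rewrite compact_cover => /(_ G C (fun x => (F x).1)).
case=> [x /HF[[]]//|x Cx|D DC CD]; first by exists x => //; have [] := HF _ Cx.
exists [seq F x | x <- finmap.enum_fset D]; split=> [r /mapP[x xD ->]|x /CD[y yD Fyx]].
  by have [] := HF x (set_mem (DC _ xD)).
have Cy := set_mem (DC _ yD).
by exists (F y); [exact: map_f|split=> //; have [] := HF _ Cy].
Qed.



Hypotheses (Ufin : (mu U < +oo)%E) (Vfin : (mu V < +oo)%E).

Lemma conv_rectangle_fin (r : set G * set G) : conv_rectangle r -> (mu r.1 < +oo)%E.
Proof.
move=> [oA cK [y Ky] AK].
apply: le_lt_trans Vfin; rewrite -(haar_transl Hmu y (open_borel oV)).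
apply: haar_le; [exact: open_borel| |by move=> x /AK/(_ _ Ky)[]].
apply: open_borel; rewrite -[[set x | _]]/((fun x => (y^-1 * x)%g) @^-1` V).
by move/continuousP: (@mulgl_continuous G y^-1%g); apply.
Qed.

(** Tonelli on finitely many rectangles: integrating first over [x], the section
    at [y] lies in the translate [y V]. *)
Lemma tonelli_rectangles (s : seq (set G * set G)) (n : nat) (d : R)
    (C : nat -> set G) : 0 <= d ->
  (forall r, r \in s -> conv_rectangle r) ->
  (forall i, (i < n)%N -> compact (C i)) ->
  (forall i, (i < n)%N -> forall x, C i x ->
     exists2 r, r \in s & r.1 x /\ ((d * i.+1%:R)%:E < mu r.2)%E) ->
  (\sum_(i < n) d%:E * mu (C i) <= mu U * mu V)%E.
Proof.
move=> d0 Hs cC HC.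
pose X0 : set G := \bigcup_(r in [set` s]) r.1.
have oX0 : open X0 by apply: bigcup_open => r /Hs[].
have mX0 : measurable (X0 : set (borel G)) by exact: open_borel.
have X0fin : (mu X0 < +oo)%E.
  have -> : X0 = \big[setU/set0]_(r <- s) r.1 by rewrite -bigcup_seq.
  have : forall r, r \in s -> conv_rectangle r := Hs.
  elim: s {Hs HC X0 oX0 mX0} => [|r s IH] Hs; first by rewrite big_nil measure0.
  have ors r' : r' \in r :: s -> open r'.1 by move/Hs => [].
  rewrite big_cons; apply: (le_lt_trans (measureU2 _ _ _)).
  - by apply: open_borel; apply: ors; rewrite mem_head.
  - rewrite -bigcup_seq; apply: open_borel; apply: bigcup_open => r' r's.
    by apply: ors; rewrite inE r's orbT.
  - apply: lte_add_pinfty; first by apply: conv_rectangle_fin; apply: Hs; rewrite mem_head.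
    by apply: IH => r' r's; apply: Hs; rewrite inE r's orbT.
pose m1 : {finite_measure set (borel G) -> \bar R} := mfrestr mX0 X0fin.
pose m2 : {finite_measure set (borel G) -> \bar R} := mfrestr (open_borel oU) Ufin.
pose W : set (borel G * borel G) := rectangles s.
have mW : measurable W.
  have -> : W = \big[setU/set0]_(r <- s) (r.1 `*` r.2).
    by rewrite -bigcup_seq; apply/seteqP; split => p [r rs rp]; exists r.
  rewrite big_seq; apply: bigsetU_measurable => r /Hs[oA cK _ _].
  by apply: measurableX; [exact: open_borel|exact: compact_borel].
have := @indic_fubini_tonelli _ _ (borel G) (borel G) R m1 m2 W mW.
rewrite indic_fubini_tonelli_FE// indic_fubini_tonelli_GE//= => E.
apply: (@le_trans _ _ (\int[m1]_x (m2 \o xsection W) x)%E); last first.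
  rewrite E; apply: (@le_trans _ _ (\int[m2]_y (mu V))%E).
    apply: ge0_le_integral => //.
    - exact: (measurable_fun_ysection m1 mW).
    - move=> y _; rewrite /= -(haar_transl Hmu y (open_borel oV)).
      apply: haar_le.
      + by apply: measurableI => //; exact: measurable_ysection.
      + apply: open_borel; rewrite -[[set x | _]]/((fun x => (y^-1 * x)%g) @^-1` V).
        by move/continuousP: (@mulgl_continuous G y^-1%g); apply.
      + move=> x [/=]; rewrite /ysection /= inE => -[r /Hs[_ _ _ AK]].
        by move=> [/AK + Ky] => /(_ _ Ky)[].
  rewrite integral_cst// muleC; apply: lee_wpmul2r; first exact: measure_ge0.
  by rewrite /m2 /= /mfrestr /mrestr setTI.
have mC i : (i < n)%N -> measurable (C i : set (borel G)).
  by move=> ?; apply: compact_borel => //; exact: cC.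
have -> : (\sum_(i < n) d%:E * mu (C i) =
    \int[m1]_x (\sum_(i < n) (d * \1_(C i) x)%:E))%E.
  rewrite ge0_integral_sum//.
  - apply: eq_bigr => i _.
    under eq_integral do rewrite EFinM.
    rewrite ge0_integralZl_EFin//; last first.
    + by apply/measurable_EFinP/measurable_indic; exact: mC.
    + rewrite integral_indic ?setIT//; last exact: mC.
      rewrite /m1 /= /mfrestr /mrestr; congr (_ * mu _)%E.
      apply/esym/setIidl => x Cx; have [r rs [rx _]] := HC i (ltn_ord i) x Cx.
      by exists r.
  - move=> i; apply/measurable_EFinP; apply: measurable_funM => //.
    by apply: measurable_indic; exact: mC.
  - by move=> i x _; rewrite lee_fin mulr_ge0.
apply: ge0_le_integral => //.
- by move=> x _; apply: sume_ge0 => i _; rewrite lee_fin mulr_ge0.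
- apply: emeasurable_sum => i; apply/measurable_EFinP; apply: measurable_funM => //.
  by apply: measurable_indic; exact: mC.
- exact: (measurable_fun_xsection m2 mW).
move=> x _; set w := (m2 \o xsection W) x.
have wfin : w \is a fin_num by apply: fin_num_measure; exact: measurable_xsection.
rewrite -(fineK wfin) sumEFin lee_fin.
have f0 : 0 <= fine w by apply: fine_ge0; exact: measure_ge0.
apply: le_trans (layer_sum_le n d0 f0); apply: ler_sum => i _.
rewrite indicE; case: (boolP (x \in C i)) => [/set_mem Cx|_]; last first.
  by rewrite mulr0; case: ifP.
rewrite mulr1 ifT// -lte_fin fineK//.
have [r rs [rx rt]] := HC i (ltn_ord i) x Cx.
apply: (lt_le_trans rt); have [oA cK _ AK] := Hs _ rs.
rewrite /w /= /mfrestr /mrestr; apply: haar_le.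
- exact: compact_borel.
- by apply: measurableI; [exact: measurable_xsection|exact: open_borel].
- move=> y Ky; split; last by have [] := AK _ rx _ Ky.
  by rewrite /xsection /= inE; exists r.
Qed.

(** By inner regularity it is enough to bound the sums over compact subsets of
    the levels, which are replaced by the levels one at a time. *)
Lemma conv_level_sum (n : nat) (d : R) : 0 < d ->
  (\sum_(i < n) d%:E * mu (conv_level (d * i.+1%:R)) <= mu U * mu V)%E.
Proof.
move=> d0; have Bfin : (mu U * mu V)%E \is a fin_num.
  by rewrite fin_numM// ge0_fin_numE.
pose O (i : nat) := conv_level (d * i.+1%:R).
suff H k : (k <= n)%N -> forall C : nat -> set G,
    (forall i, (i < n)%N -> compact (C i) /\ C i `<=` O i) ->
    (\sum_(i < n) d%:E * (if (i < k)%N then mu (O i) else mu (C i))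
      <= mu U * mu V)%E.
  have /(_ (fun=> set0)) := H n (leqnn n).
  under eq_bigr do rewrite ltn_ord.
  by apply=> i _; split; [exact: compact0|exact: sub0set].
elim: k => [_ C HC|k IH kn C HC] /=.
  have cover i : exists s : seq (set G * set G), (i < n)%N ->
      (forall r, r \in s -> conv_rectangle r) /\ forall x, C i x ->
      exists2 r, r \in s & r.1 x /\ ((d * i.+1%:R)%:E < mu r.2)%E.
    case: (ltnP i n) => [/HC[cC CO]|_]; last by exists [::].
    have [|s Hs] := conv_level_cover _ cC CO; first by rewrite mulr_ge0 ?ltW.
    by exists s.
  have [S HS] := choice cover.
  apply: (@tonelli_rectangles (flatten [seq S i | i <- iota 0 n])).
  - exact: ltW.
  - move=> r /flattenP[_ /mapP[i + ->]]; rewrite mem_iota add0n => /andP[_ /HS[h _]].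
    exact: h.
  - by move=> i /HC[].
  - move=> i lin x Cx; have [_ /(_ x Cx)[r rS rx]] := HS _ lin.
    exists r => //; apply/flattenP; exists (S i) => //; apply: map_f.
    by rewrite mem_iota.
rewrite (bigD1 (Ordinal kn))//= ltnSn.
set rest := (\sum_(i < n | _) _)%E.
have HK (K : set G) : compact K -> K `<=` O k -> (d%:E * mu K + rest <= mu U * mu V)%E.
  move=> cK KO; have := IH (ltnW kn) (fun i => if i == k then K else C i).
  rewrite (bigD1 (Ordinal kn))//= ltnn eqxx.
  rewrite (eq_bigr (fun i : 'I_n => d%:E * (if (i < k.+1)%N then mu (O i) else mu (C i)))%E).
    by apply=> i lin; case: eqP => [->|_]; [|exact: HC].
  move=> i; rewrite -val_eqE /= => ik; rewrite (negbTE ik).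
  by rewrite [(i < k.+1)%N]ltnS [(i <= k)%N]leq_eqVlt (negbTE ik).
have rest0 : (0 <= rest)%E.
  apply: sume_ge0 => i _; apply: mule_ge0; first by rewrite lee_fin ltW.
  by case: ifP.
have restfin : rest \is a fin_num.
  rewrite ge0_fin_numE//; apply: (@le_lt_trans _ _ (mu U * mu V)%E).
    by have := HK _ (@compact0 _) (@sub0set _ _); rewrite measure0 mule0 add0e.
  by rewrite -ge0_fin_numE//; apply: mule_ge0.
rewrite leNgt; apply/negP => hlt.
move: hlt; rewrite -(fineK Bfin) -(fineK restfin) lte_mul_shift//.
move=> /(haar_inner Hmu (@open_conv_level _))[K [cK KO]].
have := HK K cK KO; rewrite -(fineK Bfin) -(fineK restfin) leNgt => /negP nK hK.
by apply: nK; rewrite lte_mul_shift.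
Qed.

Lemma conv_section_fin x : mu (conv_section x) \is a fin_num.
Proof. by rewrite ge0_fin_numE//; apply: le_lt_trans Ufin; exact: mu_conv_section. Qed.

Lemma measurable_conv_section :
  measurable_fun [set: borel G] (fun x : borel G => mu (conv_section x)).
Proof.
move=> _; apply: (measurability _ (ErealGenOInfty.measurableE R)) => //.
move=> _ [_ [t ->] <-]; rewrite setTI; apply: open_borel.
rewrite (_ : _ @^-1` _ = conv_level t); first exact: open_conv_level.
by apply/seteqP; split => x /=; rewrite in_itv /= andbT.
Qed.

(** The inequality [|1_U * 1_V| <= |1_U| |1_V|] of L^1 norms. *)
Lemma integral_conv_section :
  (\int[mu]_x mu (conv_section x) <= mu U * mu V)%E.
Proof.
have [M HM] : exists M : nat, fine (mu U) <= M%:R.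
  exists (Num.truncn (fine (mu U))).+1; apply: ltW; exact: truncnS_gt.
pose d n : R := n.+1%:R^-1.
have d0 n : 0 < d n by rewrite invr_gt0 ltr0n.
pose f n (x : borel G) : \bar R :=
  (\sum_(i < n.+1 * M) (if d n * i.+1%:R < fine (mu (conv_section x)) then d n else 0))%:E.
have fE n x : f n x = (\sum_(i < n.+1 * M) d n * \1_(conv_level (d n * i.+1%:R)) x)%:E.
  congr EFin; apply: eq_bigr => i _; rewrite indicE /conv_level.
  rewrite (_ : (x \in _) = (d n * i.+1%:R < fine (mu (conv_section x)))).
    by case: ifP; rewrite ?mulr1 ?mulr0.
  by rewrite -lte_fin fineK ?conv_section_fin//; apply/idP/idP => [/set_mem|/mem_set].
have f0 n x : (0 <= f n x)%E.
  by rewrite lee_fin sumr_ge0// => i _; case: ifP => // _; exact: ltW.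
have mlev t : measurable (conv_level t : set (borel G)).
  by apply: open_borel; exact: open_conv_level.
have mf n : measurable_fun [set: borel G] (f n).
  rewrite (_ : f n = fun x => (\sum_(i < n.+1 * M) d n * \1_(conv_level (d n * i.+1%:R)) x)%:E); last exact/funext/fE.
  apply/measurable_EFinP; apply: measurable_sum => i.
  by apply: measurable_funM => //; exact: measurable_indic.
have If n : (\int[mu]_x f n x <= mu U * mu V)%E.
  under eq_integral do rewrite fE -sumEFin.
  rewrite ge0_integral_sum//.
  - apply: le_trans (conv_level_sum (n.+1 * M) (d0 n)).
    apply: lee_sum => i _; under eq_integral do rewrite EFinM.
    rewrite ge0_integralZl_EFin//.
    + by rewrite integral_indic ?setIT.
    + by apply/measurable_EFinP/measurable_indic.
    + exact: ltW.
  - move=> i; apply/measurable_EFinP; exact: measurable_funM.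
  - by move=> i x _; rewrite lee_fin mulr_ge0// ltW.
have lim x : limn_einf (f^~ x) = mu (conv_section x).
  have cv : (f^~ x) @ \oo --> mu (conv_section x).
    rewrite -(fineK (conv_section_fin x)); set r := fine _.
    have r0 : 0 <= r by exact: fine_ge0.
    apply/fine_cvgP; split; first exact: nearW.
    apply: (@squeeze_cvgr _ _ _ _ (fun n => r - d n) (cst r)).
    - near=> n; apply/andP; split; last by apply: layer_sum_le => //; exact: ltW.
      apply: layer_sum_ge; first exact: ltW.
      rewrite natrM mulrA mulVf ?mul1r ?pnatr_eq0//.
      apply: le_trans HM; apply: fine_le; rewrite ?conv_section_fin ?ge0_fin_numE//.
      exact: mu_conv_section.
    - rewrite -[X in _ --> X]subr0; apply: cvgB; first exact: cvg_cst.
      exact: cvg_harmonic.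
    - exact: cvg_cst.
  by rewrite is_cvg_limn_einfE; [exact/cvg_lim|apply/cvg_ex; exists (mu (conv_section x))].
under eq_integral do rewrite -lim.
apply: (@le_trans _ _ (limn_einf (fun n => \int[mu]_x f n x)%E)); first exact: fatou.
rewrite limn_einf_lim; apply: lime_le; first exact: is_cvg_einfs.
near=> n; apply: le_trans (If n); apply: ereal_inf_lbound; exists n => //=.
Unshelve. all: by end_near. Qed.

End open_convolution.

(** * Submultiplicativity of the L^1 norm *)

(** The partition of the positive reals by the powers of [e], indexed by natural
    numbers through an enumeration of the integers. *)
Definition exp_level (R : realType) (n : nat) : set R :=
  if (pickle_inv n : option int) is Some k
  then [set r | expR k%:~R <= r < expR (k + 1)%:~R] else set0.
Arguments exp_level : clear implicits.
Definition exp_bound (R : realType) (n : nat) : R :=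
  if (pickle_inv n : option int) is Some k then expR k%:~R else 0.

Section exp_level.
Variable R : realType.

Lemma exp_bound_ge0 n : 0 <= exp_bound R n.
Proof. by rewrite /exp_bound; case: pickle_inv => // k; exact: expR_ge0. Qed.

Lemma exp_levelP n (r : R) : exp_level R n r ->
  [/\ 0 < exp_bound R n, exp_bound R n <= r & r <= expR 1 * exp_bound R n].
Proof.
rewrite /exp_level /exp_bound; case: pickle_inv => //= k /andP[h1 h2].
by rewrite expR_gt0; split=> //; rewrite -expRD addrC -intrD1 ltW// -rmorphD.
Qed.

Lemma exp_level_cover (r : R) : 0 < r -> exists n, exp_level R n r.
Proof.
move=> r0; exists (pickle (Num.floor (ln r))).
rewrite /exp_level pickleK_inv /=.
have := floor_itv (ln r); rewrite -(ler_expR (_%:~R)) -(ltr_expR _ (_%:~R)) lnK//.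
Qed.

Lemma trivIset_exp_level : trivIset setT (exp_level R).
Proof.
move=> n m _ _ [r []]; rewrite /exp_level.
case En: (pickle_inv n) => [k|//] /=; case Em: (pickle_inv m) => [l|//] /=.
move=> /andP[k1 k2] /andP[l1 l2].
have kl : (k < l + 1)%R by rewrite -(ltr_int R) -ltr_expR; exact: le_lt_trans l2.
have lk : (l < k + 1)%R by rewrite -(ltr_int R) -ltr_expR; exact: le_lt_trans k2.
have E : k = l by apply/eqP; rewrite eq_le -!ltzD1 kl lk.
have := pickle_invK (T := int) n; have := pickle_invK (T := int) m.
by rewrite En Em /= E => <- <-.
Qed.

Lemma measurable_exp_level n : measurable (exp_level R n).
Proof.
rewrite /exp_level; case: pickle_inv => [k|//].
rewrite (_ : mkset _ = [set` `[expR k%:~R, expR (k + 1)%:~R[]) //.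
Qed.

End exp_level.

Section outer_series.
Variables (R : realType) (G : topologicalGroupType).
Hypothesis hausdorffG : hausdorff_space G.
Variable mu : {measure set (borel G) -> \bar R}.
Hypothesis Hmu : left_haar mu.

(** Outer regularity, level by level, for the partition of the positive reals in
    exponential intervals, which costs a constant factor. *)
Lemma outer_series (f : G -> R) (e : R) :
  measurable_fun [set: borel G] (f : borel G -> R) -> (forall x, 0 <= f x) ->
  (\int[mu]_x (f x)%:E < +oo)%E -> 0 < e ->
  exists (a : nat -> R) (U : nat -> set G),
    [/\ forall n, 0 <= a n, forall n, open (U n) /\ (mu (U n) < +oo)%E,
        forall x, ((f x)%:E <= \sum_(n <oo) (a n)%:E * (\1_(U n) x)%:E)%E &
        (\sum_(n <oo) (a n)%:E * mu (U n) <=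
          (expR 1)%:E * \int[mu]_x (f x)%:E + e%:E)%E].
Proof.
move=> mf f0 ffin e0.
pose E n : set G := f @^-1` exp_level R n.
pose a n := expR 1 * exp_bound R n.
have a0 n : 0 <= a n by rewrite mulr_ge0 ?expR_ge0 ?exp_bound_ge0.
have mE n : measurable (E n : set (borel G)).
  by rewrite -[E n]setTI; apply: mf => //; exact: measurable_exp_level.
have mfE (A : set (borel G)) : measurable A -> measurable_fun A (EFin \o f : borel G -> \bar R).
  by move=> mA; apply/measurable_EFinP; exact: measurable_funS mf.
have bE n : ((exp_bound R n)%:E * mu (E n) <= \int[mu]_(x in E n) (f x)%:E)%E.
  rewrite -integral_cst//; apply: ge0_le_integral => //.
  - by move=> x _; rewrite lee_fin exp_bound_ge0.
  - exact: mfE.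
  - by move=> x Ex; rewrite lee_fin; have [_ h _] := exp_levelP Ex.
have sumE : (\sum_(n <oo) (a n)%:E * mu (E n) <= (expR 1)%:E * \int[mu]_x (f x)%:E)%E.
  under eq_eseriesr do rewrite EFinM -muleA.
  rewrite nneseriesZl; last first.
    by move=> i _; apply: mule_ge0; rewrite // lee_fin exp_bound_ge0.
  apply: lee_wpmul2l; first by rewrite lee_fin expR_ge0.
  apply: (@le_trans _ _ (\sum_(n <oo) \int[mu]_(x in E n) (f x)%:E)%E).
    apply: lee_nneseries => // n _ _.
    by apply: mule_ge0; rewrite // lee_fin exp_bound_ge0.
  rewrite -ge0_integral_bigcup//.
  - apply: ge0_subset_integral => //; [exact: bigcup_measurable|exact: mfE|].
    by move=> x _; rewrite lee_fin.
  - by apply: mfE; exact: bigcup_measurable.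
  - by move=> x _; rewrite lee_fin.
  - move=> n m _ _ [x [En Em]]; apply: (@trivIset_exp_level R) => //.
    by exists (f x).
have pick n : exists U : set G, [/\ open U, E n `<=` U, (mu U < +oo)%E &
    ((a n)%:E * mu U <= (a n)%:E * mu (E n) + (e / (2 ^ n.+1)%:R)%:E)%E].
  have en0 : 0 < e / (2 ^ n.+1)%:R by rewrite divr_gt0// ltr0n expn_gt0.
  have [an|an] := eqVneq (a n) 0.
    exists set0; split; [exact: open0| |by rewrite measure0|].
      move=> x /exp_levelP[h _ _]; move: an h; rewrite /a => /eqP.
      by rewrite mulf_eq0 expR_eq0 /= => /eqP ->; rewrite ltxx.
    by rewrite an !mul0e add0e lee_fin ltW.
  have an0 : 0 < a n by rewrite lt_def an a0.
  have Efin : (mu (E n) < +oo)%E.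
    have bn0 : 0 < exp_bound R n by move: an0; rewrite /a pmulr_rgt0 ?expR_gt0.
    have : (\int[mu]_(x in E n) (f x)%:E < +oo)%E.
      apply: le_lt_trans ffin; apply: ge0_subset_integral => //; first exact: mfE.
      by move=> x _; rewrite lee_fin.
    move=> /(le_lt_trans (bE n)); case: (mu (E n)) => [r _|/=|//]; first exact: ltry.
    by rewrite mulry gtr0_sg// mul1e.
  have Ef : mu (E n) \is a fin_num by rewrite ge0_fin_numE.
  have [|U [oU EU UE]] := haar_outer Hmu (t := mu (E n) + ((a n)^-1 * (e / (2 ^ n.+1)%:R))%:E) (mE n).
    by rewrite lteDl// lte_fin mulr_gt0// invr_gt0.
  exists U; split=> //.
    by apply: (lt_trans UE); rewrite -(fineK Ef) -EFinD ltry.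
  apply: (@le_trans _ _ ((a n)%:E * (mu (E n) + ((a n)^-1 * (e / (2 ^ n.+1)%:R))%:E))%E).
    by apply: lee_wpmul2l; [rewrite lee_fin|exact: ltW].
  by rewrite -(fineK Ef) -EFinD -!EFinM -EFinD lee_fin mulrDr mulVKf.
have [U HU] := choice pick.
exists a, U; split=> //.
- by move=> n; have [] := HU n.
- move=> x; have [fx|fx] := eqVneq (f x) 0.
    by rewrite fx; apply: nneseries_ge0 => n _ _; rewrite -EFinM lee_fin mulr_ge0.
  have [|n En] := @exp_level_cover R (f x); first by rewrite lt_def fx f0.
  rewrite (@nneseriesD1 _ _ n)//; last by move=> k _; rewrite -EFinM lee_fin mulr_ge0.
  rewrite -EFinM indicE mem_set; last by have [_ EU _ _] := HU n; exact: EU.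
  rewrite mulr1; have [_ _ h] := exp_levelP En.
  apply: (@le_trans _ _ (a n)%:E); first by rewrite lee_fin.
  rewrite leeDl//; apply: nneseries_ge0 => k _ _.
  by rewrite -EFinM lee_fin mulr_ge0.
- apply: (@le_trans _ _ (\sum_(n <oo) ((a n)%:E * mu (E n) + (e / (2 ^ n.+1)%:R)%:E))%E).
    apply: lee_nneseries => n _; first by move=> _; apply: mule_ge0; rewrite // lee_fin.
    by have [] := HU n.
  apply: le_trans (epsilon_trick _ _ _) _; [|exact: ltW|].
    by move=> n; apply: mule_ge0; rewrite // lee_fin.
  by apply: leeD.
Qed.


(** [f] and [g] are dominated by series of indicators of open sets, for which
    [integral_conv_section] is available. The majorant [P] obtained in this way
    is measurable by construction. *)
Lemma convolution_bound (f g : G -> R) (e : R) :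
  measurable_fun [set: borel G] (f : borel G -> R) -> (forall x, 0 <= f x) ->
  (\int[mu]_x (f x)%:E < +oo)%E ->
  measurable_fun [set: borel G] (g : borel G -> R) -> (forall x, 0 <= g x) ->
  (\int[mu]_x (g x)%:E < +oo)%E -> 0 < e ->
  exists P : borel G -> \bar R, [/\ measurable_fun setT P, forall x, (0 <= P x)%E,
    forall x, (\int[mu]_y (f y * g (y^-1 * x)%g)%:E <= P x)%E &
    (\int[mu]_x P x <= ((expR 1)%:E * \int[mu]_x (f x)%:E + e%:E) *
                       ((expR 1)%:E * \int[mu]_x (g x)%:E + e%:E))%E].
Proof.
move=> mf f0 fi mg g0 gi e0.
have [a [U [a0 HU fU sU]]] := outer_series mf f0 fi e0.
have [b [V [b0 HV gV sV]]] := outer_series mg g0 gi e0.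
pose S n k (x : G) := conv_section (U n) (V k) x.
have mS n k x : measurable (S n k x : set (borel G)).
  by apply: open_borel; apply: open_conv_section; [case: (HU n)|case: (HV k)].
pose P (x : borel G) : \bar R :=
  (\sum_(n <oo) \sum_(k <oo) (a n * b k)%:E * mu (S n k x))%E.
have ab0 n k : 0 <= a n * b k by rewrite mulr_ge0.
have S0 n k x : (0 <= (a n * b k)%:E * mu (S n k x))%E.
  by apply: mule_ge0; rewrite // lee_fin.
have mSx n k : measurable_fun [set: borel G]
    (fun x : borel G => (a n * b k)%:E * mu (S n k x))%E.
  apply: measurable_funeM; apply: measurable_conv_section => //.
  - by case: (HU n).
  - by case: (HV k).
have mP1 n : measurable_fun [set: borel G]
    (fun x : borel G => \sum_(k <oo) (a n * b k)%:E * mu (S n k x))%E.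
  by apply: ge0_emeasurable_sum.
have [mP P0] : measurable_fun setT P /\ forall x, (0 <= P x)%E.
  split=> [|x]; last by do 2!(apply: nneseries_ge0 => ? _ _).
  by apply: ge0_emeasurable_sum => // n x _ _; apply: nneseries_ge0.
exists P; split=> //.
- move=> x; pose h n k (y : borel G) : \bar R :=
    ((a n * b k) * \1_(S n k x) y)%:E.
  have h0 n k y : (0 <= h n k y)%E by rewrite lee_fin mulr_ge0.
  have mh n k : measurable_fun setT (h n k).
    by apply/measurable_EFinP; apply: measurable_funM => //; exact: measurable_indic.
  have -> : P x = (\int[mu]_y (\sum_(n <oo) \sum_(k <oo) h n k y))%E.
    rewrite integral_nneseries//; first last.
    - by move=> n y _; apply: nneseries_ge0.
    - by move=> n; apply: ge0_emeasurable_sum.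
    apply: eq_eseriesr => n _; rewrite integral_nneseries//.
    apply: eq_eseriesr => k _; rewrite /h; under eq_integral do rewrite EFinM.
    rewrite ge0_integralZl_EFin// ?integral_indic ?setIT//.
    by apply/measurable_EFinP; exact: measurable_indic.
  have mg' : measurable_fun [set: borel G] (fun y : borel G => g (y^-1 * x)%g).
    apply: (measurableT_comp mg); apply: (continuous_borel (f := fun y : G => (y^-1 * x)%g)).
    exact: ldivl_continuous.
  apply: ge0_le_integral => //.
  - by move=> y _; rewrite lee_fin mulr_ge0.
  - by apply/measurable_EFinP; apply: measurable_funM.
  - apply: ge0_emeasurable_sum => [n y _ _|n _]; first exact: nneseries_ge0.
    by apply: ge0_emeasurable_sum.
  - move=> y _; rewrite EFinM muleC.
    apply: (@le_trans _ _ ((g (y^-1 * x)%g)%:E * \sum_(n <oo) (a n)%:E * (\1_(U n) y)%:E)%E).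
      by apply: lee_wpmul2l; rewrite ?lee_fin.
    rewrite -nneseriesZl; last by move=> n _; rewrite -EFinM lee_fin mulr_ge0.
    apply: lee_nneseries => [n _ _|n _]; first by rewrite -!EFinM lee_fin !mulr_ge0.
    rewrite muleC -[X in (X * _ <= _)%E]EFinM.
    apply: (@le_trans _ _ ((a n * \1_(U n) y)%:E * \sum_(k <oo) (b k)%:E * (\1_(V k) (y^-1 * x)%g)%:E)%E).
      by apply: lee_wpmul2l; rewrite ?lee_fin ?mulr_ge0.
    rewrite -nneseriesZl; last by move=> k _; rewrite -EFinM lee_fin mulr_ge0.
    apply: lee_nneseries => [k _ _|k _]; first by rewrite -!EFinM lee_fin !mulr_ge0.
    rewrite -!EFinM lee_fin mulrACA ler_wpM2l// /S /conv_section indicI /=.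
    by rewrite !indicE.
- rewrite integral_nneseries//; last by move=> n x _; apply: nneseries_ge0.
  set A := ((expR 1)%:E * \int[mu]_x (f x)%:E + e%:E)%E.
  set B := ((expR 1)%:E * \int[mu]_x (g x)%:E + e%:E)%E.
  have Bfin : B \is a fin_num.
    rewrite fin_numD fin_numM//=; rewrite ge0_fin_numE//.
    by apply: integral_ge0 => x _; rewrite lee_fin.
  have B0 : 0 <= fine B.
    apply: fine_ge0; apply: adde_ge0; last by rewrite lee_fin ltW.
    apply: mule_ge0; first by rewrite lee_fin expR_ge0.
    by apply: integral_ge0 => x _; rewrite lee_fin.
  have am0 n : (0 <= (a n)%:E * mu (U n))%E by apply: mule_ge0; rewrite ?lee_fin.
  apply: (@le_trans _ _ (\sum_(n <oo) (fine B)%:E * ((a n)%:E * mu (U n)))%E); last first.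
    rewrite nneseriesZl// muleC fineK//; apply: lee_wpmul2r => //.
    by rewrite -(fineK Bfin) lee_fin.
  apply: lee_nneseries => [n _ _|n _].
    by apply: integral_ge0 => x _; apply: nneseries_ge0.
  have Ufin : mu (U n) \is a fin_num by rewrite ge0_fin_numE//; case: (HU n).
  rewrite integral_nneseries// muleC fineK//.
  apply: (@le_trans _ _ (((a n)%:E * mu (U n)) * \sum_(k <oo) (b k)%:E * mu (V k))%E); last first.
    by apply: lee_wpmul2l.
  rewrite -(fineK Ufin) -EFinM -nneseriesZl; last first.
    by move=> k _; apply: mule_ge0; rewrite // lee_fin.
  apply: lee_nneseries => [k _ _|k _]; first exact: integral_ge0.
  rewrite ge0_integralZl_EFin//; last first.
    by apply: measurable_conv_section => //; [case: (HU n)|case: (HV k)].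
  rewrite !EFinM fineK// muleACA; apply: lee_wpmul2l; first by rewrite lee_fin.
  by apply: integral_conv_section => //; [case: (HU n)|case: (HV k)|case: (HU n)|case: (HV k)].
Qed.

Lemma integral_lty_ae (P : borel G -> \bar R) : measurable_fun setT P ->
  (forall x, (0 <= P x)%E) -> (\int[mu]_x P x < +oo)%E ->
  {ae mu, forall x, (P x < +oo)%E}.
Proof.
move=> mP P0 Pi; have : mu.-integrable setT P.
  by apply/integrableP; split=> //; under eq_integral do rewrite gee0_abs//.
move=> /(integrable_ae measurableT); apply: filterS => x /(_ Logic.I).
by rewrite ge0_fin_numE.
Qed.

Lemma convolution_ae_fin (f g : G -> R) :
  measurable_fun [set: borel G] (f : borel G -> R) -> (forall x, 0 <= f x) ->
  (\int[mu]_x (f x)%:E < +oo)%E ->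
  measurable_fun [set: borel G] (g : borel G -> R) -> (forall x, 0 <= g x) ->
  (\int[mu]_x (g x)%:E < +oo)%E ->
  {ae mu, forall x, (\int[mu]_y (f y * g (y^-1 * x)%g)%:E < +oo)%E}.
Proof.
move=> mf f0 fi mg g0 gi.
have [P [mP P0 fP iP]] := convolution_bound mf f0 fi mg g0 gi ltr01.
have : (\int[mu]_x P x < +oo)%E.
  apply: (le_lt_trans iP); rewrite -ge0_fin_numE; last first.
    by apply: mule_ge0; apply: adde_ge0 => //; apply: mule_ge0;
      rewrite ?lee_fin ?expR_ge0//; apply: integral_ge0 => x _; rewrite lee_fin.
  by rewrite fin_numM// fin_numD fin_numM//= ge0_fin_numE//;
    apply: integral_ge0 => x _; rewrite lee_fin.
move=> /(integral_lty_ae mP P0); apply: filterS => x; exact: le_lt_trans.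
Qed.

End outer_series.

(** * Null sets of a Haar measure *)

Section nullsets.
Variables (R : realType) (G : topologicalGroupType).
Hypothesis hausdorffG : hausdorff_space G.
Hypothesis lcG : locally_compact [set: G].
Variable mu : {measure set (borel G) -> \bar R}.
Hypothesis Hmu : left_haar mu.

Lemma compact_nbhs1 : exists2 K : set G, compact K & nbhs 1%g K.
Proof.
have [K nK [cK _]] := lcG (I : [set: G] 1%g).
by exists K => //; apply: (@filterS _ (nbhs (1%g : G)) _ [set x | setT x -> K x]) nK => x /(_ I).
Qed.

(** Local nullity is enough on a compact set. *)
Lemma negligible_compact (A K : set G) (f : G -> set G) : compact K ->
  (forall y, K y -> [/\ open (f y), f y y &
     mu.-negligible (A `&` f y : set (borel G))]) ->
  mu.-negligible (A `&` K : set (borel G)).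
Proof.
move=> cK Hf; move: (cK); rewrite compact_cover => /(_ G K f) [y /Hf[]//|y Ky|D DK KD].
  by exists y => //; have [] := Hf y Ky.
apply: (@negligibleS _ (borel G) _ mu (\big[setU/set0]_(i <- finmap.enum_fset D) (A `&` f i))).
  move=> y [Ay /KD[i iD fiy]]; rewrite -bigcup_fset; exists i => //; split=> //.
rewrite big_seq; elim/big_ind : _ => [|A1 A2|i iD].
- exact: negligible_set0.
- exact: negligibleU.
have Ki : K i by apply: set_mem; exact: DK.
by have [] := Hf i Ki.
Qed.

Lemma haar_open_gt0 (U : set G) x : open U -> U x -> (0 < mu U)%E.
Proof.
move=> oU Ux; rewrite lt0e measure_ge0 andbT; apply/eqP => U0.
have : (0 < mu [set: G])%E.
  by rewrite lt0e measure_ge0 andbT; apply/eqP; exact: left_haar_neq0 Hmu.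
move=> /(haar_inner Hmu openT)[K [cK _]]; apply/negP; rewrite -leNgt measure_le0.
apply/eqP/measure_negligible; first exact: compact_borel.
rewrite -[K]setTI; apply: (negligible_compact (f := fun y => [set z | U ((y * x^-1)^-1 * z)%g])) => // y Ky.
have oy : open [set z | U ((y * x^-1)^-1 * z)%g].
  rewrite -[X in open X]/((fun z => ((y * x^-1)^-1 * z)%g) @^-1` U).
  by move/continuousP: (@mulgl_continuous G (y * x^-1)^-1%g); apply.
split=> //; first by rewrite /= invgM invgK mulgVK.
rewrite setTI; apply/negligibleP; first exact: open_borel.
exact: etrans (haar_transl Hmu (y * x^-1)%g (open_borel oU)) U0.
Qed.

Lemma negligible_open_eq0 (U : set G) : open U ->
  mu.-negligible (U : set (borel G)) -> U = set0.
Proof.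
move=> oU /(measure_negligible (open_borel oU)) U0.
apply/eqP; apply: contraPT U0 => /set0P[x Ux] U0.
by have := haar_open_gt0 oU Ux; rewrite U0 ltxx.
Qed.

(** The products [K C ... C] with a compact neighbourhood [C] of the unit form an
    open set, with an open complement in [V] that is null, hence empty. *)
Lemma haar_sigma_compact (V : set G) : open V -> (mu V < +oo)%E ->
  exists K : nat -> set G, (forall n, compact (K n)) /\ V `<=` \bigcup_n K n.
Proof.
move=> oV Vfin; have Vf : mu V \is a fin_num by rewrite ge0_fin_numE.
have pick n : exists K : set G, [/\ compact K, K `<=` V &
    (mu V - (n.+1%:R^-1)%:E < mu K)%E].
  by apply: haar_inner => //; rewrite lteBlDr// lteDl// lte_fin invr_gt0.
have [K HK] := choice pick.
have [C cC C1] := compact_nbhs1.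
pose T n m : set G := iter m (fun A => (fun p : G * G => (p.1 * p.2)%g) @` (A `*` C)) (K n).
have cT n m : compact (T n m).
  elim: m => [|m IH] /=; first by have [] := HK n.
  apply: continuous_compact; last exact: compact_setX.
  by apply: continuous_subspaceT; exact: mulg_continuous.
pose S : set G := \bigcup_n \bigcup_m T n m.
have SC x y : S x -> C y -> S (x * y)%g.
  move=> [n _ [m _ Tx]] Cy; exists n => //; exists m.+1 => //.
  by exists (x, y).
have nC x : nbhs x [set y | C (x^-1 * y)%g].
  by apply: (@mulgl_continuous G x^-1%g x); rewrite /= mulVg.
have nCV x : nbhs x [set y | C (y^-1 * x)%g].
  by apply: (@ldivl_continuous G x x); rewrite /= mulVg.
have oS : open (~` S).
  rewrite openE => x nSx; apply: (@filterS _ (nbhs x) _ _ _ _ (nCV x)) => y /= Cy Sy.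
  by apply: nSx; rewrite -(mulVKg y x); exact: SC.
have VS : V `&` ~` S = set0.
  apply: negligible_open_eq0; first exact: openI.
  have mK n : measurable (K n : set (borel G)) by apply: compact_borel => //; case: (HK n).
  apply: (@negligibleS _ (borel G) _ mu (V `\` \bigcup_n K n)).
    by move=> x [Vx nSx]; split=> // -[n _ Kx]; apply: nSx; exists n => //; exists 0%N.
  have mKK : measurable (\bigcup_n K n : set (borel G)) by exact: bigcupT_measurable.
  apply/negligibleP; first by apply: measurableD => //; exact: open_borel.
  apply/eqP; rewrite -measure_le0; apply/lee_addgt0Pr => e e0; rewrite add0e.
  have [n en] : exists n : nat, n.+1%:R^-1 < e.
    have [n _ Hn] := near_infty_natSinv_lt (PosNum e0).
    by exists n; apply: (Hn n); exact: leqnn.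
  apply: (@le_trans _ _ (mu (V `\` K n))).
    apply: haar_le; [|by apply: measurableD => //; exact: open_borel|].
      by apply: measurableD => //; exact: open_borel.
    by move=> x [Vx nK]; split=> // Kx; apply: nK; exists n.
  have [_ KV hn] := HK n; rewrite measureD//; last exact: open_borel.
  rewrite setIidr//; apply: ltW; rewrite lteBlDr//; last first.
    rewrite ge0_fin_numE//; apply: le_lt_trans Vfin.
    by apply: haar_le => //; exact: open_borel.
  move: hn; rewrite lteBlDr// => /lt_le_trans; apply; rewrite addeC leeD2r// lee_fin.
  exact: ltW.
exists (fun k => if (pickle_inv k : option (nat * nat)) is Some p then T p.1 p.2 else set0).
split=> [k|x Vx].
  by case: pickle_inv => [p|]; [exact: cT|exact: compact0].
have : S x.
  by apply: contrapT => nSx; have : (V `&` ~` S) x by []; rewrite VS.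
by move=> [n _ [m _ Tx]]; exists (pickle (n, m)) => //; rewrite pickleK_inv.
Qed.

(** The sections over open neighbourhoods of [N] of measure [2^-n] have integrals
    at most [2^-n mu U]. *)
Lemma near_ae_conv_section_null (N U : set G) : measurable (N : set (borel G)) ->
  mu N = 0%E -> open U -> (mu U < +oo)%E ->
  {ae mu, forall x, mu.-negligible
    ([set y | N (y^-1 * x)%g] `&` U : set (borel G))}.
Proof.
move=> mN N0 oU Ufin.
have pick n : exists V : set G, [/\ open V, N `<=` V &
    (mu V < (1 / (2 ^ n.+1)%:R)%:E)%E].
  by apply: haar_outer => //; rewrite N0 lte_fin divr_gt0// ltr0n expn_gt0.
have [V HV] := choice pick.
have Vfin n : (mu (V n) < +oo)%E.
  by have [_ _ h] := HV n; apply: (lt_trans h); exact: ltry.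
have oV n : open (V n) by case: (HV n).
pose h n (x : borel G) := mu (conv_section U (V n) x).
have mh n : measurable_fun setT (h n) by exact: measurable_conv_section.
pose P (x : borel G) : \bar R := (\sum_(n <oo) h n x)%E.
have mP : measurable_fun setT P by apply: ge0_emeasurable_sum.
have P0 x : (0 <= P x)%E by apply: nneseries_ge0.
have iP : (\int[mu]_x P x < +oo)%E.
  rewrite integral_nneseries//.
  apply: (@le_lt_trans _ _ (\sum_(n <oo) (fine (mu U))%:E * (1 / (2 ^ n.+1)%:R)%:E)%E).
    apply: lee_nneseries => [n _ _|n _]; first exact: integral_ge0.
    apply: (le_trans (integral_conv_section _ _ _ _ _ _)) => //.
    rewrite fineK ?ge0_fin_numE//; apply: lee_wpmul2l => //.
    by have [_ _ /ltW] := HV n.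
  rewrite nneseriesZl; last by move=> n _; rewrite lee_fin divr_ge0.
  apply: (@le_lt_trans _ _ ((fine (mu U))%:E * 1%:E)%E); last by rewrite -EFinM ltry.
  by apply: lee_wpmul2l; [rewrite lee_fin fine_ge0|exact: epsilon_trick0].
apply: filterS (integral_lty_ae mP P0 iP) => x Px.
have ms n : measurable (conv_section U (V n) x : set (borel G)).
  by apply: open_borel; exact: open_conv_section.
pose S : set (borel G) := \bigcap_n conv_section U (V n) x.
have mS : measurable S by exact: bigcapT_measurable.
apply: (@negligibleS _ (borel G) _ mu S).
  by move=> y [Ny Uy] n _; split=> //; have [_ NV _] := HV n; exact: NV.
apply/negligibleP => //.
have kS k : (k%:R%:E * mu S <= P x)%E.
  apply: le_trans (nneseries_lim_ge k _) => [|n _ _]; last exact: measure_ge0.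
  rewrite big_mkord (_ : (_ * _)%E = \sum_(i < k) mu S)%E; last first.
    by rewrite mule_natl sumr_const card_ord.
  apply: lee_sum => i _; apply: haar_le => //.
  by move=> y /(_ i I).
apply/eqP; rewrite -measure_le0 leNgt; apply/negP => S0.
have Pf : P x \is a fin_num by rewrite ge0_fin_numE.
have Sf : mu S \is a fin_num.
  by rewrite ge0_fin_numE//; apply: le_lt_trans Px; have := kS 1%N; rewrite mul1e.
have s0 : 0 < fine (mu S) by rewrite -lte_fin fineK.
have := kS (Num.truncn (fine (P x) / fine (mu S))).+1.
rewrite -(fineK Pf) -(fineK Sf) -EFinM lee_fin leNgt => /negP; apply.
by rewrite -ltr_pdivrMr//; exact: truncnS_gt.
Qed.

(** A null set lies in a sigma-compact open set. Its inverse is null in almost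
    every translate of a fixed open set, and finitely many of those translates
    cover a given compact set. *)
Lemma haar_inv_null (N : set G) : mu.-negligible (N : set (borel G)) ->
  mu.-negligible ([set y | N y^-1%g] : set (borel G)).
Proof.
move=> [N' [mN' N'0 NN']].
apply: (@negligibleS _ (borel G) _ mu [set y | N' y^-1%g]); first by move=> y /NN'.
have [|V [oV NV V1]] := haar_outer Hmu (t := 1%E) mN'; first by rewrite N'0.
have [|K [cK VK]] := haar_sigma_compact oV; first by apply: (lt_trans V1); exact: ltry.
have [C cC C1] := compact_nbhs1.
have [U [oU U1 UC]] : exists U : set G, [/\ open U, U 1%g & U `<=` C].
  by move: C1; rewrite nbhsE => -[U [oU U1] UC]; exists U.
have Ufin : (mu U < +oo)%E.
  apply: le_lt_trans (left_haar_compact Hmu cC).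
  by apply: haar_le => //; [exact: open_borel|exact: compact_borel].
have [B [mB B0 HB]] := near_ae_conv_section_null mN' N'0 oU Ufin.
have good (z : G) : exists x, U (x * z)%g /\
    mu.-negligible ([set y | N' (y^-1 * x)%g] `&` U : set (borel G)).
  apply: contrapT => nx.
  have oz : open [set x | U (x * z)%g].
    rewrite -[X in open X]/((fun x => (x * z)%g) @^-1` U).
    by move/continuousP: (@mulgr_continuous G z); apply.
  have /(_ z^-1%g) := haar_open_gt0 oz; rewrite /= mulVg => /(_ U1).
  apply/negP; rewrite -leNgt -B0; apply: haar_le => //; first exact: open_borel.
  by move=> x Ux; apply: HB => h; apply: nx; exists x.
have invc : continuous (fun x : G => x^-1%g) by exact: invg_continuous.
apply: (@negligibleS _ (borel G) _ mu (\bigcup_n ([set y | N' y^-1%g] `&` ((fun x : G => x^-1%g) @` K n)))).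
  move=> y Ny; have [n _ Kn] := VK _ (NV _ Ny); exists n => //; split=> //.
  by exists y^-1%g => //; rewrite invgK.
apply: negligible_bigcup => n; have [F HF] := choice good.
apply: (negligible_compact (f := fun z => [set y | U (F z * y)%g])).
  by apply: continuous_compact; [apply: continuous_subspaceT|exact: cK].
move=> z _; have [Uz nz] := HF z; split=> //.
  rewrite -[X in open X]/((fun y => (F z * y)%g) @^-1` U).
  by move/continuousP: (@mulgl_continuous G (F z)); apply.
move: nz => [B' [mB' B'0 HB']].
have mt : measurable ([set y | B' (F z * y)%g] : set (borel G)).
  by rewrite -[X in measurable X]setTI; apply: (continuous_borel (@mulgl_continuous G (F z))).
have m0 : mu [set y | B' (F z * y)%g] = 0%E.
  by apply: etrans B'0; have := haar_transl Hmu (F z)^-1%g mB'; rewrite invgK.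
exists [set y | B' (F z * y)%g]; split => // y [Ny Uy] /=; apply: HB'; split=> //=.
by rewrite invgM mulgVK.
Qed.

End nullsets.

(** * The Mackey group *)

Lemma hausdorff_separated (X : topologicalType) :
  (forall x y : X, x <> y -> exists (Y : topologicalType) (f : X -> Y),
     [/\ hausdorff_space Y, continuous f & f x <> f y]) -> hausdorff_space X.
Proof.
move=> sep; rewrite open_hausdorff => x y /eqP /sep[Y [f [hY cf /eqP fxy]]].
move: hY; rewrite open_hausdorff => /(_ _ _ fxy)[[A B] /= [xA yB] [oA oB AB]].
exists (f @^-1` A, f @^-1` B).
  by split; apply/mem_set => /=; exact: set_mem.
split=> /=; [by move/continuousP: cf; apply|by move/continuousP: cf; apply|].
by rewrite -preimage_setI (eqP AB) preimage_set0.
Qed.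

Section circle_topology.
Variable R : realType.
Local Notation T := (circle R).
Implicit Types x y : T.

Lemma complex_nbhs_cabs (z : R[i]) (A : set R[i]) : nbhs z A ->
  exists2 e : R, 0 < e & forall w, cabs (z - w) < e -> A w.
Proof.
move=> /nbhs_ballP[e /= e0 eA]; exists (complex.Re e).
  by move: e0; rewrite ltcE => /andP[].
move=> w zw; apply: eA; rewrite -ball_normE /= normr_cabs ltcE /=.
by move: e0; rewrite ltcE /= => /andP[/eqP <- _]; rewrite eqxx zw.
Qed.

Lemma nbhs_circle x (A : set T) : nbhs x A ->
  exists2 e : R, 0 < e & forall y, `|complex.Re (x : R[i]) - complex.Re (y : R[i])| < e ->
    `|complex.Im (x : R[i]) - complex.Im (y : R[i])| < e -> A y.
Proof.
rewrite nbhsE => -[W [[B oB <-] Bx] OA].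
have [e e0 eB] := complex_nbhs_cabs (open_nbhs_nbhs (conj oB Bx)).
exists (e / 2); first by rewrite divr_gt0.
move=> y hR hI; apply: OA; apply: eB; apply: (le_lt_trans (cabs_le_ReIm _)).
by move: (x : R[i]) (y : R[i]) hR hI => [a b] [a' b'] /= hR hI; lra.
Qed.

Lemma circle_lipschitz_continuous (f : R[i] -> R) :
  (forall z w, `|f z - f w| <= cabs (z - w)) -> continuous (fun x : T => f x).
Proof.
move=> hf x; apply/(@cvgrPdist_lt R R^o _ (nbhs x) (nbhs_filter x)) => e e0.
have := @circle_val_continuous R x.
move=> /(@cvgrPdist_lt R[i] R[i]^o _ (nbhs x) (nbhs_filter x))/(_ e%:C%C).
rewrite ltcR => /(_ e0); apply: (@filterS _ (nbhs x)) => y.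
by rewrite normr_cabs ltcR; apply: le_lt_trans.
Qed.

Lemma circle_Re_continuous : continuous (fun x : T => complex.Re (x : R[i])).
Proof.
by apply: circle_lipschitz_continuous => z w; rewrite -raddfB; exact: Re_le_cabs.
Qed.

Lemma circle_Im_continuous : continuous (fun x : T => complex.Im (x : R[i])).
Proof.
by apply: circle_lipschitz_continuous => z w; rewrite -raddfB; exact: Im_le_cabs.
Qed.

Lemma circle_hausdorff : hausdorff_space T.
Proof.
apply: hausdorff_separated => x y xy.
have [h|h] := eqVneq (complex.Re (x : R[i])) (complex.Re (y : R[i])).
  exists R, (fun x : T => complex.Im (x : R[i])).
  split; [exact: Rhausdorff|exact: circle_Im_continuous|].
  move=> hI; apply: xy; apply: val_inj => /=.
  by move: (x : R[i]) (y : R[i]) h hI => [a b] [a' b'] /= -> ->.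
exists R, (fun x : T => complex.Re (x : R[i])).
by split; [exact: Rhausdorff|exact: circle_Re_continuous|exact/eqP].
Qed.

Fact circle_cis_subproof (t : R) : `|Complex (cos t) (sin t)| == 1.
Proof. by rewrite normr_cabs cabs_sqrt /= cos2Dsin2 sqrtr1. Qed.
Definition circle_cis (t : R) : T := Circle (circle_cis_subproof t).

Lemma circle_compact : compact [set: T].
Proof.
have -> : [set: T] = circle_cis @` `[- pi, pi].
  apply/seteqP; split=> // x _.
  have [|t tpi ht] := @circle_cos_sin _ (x : R[i]).
    by apply: complexI; rewrite -normr_cabs (eqP (circle_valP x)).
  by exists t => //; apply: val_inj.
apply: continuous_compact; last exact: segment_compact.
apply: continuous_subspaceT => t A /nbhs_circle[e e0 eA].
have hc : \forall s \near t, `|cos t - cos s| < e.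
  by have := @continuous_cos R t => /cvgrPdist_lt; apply.
have hs : \forall s \near t, `|sin t - sin s| < e.
  by have := @continuous_sin R t => /cvgrPdist_lt; apply.
by apply: filterS2 hc hs => s h1 h2; exact: (eA (circle_cis s)).
Qed.

Definition circle_box (q : rat * rat * rat) : set T :=
  [set y | `|complex.Re (y : R[i]) - ratr q.1.1| < ratr q.2 /\
           `|complex.Im (y : R[i]) - ratr q.1.2| < ratr q.2].

Lemma open_circle_box q : open (circle_box q).
Proof.
have ob (a b : R) : open [set r : R | `|r - a| < b].
  rewrite (_ : mkset _ = [set` `]a - b, a + b[]); first exact: interval_open.
  by apply/seteqP; split => r /=; rewrite in_itv /= ltr_distl.
apply: openI.
  by move/continuousP: circle_Re_continuous => /(_ _ (ob _ _)); apply.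
by move/continuousP: circle_Im_continuous => /(_ _ (ob _ _)); apply.
Qed.

Lemma circle_box_nbhs x (A : set T) : nbhs x A ->
  exists2 q, circle_box q x & circle_box q `<=` A.
Proof.
move=> /nbhs_circle[e e0 eA].
have [r] : exists r : rat, (ratr r : R) \in `]0, (e / 2)[.
  by apply: rat_in_itvoo; rewrite divr_gt0.
rewrite in_itv /= => /andP[r0 re].
have near_rat (a : R) : exists q : rat, `|a - ratr q| < ratr r.
  have [|q] := @rat_in_itvoo _ (a - ratr r) (a + ratr r); first by lra.
  by rewrite in_itv /= => /andP[h1 h2]; exists q; rewrite ltr_norml; apply/andP; split; lra.
have [a ha] := near_rat (complex.Re (x : R[i])).
have [b hb] := near_rat (complex.Im (x : R[i])).
exists (a, b, r) => // y [/= h1 h2]; apply: eA.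
  by rewrite -[X in X - _](subrK (ratr a)) -addrA; apply: (le_lt_trans (ler_normD _ _)); rewrite (distrC (ratr a)); lra.
by rewrite -[X in X - _](subrK (ratr b)) -addrA; apply: (le_lt_trans (ler_normD _ _)); rewrite (distrC (ratr b)); lra.
Qed.

End circle_topology.

Section mackey_topology.
Variables (R : realType) (G : topologicalGroupType) (c : cocycle R G).
Hypothesis hausdorffG : hausdorff_space G.
Hypothesis lcG : locally_compact [set: G].
Local Notation M := (mackey c).

Lemma mackey_fst_continuous : continuous (fst : M -> G).
Proof. by move=> p; exact: cvg_fst. Qed.

Lemma mackey_snd_continuous : continuous (snd : M -> circle R).
Proof. by move=> p; exact: cvg_snd. Qed.

Lemma mackey_hausdorff : hausdorff_space M.
Proof.
apply: hausdorff_separated => -[x s] [y t] xy.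
have [h|/eqP h] := eqVneq x y.
  exists (circle R), snd; split; [exact: circle_hausdorff|exact: mackey_snd_continuous|].
  by move=> /= st; apply: xy; rewrite h st.
by exists G, fst; split => //; exact: mackey_fst_continuous.
Qed.

Lemma mackey_locally_compact : locally_compact [set: M].
Proof.
move=> -[x s] _; have [K nK [cK clK]] := lcG (I : [set: G] x).
exists (K `*` [set: circle R]).
  have nK' : nbhs x K by apply: (@filterS _ (nbhs x) _ [set x | setT x -> K x]) nK => y /(_ I).
  apply: (@filterS _ (nbhs ((x, s) : G * circle R))); last first.
    by apply: (@cvg_fst _ _ (nbhs x) (nbhs s)); exact: nK'.
  by move=> p /= Kp _; split.
have cKT : compact (K `*` [set: circle R]) by apply: compact_setX => //; exact: circle_compact.
by split=> //; exact: (compact_closed mackey_hausdorff).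
Qed.

(** The second factor is second countable, so that the Borel sets of the product
    are generated by the products of Borel sets. *)
Lemma mackey_borel (A : set M) : measurable (A : set (borel M)) ->
  measurable (A : set (borel G * borel (circle R))).
Proof.
apply: smallest_sub => [|W oW]; first exact: sigma_algebra_measurable.
pose U q : set G := \bigcup_(O in [set O | open O /\ O `*` circle_box q `<=` W]) O.
have -> : W = \bigcup_q (U q `*` @circle_box R q).
  apply/seteqP; split=> [[x t] Wxt|p [q _ [[W1 [oO OW] Op] qp]]]; last exact: OW.
  have [[A1 A2] /= [nA1 nA2] AW] : nbhs ((x, t) : G * circle R) W by exact: open_nbhs_nbhs.
  move: nA1; rewrite nbhsE => -[W1 [oO Ox] OA].
  have [q qt qA] := circle_box_nbhs nA2.
  exists q => //; split => //=; exists W1 => //; split=> // p [/= Op qp].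
  by apply: AW; split; [exact: OA|exact: qA].
apply: countable_bigcupT_measurable => [|q]; first exact: countableP.
apply: measurableX; apply: open_borel; last exact: open_circle_box.
by apply: bigcup_open => W1 [].
Qed.

Lemma prod_mackey_borel (A : set M) :
  measurable (A : set (borel G * borel (circle R))) ->
  measurable (A : set (borel M)).
Proof.
move=> mA; rewrite -[A]setTI.
have : measurable_fun [set: borel M] (id : borel M -> (borel G * borel (circle R))%type).
  rewrite (_ : id = fun p => (p.1, p.2)); last by apply/funext; case.
  apply: measurable_fun_pair.
    exact: (continuous_borel mackey_fst_continuous).
  exact: (continuous_borel mackey_snd_continuous).
exact.
Qed.

End mackey_topology.

(** * Integration over the Mackey group *)

Lemma integral_support d (X : measurableType d) (R : realType)
    (m : {measure set X -> \bar R}) (D : set X) (f : X -> \bar R) :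
  (forall x, ~ D x -> f x = 0%E) -> (\int[m]_x f x = \int[m]_(x in D) f x)%E.
Proof.
move=> fD; rewrite [RHS]integral_mkcond; apply: eq_integral => x _.
by rewrite patchE; case: ifPn => // /negP xD; rewrite fD// => Dx; apply/xD/mem_set.
Qed.

Section restriction.
Context d (X : measurableType d) (R : realType) (m : {measure set X -> \bar R}).
Variables (D : set X) (mD : measurable D).

Lemma integral_mrestr_support (f : X -> \bar R) : (forall x, ~ D x -> f x = 0%E) ->
  (\int[mrestr m mD]_x f x = \int[m]_x f x)%E.
Proof.
move=> fD; rewrite !(integral_support _ fD).
by apply: eq_measure_integral => A mA AD; rewrite /= /mrestr setIidl.
Qed.

Lemma integrable_mrestr_support (f : X -> \bar R) : (forall x, ~ D x -> f x = 0%E) ->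
  (mrestr m mD).-integrable setT f <-> m.-integrable setT f.
Proof.
move=> fD; split=> /integrableP[mf h]; apply/integrableP; split=> //; move: h;
  by rewrite (integral_mrestr_support (f := fun x => `|f x|%E))// => x /fD ->;
    rewrite abse0.
Qed.

Lemma ae_mrestr_support (P : X -> Prop) : (forall x, ~ D x -> P x) ->
  {ae mrestr m mD, forall x, P x} -> {ae m, forall x, P x}.
Proof.
move=> PD [N [mN N0 PN]]; exists (N `&` D); split=> //; first exact: measurableI.
move=> x nPx; split; first exact: PN.
by apply: contrapT => /PD.
Qed.

End restriction.

(** The product measure theorems require sigma-finite measures, which Haar
    measures become when cut down to a countable union of compact sets. *)
Section sigma_compact_restriction.
Variables (R : realType) (G : topologicalGroupType).
Hypothesis hausdorffG : hausdorff_space G.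
Variable mu : {measure set (borel G) -> \bar R}.
Hypothesis Hmu : left_haar mu.
Variable K : nat -> set G.
Hypothesis cK : forall n, compact (K n).

Lemma measurable_sigma_compact : measurable (\bigcup_n K n : set (borel G)).
Proof. by apply: bigcupT_measurable => n; exact: compact_borel. Qed.

Definition compact_restr : set (borel G) -> \bar R :=
  mrestr mu measurable_sigma_compact.

HB.instance Definition _ := Measure.on compact_restr.

Fact compact_restr_sigma_finite : sigma_finite setT compact_restr.
Proof.
exists (fun n => K n `|` ~` \bigcup_n K n).
  apply/esym; rewrite -subTset => x _.
  have [[n _ Kx]|nK] := pselect ((\bigcup_n K n) x).
    by exists n => //; left.
  by exists 0%N => //; right.
move=> n; have mK : measurable (K n : set (borel G)) by exact: compact_borel.
split; first by apply: measurableU => //; apply: measurableC; exact: measurable_sigma_compact.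
rewrite /compact_restr /mrestr setIUl setICl setU0.
apply: (le_lt_trans _ (left_haar_compact Hmu (@cK n))).
apply: haar_le => //; apply: measurableI => //; exact: measurable_sigma_compact.
Qed.

HB.instance Definition _ := @Measure_isSigmaFinite.Build _ (borel G) R
  compact_restr compact_restr_sigma_finite.

Definition compact_measure : {sigma_finite_measure set (borel G) -> \bar R} :=
  compact_restr.

End sigma_compact_restriction.

(** Integrable functions live on a countable union of sets of finite measure,
    and open sets of finite measure are sigma-compact up to inclusion. *)
Lemma integrable_sigma_compact (R : realType) (G : topologicalGroupType)
    (mu : {measure set (borel G) -> \bar R}) (f : borel G -> \bar R) :
  hausdorff_space G -> locally_compact [set: G] -> left_haar mu ->
  mu.-integrable setT f ->
  exists K : nat -> set G, (forall n, compact (K n)) /\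
    forall x, ~ (\bigcup_n K n) x -> f x = 0%E.
Proof.
move=> hG lcG Hmu /integrableP[mf fi].
pose E n : set (borel G) := [set x | ((n.+1%:R^-1)%:E <= `|f x|)%E].
have pick n : exists K : nat -> set G, (forall m, compact (K m)) /\
    E n `<=` \bigcup_m K m.
  have mE : measurable (E n).
    rewrite -[E n]setTI; apply: emeasurable_fun_c_infty => //.
    exact: measurableT_comp.
  have Efin : (mu (E n) < +oo)%E.
    have e0 : 0 < (n.+1%:R^-1 : R) by rewrite invr_gt0.
    have : ((n.+1%:R^-1)%:E * mu (E n) < +oo)%E.
      apply: le_lt_trans fi; rewrite -integral_cst//.
      apply: (@le_trans _ _ (\int[mu]_(x in E n) `|f x|)%E); last first.
        by apply: ge0_subset_integral => //; exact: measurableT_comp.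
      apply: ge0_le_integral => //.
      - by move=> x _; rewrite lee_fin ltW.
      - by apply: measurable_funTS; exact: measurableT_comp.
    case: (mu (E n)) => [r|/=|//]; first by rewrite !ltry.
    by rewrite mulry gtr0_sg// mul1e.
  have [V [oV EV Vfin]] := haar_outer Hmu mE Efin.
  have [K [cK VK]] := haar_sigma_compact hG lcG Hmu oV Vfin.
  by exists K; split=> // x /EV/VK.
have [K HK] := choice pick.
exists (fun k => if (pickle_inv k : option (nat * nat)) is Some p then K p.1 p.2 else set0).
split=> [k|x nKx].
  by case: pickle_inv => [p|]; [case: (HK p.1) => h _; exact: h|exact: compact0].
apply: contrapT => /eqP fx.
have [n En] : exists n, E n x.
  case E0 : (f x) => [r| |] in fx *; last 2 first.
  - by exists 0%N; rewrite /E /= E0 /= leey.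
  - by exists 0%N; rewrite /E /= E0 /= leey.
  have r0 : 0 < `|r| by rewrite normr_gt0; move: fx; rewrite eqe.
  have [n _ Hn] := near_infty_natSinv_lt (PosNum r0).
  exists n; rewrite /E /= E0 /= lee_fin; apply: ltW.
  by apply: (Hn n); exact: leqnn.
have [_ /(_ x En)[m _ Kx]] := HK n.
by apply: nKx; exists (pickle (n, m)) => //; rewrite pickleK_inv.
Qed.

Lemma pairr_continuous (X Y : topologicalType) (x : X) :
  continuous (fun y : Y => (x, y)).
Proof. by move=> y; apply: cvg_pair; [exact: cvg_cst|exact: cvg_id]. Qed.

Section mackey_integral.
Variables (R : realType) (G : topologicalGroupType) (c : cocycle R G).
Hypothesis hausdorffG : hausdorff_space G.
Hypothesis lcG : locally_compact [set: G].
Variable mu : {measure set (borel G) -> \bar R}.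
Hypothesis Hmu : left_haar mu.
Local Notation T := (circle R).
Variable nu : {measure set (borel (mackey c)) -> \bar R}.
Hypothesis Hnu : left_haar nu.
Variable lam : {finite_measure set (borel T) -> \bar R}.
Hypothesis lam1 : lam setT = 1%E.
Hypothesis rect : forall (A : set (borel G)) (B : set (borel T)),
  measurable A -> measurable B -> (mu A < +oo)%E ->
  nu (A `*` B) = (mu A * lam B)%E.
Local Notation M := (mackey c).

(** The identity, seen as a map to the product of the measurable spaces. *)
Definition mackey_id : borel M -> (borel G * borel T)%type := fun p => (p.1, p.2).

Lemma measurable_mackey_id : measurable_fun setT mackey_id.
Proof.
apply: measurable_fun_pair.
  exact: (continuous_borel (@mackey_fst_continuous R G c)).
exact: (continuous_borel (@mackey_snd_continuous R G c)).
Qed.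

Definition prod_view : {measure set (borel G * borel T) -> \bar R}.
Proof. by refine (pushforward nu mackey_id); exact: measurable_mackey_id. Defined.

Lemma prod_viewE (A : set M) : prod_view (A : set (borel G * borel T)) = nu A.
Proof.
rewrite /prod_view /= /pushforward; congr (nu _).
by apply/seteqP; split => -[x t].
Qed.

Lemma measurable_prod_view (F : M -> \bar R) : measurable_fun [set: borel M] F ->
  measurable_fun [set: (borel G * borel T)%type] F.
Proof. by move=> mF _ B mB; rewrite setTI; apply: mackey_borel; rewrite -[X in measurable X]setTI; exact: mF. Qed.

Lemma measurable_mackey_fst d (Y : measurableType d) (f : G -> Y) :
  measurable_fun [set: borel G] (f : borel G -> Y) ->
  measurable_fun [set: borel M] (fun p : borel M => f p.1).
Proof.
by move=> mf; exact: (measurableT_comp mf (continuous_borel (@mackey_fst_continuous R G c))).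
Qed.

Section support.
Variable K : nat -> set G.
Hypothesis cK : forall n, compact (K n).
Local Notation A := (\bigcup_n K n).
Let mA := measurable_sigma_compact hausdorffG cK.
Let m1 := compact_measure hausdorffG Hmu cK.

Let mAT : measurable (A `*` [set: T] : set (borel G * borel T)).
Proof. by apply: measurableX => //; exact: mA. Qed.

Lemma prod_view_rect (X : set (borel G)) (Y : set (borel T)) :
  measurable X -> measurable Y ->
  prod_view ((X `*` Y) `&` (A `*` [set: T])) = (mu (X `&` A) * lam Y)%E.
Proof.
move=> mX mY; pose D n : set G := X `&` seqDU K n.
have mK n : measurable (K n : set (borel G)) by exact: compact_borel.
have mD n : measurable (D n : set (borel G)).
  apply: measurableI => //; apply: measurableD => //.
  by apply: bigsetU_measurable => i _.
have tD : trivIset setT D by apply: trivIset_setIl; exact: trivIset_seqDU.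
have XA : X `&` A = \bigcup_n D n by rewrite seqDU_bigcup_eq setI_bigcupr.
have -> : (X `*` Y) `&` (A `*` [set: T]) = \bigcup_n (D n `*` Y).
  rewrite -setX_bigcupl -XA; apply/seteqP.
  by split=> [[x t] [[/= Xx Yt] [/= Ax _]]|[x t] [[/= Xx Ax] Yt]].
rewrite prod_viewE XA measure_semi_bigcup//; last first.
- apply: bigcupT_measurable => n; apply: prod_mackey_borel.
  by apply: measurableX => //; exact: mD.
- apply/trivIsetP => i j _ _ ij; apply/seteqP; split=> // -[x t] [[/= Di _] [/= Dj _]].
  have [B] : (D i `&` D j) x by []; move/trivIsetP : tD => /(_ i j I I ij) h.
  by have : (D i `&` D j) x by []; rewrite h.
- by move=> n; apply: prod_mackey_borel; apply: measurableX => //; exact: mD.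
have lY : lam Y \is a fin_num by exact: fin_num_measure.
rewrite measure_semi_bigcup//; last by apply: bigcupT_measurable.
rewrite muleC -(fineK lY) -nneseriesZl//; apply: eq_eseriesr => n _.
rewrite rect// ?fineK// 1?muleC//.
apply: le_lt_trans (left_haar_compact Hmu (@cK n)).
apply: haar_le => //.
by move=> x [_]; exact: subset_seqDU.
Qed.

(** The two measures agree on rectangles, and rectangles generate. *)
Lemma prod_measure_mackey (X : set (borel G * borel T)) : measurable X ->
  X `<=` A `*` [set: T] -> (m1 \x lam)%E X = nu X.
Proof.
move=> mX XA; pose m' : {measure set (borel G * borel T) -> \bar R} := mrestr prod_view mAT.
rewrite (@product_measure_unique _ _ _ _ _ m1 lam m') //; last first.
  by move=> B C mB mC; rewrite /m' /= /mrestr prod_view_rect.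
by rewrite /m' /= /mrestr setIidl// prod_viewE.
Qed.

Lemma integral_prod_mackey (F : M -> \bar R) : measurable_fun [set: borel M] F ->
  (forall p, (0 <= F p)%E) -> (forall p, ~ A p.1 -> F p = 0%E) ->
  (\int[m1 \x lam]_p F p = \int[nu]_p F p)%E.
Proof.
move=> mF F0 FA; have FAT p : ~ (A `*` [set: T]) p -> F p = 0%E.
  by move=> nA; apply: FA => Ap; apply: nA; split.
rewrite (@integral_support _ (borel G * borel T)%type R (m1 \x lam)%E (A `*` [set: T]) F FAT).
rewrite [RHS](@integral_support _ (borel M) R nu (A `*` [set: T]) F FAT).
transitivity (\int[prod_view]_(p in (A `*` [set: T] : set (borel G * borel T))) F p)%E.
  apply: eq_measure_integral => X mX XA.
  by rewrite [RHS]prod_viewE; exact: prod_measure_mackey.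
have := @ge0_integral_pushforward _ _ (borel M) (borel G * borel T)%type R mackey_id
  measurable_mackey_id nu (A `*` [set: T]) F mAT.
rewrite /prod_view => -> //; last first.
  by apply: measurable_funTS; exact: measurable_prod_view.
have -> : mackey_id @^-1` (A `*` [set: T]) = A `*` [set: T].
  by apply/seteqP; split => -[x t].
by apply: eq_integral => -[x t].
Qed.

Lemma tonelli_mackey_support (F : M -> \bar R) : measurable_fun [set: borel M] F ->
  (forall p, (0 <= F p)%E) -> (forall p, ~ A p.1 -> F p = 0%E) ->
  (\int[nu]_p F p = \int[mu]_x \int[lam]_t F (x, t))%E.
Proof.
move=> mF F0 FA; rewrite -integral_prod_mackey//.
rewrite (@fubini_tonelli1 _ _ (borel G) (borel T) R m1 lam F) //; last exact: measurable_prod_view.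
rewrite integral_mrestr_support// => x nAx.
by rewrite /fubini_F integral0_eq// => t _; exact: FA.
Qed.

Lemma measurable_tonelli_mackey (F : M -> \bar R) : measurable_fun [set: borel M] F ->
  (forall p, (0 <= F p)%E) -> measurable_fun [set: borel G] (fun x : borel G => \int[lam]_t F (x, t))%E.
Proof.
move=> mF F0; apply: (@measurable_fun_fubini_tonelli_F _ _ (borel G) (borel T) R lam F) => //.
exact: measurable_prod_view.
Qed.

Lemma fubini_mackey_support (F : M -> \bar R) : nu.-integrable setT F ->
  (forall p, ~ A p.1 -> F p = 0%E) ->
  [/\ {ae mu, forall x, lam.-integrable setT (fun t => F (x, t))},
      mu.-integrable setT (fun x => \int[lam]_t F (x, t))%E &
      (\int[nu]_p F p = \int[mu]_x \int[lam]_t F (x, t))%E].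
Proof.
move=> /integrableP[mF iF] FA; have mFp := measurable_prod_view mF.
have A0 x : ~ A x -> (\int[lam]_t F (x, t) = 0)%E.
  by move=> nAx; rewrite integral0_eq// => t _; exact: FA.
have iF' : (m1 \x lam)%E.-integrable setT F.
  apply/integrableP; split=> //.
  rewrite (integral_prod_mackey (F := fun p => `|F p|%E))//.
  - exact: measurableT_comp.
  - by move=> p /FA ->; rewrite abse0.
split.
- apply: (ae_mrestr_support (mD := mA)) (ae_integrable1 iF') => x nAx.
  apply: (eq_integrable measurableT (cst 0%E)); last exact: integrable0.
  by move=> t _ /=; rewrite FA.
- apply: (@integrable_mrestr_support _ (borel G) R mu A mA _ A0).1.
  exact: (integrable_fubini_F iF').
- transitivity (\int[m1 \x lam]_p F p)%E.
    rewrite integralE [RHS]integralE; congr (_ - _)%E; apply/esym/integral_prod_mackey => //.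
    + exact: measurable_funepos.
    + by move=> p /FA h; rewrite funeposE h maxxx.
    + exact: measurable_funeneg.
    + by move=> p /FA h; rewrite funenegE h oppe0 maxxx.
  rewrite -(integral12_prod_meas1 iF').
  by rewrite integral_mrestr_support.
Qed.

End support.

(** The projection of a compact set is compact. *)
Lemma mackey_support (F : M -> \bar R) : nu.-integrable setT F ->
  exists K : nat -> set G, (forall n, compact (K n)) /\
    forall p, ~ (\bigcup_n K n) p.1 -> F p = 0%E.
Proof.
move=> iF; have [K [cK FK]] := integrable_sigma_compact (@mackey_hausdorff R G c hausdorffG)
  (@mackey_locally_compact R G c hausdorffG lcG) Hnu iF.
exists (fun n => fst @` K n); split=> [n|p nKp].
  apply: continuous_compact; last exact: cK.
  by apply: continuous_subspaceT; exact: mackey_fst_continuous.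
by apply: FK => -[n _ Kp]; apply: nKp; exists n => //; exists p.
Qed.

Lemma fubini_mackey (F : M -> \bar R) : nu.-integrable setT F ->
  [/\ {ae mu, forall x, lam.-integrable setT (fun t => F (x, t))},
      mu.-integrable setT (fun x => \int[lam]_t F (x, t))%E &
      (\int[nu]_p F p = \int[mu]_x \int[lam]_t F (x, t))%E].
Proof.
by move=> iF; have [K [cK FK]] := mackey_support iF; exact: (fubini_mackey_support cK).
Qed.

Lemma integral_mackey_fst (f : G -> R) : mu.-integrable setT (EFin \o f) ->
  (\int[nu]_p `|f p.1|%:E = \int[mu]_x `|f x|%:E)%E.
Proof.
move=> fi; have [K [cK fK]] := integrable_sigma_compact hausdorffG lcG Hmu fi.
have mf : measurable_fun [set: borel G] (f : borel G -> R).
  by apply/measurable_EFinP; exact: measurable_int fi.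
rewrite (tonelli_mackey_support cK (F := fun p => `|f p.1|%:E)) //=.
- apply: eq_integral => x _; transitivity (`|f x|%:E * lam setT)%E.
    exact: integral_cst.
  by rewrite lam1 mule1.
- apply/measurable_EFinP; apply: measurableT_comp => //.
  exact: measurable_mackey_fst.
- by move=> p /fK /= [->]; rewrite normr0.
Qed.

Lemma negligible_mackey_fst (N : set G) : mu.-negligible (N : set (borel G)) ->
  nu.-negligible ([set p | N p.1] : set (borel M)).
Proof.
move=> [A [mA A0 NA]]; exists (A `*` [set: T]); split.
- by apply: prod_mackey_borel; exact: measurableX.
- by rewrite rect ?A0 ?mul0e.
- by move=> p /NA.
Qed.

Lemma ae_mackey_section (P : M -> Prop) : {ae nu, forall p, P p} ->
  {ae mu, forall x, {ae lam, forall t, P (x, t)}}.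
Proof.
move=> [N [mN N0 PN]].
have iN : nu.-integrable setT (EFin \o \1_N).
  apply/integrableP; split; first by apply/measurable_EFinP; exact: measurable_indic.
  under eq_integral => p _ do rewrite /= ger0_norm//.
  by rewrite integral_indic// setIT N0.
have [_ _] := fubini_mackey iN; rewrite integral_indic// setIT N0 => /esym h0.
have mI := measurable_tonelli_mackey (F := EFin \o \1_N) (measurable_int _ iN) _.
have : {ae mu, forall x, (\int[lam]_t (\1_N (x, t))%:E = 0)%E}.
  have := (ae_eq_integral_abs mu measurableT (mI _)).1.
  move=> []; first by move=> p; rewrite lee_fin.
    rewrite -[RHS]h0; apply: eq_integral => x _; rewrite gee0_abs//.
    by apply: integral_ge0 => t _; rewrite lee_fin.
  by move=> N' [mN' N'0 h]; exists N'; split => // x nx; apply: h => /(_ I).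
move=> [N' [mN' N'0 hN']]; exists N'; split=> // x nx; apply: hN' => h; apply: nx.
have mNx : measurable ([set t | N (x, t)] : set (borel T)).
  rewrite -[X in measurable X]setTI.
  exact: (continuous_borel (f := fun t : T => (x, t) : M) (@pairr_continuous G T x)).
exists [set t | N (x, t)]; split=> // [|t nP]; last exact: PN.
rewrite -[X in lam X]setIT -(integral_indic lam measurableT mNx); exact: h.
Qed.

End mackey_integral.

(** * Complex L^1 spaces *)

Section complex_integral.
Context d (X : measurableType d) (R : realType) (m : {measure set X -> \bar R}).
Implicit Types f g : X -> R[i].

Definition cmeasurable f : Prop :=
  measurable_fun setT (fun x => complex.Re (f x)) /\
  measurable_fun setT (fun x => complex.Im (f x)).

Lemma cmeasurableM f g : cmeasurable f -> cmeasurable g ->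
  cmeasurable (fun x => f x * g x).
Proof.
move=> [fR fI] [gR gI]; split.
  rewrite (_ : (fun x => _) = fun x => complex.Re (f x) * complex.Re (g x) -
    complex.Im (f x) * complex.Im (g x)); last first.
    by apply/funext => x; case: (f x) (g x) => [a b] [a' b'].
  by apply: measurable_funB; exact: measurable_funM.
rewrite (_ : (fun x => _) = fun x => complex.Re (f x) * complex.Im (g x) +
  complex.Im (f x) * complex.Re (g x)); last first.
  by apply/funext => x; case: (f x) (g x) => [a b] [a' b'].
by apply: measurable_funD; exact: measurable_funM.
Qed.

Lemma cmeasurableB f g : cmeasurable f -> cmeasurable g ->
  cmeasurable (fun x => f x - g x).
Proof.
move=> [fR fI] [gR gI]; split.
  rewrite (_ : (fun x => _) = fun x => complex.Re (f x) - complex.Re (g x)).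
    exact: measurable_funB.
  by apply/funext => x; case: (f x) (g x) => [a b] [a' b'].
rewrite (_ : (fun x => _) = fun x => complex.Im (f x) - complex.Im (g x)).
  exact: measurable_funB.
by apply/funext => x; case: (f x) (g x) => [a b] [a' b'].
Qed.

Lemma cmeasurable_conj f : cmeasurable f -> cmeasurable (fun x => (f x)^*).
Proof.
move=> [fR fI]; split.
  rewrite (_ : (fun x => _) = fun x => complex.Re (f x))//.
  by apply/funext => x; case: (f x) => a b; rewrite conjC_complex.
rewrite (_ : (fun x => _) = fun x => - complex.Im (f x)).
  exact: measurable_funN.
by apply/funext => x; case: (f x) => a b; rewrite conjC_complex.
Qed.

Lemma cmeasurable_cst z : cmeasurable (fun _ : X => z).
Proof. by split; exact: measurable_cst. Qed.

Lemma cmeasurable_cabs f : cmeasurable f -> measurable_fun setT (fun x => cabs (f x)).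
Proof.
move=> [fR fI].
rewrite (_ : (fun x => _) = fun x => Num.sqrt (complex.Re (f x) ^+ 2 + complex.Im (f x) ^+ 2)).
  apply: (measurableT_comp (continuous_measurable_fun (@sqrt_continuous R))).
  by apply: measurable_funD; exact: measurable_funX.
by apply/funext => x; rewrite cabs_sqrt.
Qed.

Lemma cintegrableP f : cintegrable m f <->
  cmeasurable f /\ (\int[m]_x (cabs (f x))%:E < +oo)%E.
Proof.
split=> [[fR fI]|[[mR mI] fi]].
  have mf : cmeasurable f.
    by split; apply/measurable_EFinP; [exact: measurable_int fR|exact: measurable_int fI].
  split=> //; have /integrableP[_ h1] := fR; have /integrableP[_ h2] := fI.
  apply: (@le_lt_trans _ _ (\int[m]_x `|(complex.Re (f x))%:E| +
                            \int[m]_x `|(complex.Im (f x))%:E|)%E); last first.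
    exact: lte_add_pinfty.
  rewrite -ge0_integralD//; last 2 first.
  - apply: measurableT_comp => //; exact: measurable_int fR.
  - apply: measurableT_comp => //; exact: measurable_int fI.
  apply: ge0_le_integral => //.
  - by move=> x _; rewrite lee_fin cabs_ge0.
  - by apply/measurable_EFinP; exact: cmeasurable_cabs.
  - apply: emeasurable_funD; apply: measurableT_comp => //.
      exact: measurable_int fR.
    exact: measurable_int fI.
  - by move=> x _; rewrite -EFinD lee_fin; exact: cabs_le_ReIm.
have mc := cmeasurable_cabs (conj mR mI).
split; apply/integrableP; split; try exact/measurable_EFinP.
  apply: le_lt_trans fi; apply: ge0_le_integral => //.
  - by apply: measurableT_comp => //; exact/measurable_EFinP.
  - exact/measurable_EFinP.
  - by move=> x _; rewrite lee_fin; exact: Re_le_cabs.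
apply: le_lt_trans fi; apply: ge0_le_integral => //.
- by apply: measurableT_comp => //; exact/measurable_EFinP.
- exact/measurable_EFinP.
- by move=> x _; rewrite lee_fin; exact: Im_le_cabs.
Qed.

Lemma cintegralZ z f : cintegrable m f ->
  cintegral m (fun x => z * f x) = z * cintegral m f.
Proof.
move=> [fR fI]; rewrite /cintegral; case: z => a b.
apply/eqP; rewrite eq_complex /=; apply/andP; split; apply/eqP.
- rewrite -!RintegralZl// -RintegralB//; [|exact: (integrableZl measurableT a fR)|exact: (integrableZl measurableT b fI)].
  by apply: eq_Rintegral => x _; case: (f x).
- rewrite -!RintegralZl// -RintegralD//; [|exact: (integrableZl measurableT a fI)|exact: (integrableZl measurableT b fR)].
  by apply: eq_Rintegral => x _; case: (f x).
Qed.

Lemma ae_eq_cintegral f g : cmeasurable f -> cmeasurable g ->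
  {ae m, forall x, f x = g x} -> cintegral m f = cintegral m g.
Proof.
move=> [fR fI] [gR gI] fg; congr Complex; congr fine; apply: ae_eq_integral => //.
- exact/measurable_EFinP.
- exact/measurable_EFinP.
- by apply: filterS fg => x -> _.
- exact/measurable_EFinP.
- exact/measurable_EFinP.
- by apply: filterS fg => x -> _.
Qed.

(** The factor [2] comes from estimating the real and imaginary parts apart. *)
Lemma cabs_cintegral f : cintegrable m f ->
  cabs (cintegral m f) <= 2 * fine (\int[m]_x (cabs (f x))%:E).
Proof.
move=> If; have [mf fi] := (cintegrableP _).1 If; have [fR fI] := If.
have ic : m.-integrable setT (EFin \o (fun x => cabs (f x))).
  apply/integrableP; split; first by apply/measurable_EFinP; exact: cmeasurable_cabs.
  by under eq_integral do rewrite gee0_abs ?lee_fin ?cabs_ge0//.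
apply: (le_trans (cabs_le_ReIm _)); rewrite mulr_natl mulr2n /cintegral /=.
apply: lerD; apply: (le_trans (le_normr_Rintegral _ _)) => //.
- apply: le_Rintegral => //; first exact: (integrable_abse fR).
  by move=> x _; exact: Re_le_cabs.
- apply: le_Rintegral => //; first exact: (integrable_abse fI).
  by move=> x _; exact: Im_le_cabs.
Qed.

(** Absolutely convergent series in [L^1], the dominated convergence theorem
    giving the limit. *)
Lemma summable_Rintegral (v w : nat -> X -> R) :
  (forall i, measurable_fun setT (v i)) -> (forall i, measurable_fun setT (w i)) ->
  (forall i x, `|v i x| <= w i x) ->
  (\int[m]_x (\sum_(i <oo) (w i x)%:E) < +oo)%E ->
  exists2 l : X -> R, m.-integrable setT (EFin \o l) &
    (fun n => \int[m]_x `|(\sum_(i < n) v i x - l x)%:E|)%E @ \oo --> 0%E.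
Proof.
move=> mv mw vw wi.
have w0 i x : 0 <= w i x by exact: le_trans (normr_ge0 _) (vw i x).
pose g x : \bar R := (\sum_(i <oo) (w i x)%:E)%E.
have g0 x : (0 <= g x)%E by apply: nneseries_ge0 => i _ _; rewrite lee_fin.
have mg : measurable_fun setT g.
  apply: ge0_emeasurable_sum => [i x _ _|i _]; first by rewrite lee_fin.
  exact/measurable_EFinP.
have ig : m.-integrable setT g.
  by apply/integrableP; split=> //; under eq_integral do rewrite gee0_abs//.
pose f_ n x : \bar R := (\sum_(i < n) v i x)%:E.
have mf_ n : measurable_fun setT (f_ n).
  by apply/measurable_EFinP; exact: measurable_sum.
pose f x : \bar R := limn_esup (f_ ^~ x).
have mf : measurable_fun setT f by exact: measurable_fun_limn_esup.
have part x n : ((\sum_(i < n) w i x)%:E <= g x)%E.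
  rewrite -sumEFin -(big_mkord xpredT (fun i => (w i x)%:E)).
  by apply: nneseries_lim_ge => i _ _; rewrite lee_fin.
have f_f : {ae m, forall x, setT x -> f_ ^~ x @ \oo --> f x}.
  apply: filterS (integrable_ae measurableT ig) => x /(_ I) gx _.
  have : cvgn [normed series (fun i => v i x)].
    rewrite (_ : [normed series _] = fun n => \sum_(i < n) `|v i x|); last first.
      by apply/funext => n; rewrite /normed_series_of /series /= big_mkord.
    apply: nondecreasing_is_cvgn.
      by apply/nondecreasing_seqP => n; rewrite /= big_ord_recr /= lerDl.
    exists (fine (g x)) => _ [n _ <-]; rewrite /= -lee_fin fineK//.
    by apply: le_trans (part x n); rewrite lee_fin; exact: ler_sum.
  move=> /normed_cvg/cvg_ex[l hl].
  have hl' : f_ ^~ x @ \oo --> l%:E.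
    by apply: cvg_EFin; [exact: nearW|rewrite seriesEord in hl].
  by rewrite /f (cvg_limn_einf_sup hl').2.
have f_g : {ae m, forall x n, setT x -> (`|f_ n x| <= g x)%E}.
  apply: aeW => x n _; apply: le_trans (part x n); rewrite lee_fin.
  by apply: le_trans (ler_norm_sum _ _ _) _; exact: ler_sum.
have [If cf _] := dominated_convergence measurableT mf_ mf f_f ig f_g.
have ff := integrable_ae measurableT If.
have If' : m.-integrable setT (EFin \o (fine \o f)).
  apply: (@le_integrable _ _ _ m setT measurableT _ f) => //.
  - by apply/measurable_EFinP; exact: measurableT_comp.
  - move=> x _ /=; case: (f x) => [r| |] //=; rewrite ?normr0 leey //.
exists (fine \o f) => //.
apply: cvg_trans cf; apply: near_eq_cvg; apply: nearW => n.
apply: ae_eq_integral => //.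
- by apply: measurableT_comp => //; exact: emeasurable_funB.
- apply: measurableT_comp => //; apply/measurable_EFinP; apply: measurable_funB.
    exact: measurable_sum.
  exact: measurableT_comp.
- by apply: filterS ff => x /(_ I) fx _; rewrite -[in LHS](fineK fx).
Qed.

End complex_integral.

Local Open Scope quotient_scope.

Section L1_space.
Context d (X : measurableType d) (R : realType) (m : {measure set X -> \bar R}).
Implicit Types (u v : L1 m) (f g : X -> R[i]).

Lemma L1_cintegrable u : cintegrable m (u : X -> R[i]).
Proof. exact/asboolP/(L1fun_valP (repr u : L1fun m)). Qed.

Lemma L1_ext u v : {ae m, forall x, u x = v x} -> u = v.
Proof. by move=> uv; rewrite -[u]reprK -[v]reprK; apply/L1eqP. Qed.

Lemma toL1_ext f g : {ae m, forall x, f x = g x} -> toL1 m f = toL1 m g.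
Proof.
move=> fg; congr (xget 0 _); apply/seteqP; split => u /= uf.
  by apply: filterS2 uf fg => x -> ->.
by apply: filterS2 uf fg => x -> ->.
Qed.

Lemma toL1_id u : toL1 m u = u.
Proof.
rewrite /toL1; case: xgetP => [v _ /= vu|/(_ u) h]; first exact: L1_ext.
by exfalso; apply: h; exact: aeW.
Qed.

Lemma toL1_cintegrable f : cintegrable m f -> {ae m, forall x, toL1 m f x = f x}.
Proof.
move=> fi; have fP : f \in cintegrable_pred m by exact/asboolP.
pose u : L1 m := \pi_(L1 m) (L1Fun fP).
have uf : {ae m, forall x, u x = f x} by exact: (L1rep_pi (L1Fun fP)).
by rewrite (toL1_ext (g := u)) ?toL1_id//; apply: filterS uf => x ->.
Qed.

Lemma toL1_default f : (forall u, ~ {ae m, forall x, u x = f x}) -> toL1 m f = 0.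
Proof. by move=> h; rewrite /toL1; case: xgetP => // u _ /h. Qed.

Lemma L1repD u v : {ae m, forall x, L1rep (u + v) x = u x + v x}.
Proof. exact: (L1rep_pi (repr u + repr v)). Qed.

Lemma L1repZ z u : {ae m, forall x, L1rep (z *: u) x = z * u x}.
Proof. exact: (L1rep_pi (z *: repr u)). Qed.

Lemma L1rep0 : {ae m, forall x, L1rep (0 : L1 m) x = 0}.
Proof. exact: (L1rep_pi (0 : L1fun m)). Qed.

Lemma L1repN u : {ae m, forall x, L1rep (- u) x = - u x}.
Proof. by rewrite -scaleN1r; apply: filterS (L1repZ (-1) u) => x ->; rewrite mulN1r. Qed.

Definition L1_norm u : R := fine (\int[m]_x (cabs (u x))%:E).

Lemma L1_cmeasurable u : cmeasurable (u : X -> R[i]).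
Proof. by have [] := (cintegrableP m _).1 (L1_cintegrable u). Qed.

Lemma measurable_L1_cabs u : measurable_fun setT (fun x => (cabs (u x))%:E).
Proof. by apply/measurable_EFinP; apply: cmeasurable_cabs; exact: L1_cmeasurable. Qed.

Lemma L1_normE u : (L1_norm u)%:E = (\int[m]_x (cabs (u x))%:E)%E.
Proof.
have [_ ui] := (cintegrableP m _).1 (L1_cintegrable u).
rewrite fineK// ge0_fin_numE//.
by apply: integral_ge0 => x _; rewrite lee_fin cabs_ge0.
Qed.

Lemma L1_norm_ge0 u : 0 <= L1_norm u.
Proof. by apply: fine_ge0; apply: integral_ge0 => x _; rewrite lee_fin cabs_ge0. Qed.

Lemma L1_norm_le (P : X -> \bar R) u : measurable_fun setT P -> (forall x, (0 <= P x)%E) ->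
  {ae m, forall x, ((cabs (u x))%:E <= P x)%E} -> ((L1_norm u)%:E <= \int[m]_x P x)%E.
Proof.
move=> mP P0 uP; rewrite L1_normE; apply: ae_ge0_le_integral => //.
- by move=> x _; rewrite lee_fin cabs_ge0.
- exact: measurable_L1_cabs.
- by apply: filterS uP => x h _.
Qed.

Lemma L1_normD u v : L1_norm (u + v) <= L1_norm u + L1_norm v.
Proof.
rewrite -lee_fin EFinD !L1_normE -ge0_integralD//;
  try exact: measurable_L1_cabs; try by move=> x _; rewrite lee_fin cabs_ge0.
rewrite -L1_normE; apply: L1_norm_le.
- by apply: emeasurable_funD; exact: measurable_L1_cabs.
- by move=> x; apply: adde_ge0; rewrite lee_fin cabs_ge0.
- by apply: filterS (L1repD u v) => x ->; rewrite -EFinD lee_fin cabsD.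
Qed.

Lemma L1_normZ z u : L1_norm (z *: u) = cabs z * L1_norm u.
Proof.
apply: EFin_inj; rewrite EFinM !L1_normE -ge0_integralZl_EFin ?cabs_ge0//; last first.
- exact: measurable_L1_cabs.
- by move=> x _; rewrite lee_fin cabs_ge0.
apply: ge0_ae_eq_integral => //.
- exact: measurable_L1_cabs.
- by apply: measurable_funeM; exact: measurable_L1_cabs.
- by move=> x _; rewrite lee_fin cabs_ge0.
- by move=> x _; rewrite -EFinM lee_fin mulr_ge0 ?cabs_ge0.
- by apply: filterS (L1repZ z u) => x -> _; rewrite cabsM.
Qed.

Lemma L1_norm_eq0 u : L1_norm u = 0 -> u = 0.
Proof.
move=> u0; have : (\int[m]_x `|(cabs (u x))%:E| = 0)%E.
  under eq_integral do rewrite gee0_abs ?lee_fin ?cabs_ge0//.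
  by rewrite -L1_normE u0.
move=> /(ae_eq_integral_abs m measurableT (measurable_L1_cabs u)) h.
apply: L1_ext; apply: filterS2 h L1rep0 => x /(_ I) /= [/eqP].
by rewrite cabs_eq0 => /eqP -> ->.
Qed.

Lemma L1_complete (u : nat -> L1 m) :
  (exists S, forall n, \sum_(i < n) L1_norm (u i) <= S) ->
  exists l, (fun n => L1_norm (\sum_(i < n) u i - l)) @ \oo --> (0 : R).
Proof.
move=> [S hS]; pose w i x := cabs (u i x).
have mw i : measurable_fun setT (w i) by apply: cmeasurable_cabs; exact: L1_cmeasurable.
have wi : (\int[m]_x (\sum_(i <oo) (w i x)%:E) < +oo)%E.
  rewrite integral_nneseries//; last 2 first.
  - by move=> i; exact/measurable_EFinP.
  - by move=> i x _; rewrite lee_fin cabs_ge0.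
  apply: (@le_lt_trans _ _ S%:E); last exact: ltry.
  apply: lime_le.
    by apply: is_cvg_nneseries => i _ _; apply: integral_ge0 => x _; rewrite lee_fin cabs_ge0.
  apply: nearW => n; rewrite big_mkord.
  by under eq_bigr do rewrite -L1_normE; rewrite sumEFin lee_fin.
have mR i : measurable_fun setT (fun x => complex.Re (u i x)) by case: (L1_cmeasurable (u i)).
have mI i : measurable_fun setT (fun x => complex.Im (u i x)) by case: (L1_cmeasurable (u i)).
have [a ia ca] := summable_Rintegral mR mw (fun i x => Re_le_cabs (u i x)) wi.
have [b ib cb] := summable_Rintegral mI mw (fun i x => Im_le_cabs (u i x)) wi.
have li : cintegrable m (fun x => Complex (a x) (b x)) by split.
exists (toL1 m (fun x => Complex (a x) (b x))).
have sumE n : {ae m, forall x, L1rep (\sum_(i < n) u i) x = \sum_(i < n) u i x}.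
  elim: n => [|n IH].
    by rewrite big_ord0; apply: filterS L1rep0 => x ->; rewrite big_ord0.
  rewrite big_ord_recr /=; apply: filterS2 IH (L1repD (\sum_(i < n) u i) (u n)) => x h ->.
  by rewrite h big_ord_recr.
have ReS x n : complex.Re (\sum_(i < n) u i x) = \sum_(i < n) complex.Re (u i x).
  by rewrite raddf_sum.
have ImS x n : complex.Im (\sum_(i < n) u i x) = \sum_(i < n) complex.Im (u i x).
  by rewrite raddf_sum.
have ma : measurable_fun setT a by apply/measurable_EFinP; exact: measurable_int ia.
have mb : measurable_fun setT b by apply/measurable_EFinP; exact: measurable_int ib.
pose A n := (\int[m]_x `|(\sum_(i < n) complex.Re (u i x) - a x)%:E|)%E.
pose B n := (\int[m]_x `|(\sum_(i < n) complex.Im (u i x) - b x)%:E|)%E.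
have mA n : measurable_fun setT (fun x => `|(\sum_(i < n) complex.Re (u i x) - a x)%:E|%E).
  apply: measurableT_comp => //; apply/measurable_EFinP; apply: measurable_funB => //.
  exact: measurable_sum.
have mB n : measurable_fun setT (fun x => `|(\sum_(i < n) complex.Im (u i x) - b x)%:E|%E).
  apply: measurableT_comp => //; apply/measurable_EFinP; apply: measurable_funB => //.
  exact: measurable_sum.
have AB n : ((L1_norm (\sum_(i < n) u i - toL1 m (fun x => Complex (a x) (b x))))%:E <= A n + B n)%E.
  rewrite -ge0_integralD//; apply: L1_norm_le.
  - exact: emeasurable_funD.
  - by move=> x; apply: adde_ge0.
  - have := L1repN (toL1 m (fun x => Complex (a x) (b x))) => hN.
    have hD := L1repD (\sum_(i < n) u i) (- toL1 m (fun x => Complex (a x) (b x))).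
    apply: filterS2 (filterI hD (sumE n)) (filterI hN (toL1_cintegrable li)).
    move=> x [h1 h2] [h3 h4]; rewrite h1 h2 h3 h4 -EFinD lee_fin.
    apply: (le_trans (cabs_le_ReIm _)).
    by rewrite !raddfD /= ReS ImS.
have cAB : (fun n => A n + B n)%E @ \oo --> 0%E.
  by rewrite -[0%E]adde0; apply: cvgeD.
have cN : (fun n => (L1_norm (\sum_(i < n) u i - toL1 m (fun x => Complex (a x) (b x))))%:E) @ \oo --> 0%E.
  apply: (squeeze_cvge _ (cvg_cst 0%E) cAB).
  by apply: nearW => n; rewrite AB lee_fin L1_norm_ge0.
by have /fine_cvgP[_] := cN.
Qed.

End L1_space.

(** * The norm of the twisted algebra *)

Lemma continuous_borel_real (R : realType) (X : ptopologicalType) (f : X -> R) :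
  continuous f -> measurable_fun [set: borel X] (f : borel X -> R).
Proof.
move=> /continuousP cf _; apply: (measurability _ (RGenOpens.measurableE R)) => //.
move=> _ [_ [a [b ->]] <-]; rewrite setTI; apply: open_borel; apply: cf.
exact: interval_open.
Qed.

Section cmeasurable_borel.
Variables (R : realType) (X Y : ptopologicalType).

Lemma cmeasurable_continuous_comp (f : X -> Y) (h : Y -> R[i]) : continuous f ->
  cmeasurable (h : borel Y -> R[i]) -> cmeasurable (fun x : borel X => h (f x)).
Proof.
by move=> cf [hR hI]; split; [exact: (measurableT_comp hR (continuous_borel cf))|
  exact: (measurableT_comp hI (continuous_borel cf))].
Qed.

Lemma cmeasurable_circle (k : X -> circle R) : continuous k ->
  cmeasurable (fun x : borel X => circle_val (k x)).
Proof.
move=> ck; split; apply: continuous_borel_real => x.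
  apply: (@continuous_comp _ _ _ k (fun t : circle R => complex.Re (t : R[i]))).
    exact: ck.
  exact: circle_Re_continuous.
apply: (@continuous_comp _ _ _ k (fun t : circle R => complex.Im (t : R[i]))).
  exact: ck.
exact: circle_Im_continuous.
Qed.

End cmeasurable_borel.

Lemma cabs_circle (R : realType) (t : circle R) : cabs (t : R[i]) = 1.
Proof. by apply: complexI; rewrite -normr_cabs (eqP (circle_valP t)). Qed.

Section twisted_norm.
Variables (R : realType) (G : topologicalGroupType).
Hypothesis hausdorffG : hausdorff_space G.
Variable mu : {measure set (borel G) -> \bar R}.
Hypothesis Hmu : left_haar mu.
Variables (m : G -> R) (c : cocycle R G).

Lemma cocycle_ldiv_continuous x : continuous (fun y : G => c y (y^-1 * x)%g).
Proof.
move=> y; apply: (@continuous_comp _ _ _ (fun y : G => (y, (y^-1 * x)%g))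
  (fun p : G * G => c p.1 p.2)); last exact: cocycle_continuous.
by apply: cvg_pair; [exact: cvg_id|exact: ldivl_continuous].
Qed.

Lemma cmeasurable_twist (f g : L1 mu) x : cmeasurable (fun y : borel G =>
  f y * g (y^-1 * x)%g * circle_val (c y (y^-1 * x)%g)).
Proof.
apply: cmeasurableM; last exact: (cmeasurable_circle (@cocycle_ldiv_continuous x)).
apply: cmeasurableM; first exact: L1_cmeasurable.
exact: (cmeasurable_continuous_comp (@ldivl_continuous G x) (L1_cmeasurable g)).
Qed.

Lemma L1_integral_lty (f : L1 mu) : (\int[mu]_x (cabs (f x))%:E < +oo)%E.
Proof. by rewrite -L1_normE ltry. Qed.

(** [convolution_bound] at the places where it is finite; when the convolution
    is not integrable the default value [0] of [toL1] satisfies the claim. *)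
Lemma L1_norm_tconv_eps (f g : L1 mu) (e : R) : 0 < e ->
  L1_norm (tconv c f g) <= 2 * ((expR 1 * L1_norm f + e) * (expR 1 * L1_norm g + e)).
Proof.
move=> e0.
have mc u : measurable_fun [set: borel G] (fun x : borel G => cabs ((u : L1 mu) x)).
  by apply: cmeasurable_cabs; exact: L1_cmeasurable.
have [P [mP P0 fP iP]] := convolution_bound hausdorffG Hmu (mc f)
  (fun x => cabs_ge0 _) (L1_integral_lty f) (mc g) (fun x => cabs_ge0 _) (L1_integral_lty g) e0.
rewrite -lee_fin EFinM; apply: (@le_trans _ _ (\int[mu]_x (2%:E * P x))%E); last first.
  rewrite ge0_integralZl_EFin//; apply: lee_wpmul2l; first by rewrite lee_fin.
  by apply: (le_trans iP); rewrite [leRHS]EFinM !EFinD !EFinM !L1_normE.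
have P20 x : (0 <= 2%:E * P x)%E by apply: mule_ge0; rewrite ?lee_fin.
have mP2 : measurable_fun setT (fun x => 2%:E * P x)%E by exact: measurable_funeM.
rewrite /tconv; set raw := (fun x : G => cintegral mu _).
have [[u uraw]|nu] := pselect (exists u : L1 mu, {ae mu, forall x, u x = raw x}); last first.
  rewrite toL1_default => [|u ur]; last by apply: nu; exists u.
  apply: L1_norm_le => //; apply: filterS (L1rep0 mu) => x ->.
  by rewrite cabs0.
rewrite -(toL1_ext uraw) toL1_id; apply: L1_norm_le => //.
apply: filterS uraw => x ->.
have [Px|Px] := eqVneq (P x) +oo%E.
  by rewrite Px mulry gtr0_sg// mul1e leey.
have cE y : cabs (f y * g (y^-1 * x)%g * circle_val (c y (y^-1 * x)%g)) =
    cabs (f y) * cabs (g (y^-1 * x)%g).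
  by rewrite !cabsM cabs_circle mulr1.
have iE : (\int[mu]_y (cabs (f y * g (y^-1 * x)%g * circle_val (c y (y^-1 * x)%g)))%:E
    <= P x)%E.
  by under eq_integral do rewrite cE.
have Pfin : P x \is a fin_num by rewrite ge0_fin_numE// lt_neqAle Px leey.
have ci : cintegrable mu (fun y => f y * g (y^-1 * x)%g * circle_val (c y (y^-1 * x)%g)).
  apply/cintegrableP; split; first exact: cmeasurable_twist.
  by apply: (le_lt_trans iE); rewrite -ge0_fin_numE.
rewrite -(fineK Pfin) -EFinM lee_fin; apply: (le_trans (cabs_cintegral ci)).
rewrite ler_wpM2l//; apply: fine_le => //.
rewrite ge0_fin_numE; first by apply: (le_lt_trans iE); rewrite -ge0_fin_numE.
by apply: integral_ge0 => y _; rewrite lee_fin cabs_ge0.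
Qed.

Lemma L1_norm_tconv (f g : L1 mu) :
  L1_norm (tconv c f g) <= 2 * expR 1 ^+ 2 * L1_norm f * L1_norm g.
Proof.
apply/ler_addgt0Pr => e e0.
pose a := expR 1 * L1_norm f; pose b := expR 1 * L1_norm g.
have a0 : 0 <= a by rewrite mulr_ge0 ?expR_ge0 ?L1_norm_ge0.
have b0 : 0 <= b by rewrite mulr_ge0 ?expR_ge0 ?L1_norm_ge0.
pose M := 2 * (a + b + 1); have M0 : 0 < M by rewrite /M; lra.
pose d := Num.min 1 (e / M).
have d0 : 0 < d by rewrite lt_min ltr01 divr_gt0.
have d1 : d <= 1 by rewrite ge_min lexx.
have dM : d * M <= e by rewrite -ler_pdivlMr// ge_min lexx orbT.
apply: (le_trans (L1_norm_tconv_eps f g d0)).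
rewrite (_ : 2 * expR 1 ^+ 2 * _ * _ = 2 * (a * b)); last by rewrite /a /b; ring.
rewrite -/a -/b; apply: (@le_trans _ _ (2 * (a * b) + d * M)); last by lra.
by have := ler_wpM2l (ltW d0) d1; rewrite /M; nra.
Qed.

(** The convolution inequality is only available up to a constant, which is
    absorbed in the norm. *)
Lemma L1_complete_anorm :
  complete_anorm (fun f : L1alg mu m c => 2 * expR 1 ^+ 2 * L1_norm f).
Proof.
set K : R := 2 * expR 1 ^+ 2.
have K0 : 0 < K by rewrite mulr_gt0// exprn_gt0// expR_gt0.
split.
- by move=> f g; rewrite -mulrDr ler_pM2l// L1_normD.
- by move=> z f; rewrite L1_normZ mulrCA.
- by move=> f /eqP; rewrite mulf_eq0 gt_eqF//= => /eqP/L1_norm_eq0.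
- by move=> f g; rewrite -mulrA ler_pM2l// mulrCA mulrA L1_norm_tconv.
- move=> u [S hS]; have [|l hl] := @L1_complete _ _ _ mu u.
    exists (S / K) => n; rewrite ler_pdivlMr// mulrC mulr_sumr; exact: hS.
  by exists l; rewrite -(mulr0 K); apply: cvgM => //; exact: cvg_cst.
Qed.

End twisted_norm.

(** * The twisted algebra as a retract of the algebra of the Mackey group *)

Section ae_lemmas.
Context d (X : measurableType d) (R : realType) (m : {measure set X -> \bar R}).
Implicit Types P Q S : X -> Prop.

Lemma ae_imp P Q : {ae m, forall x, P x} -> (forall x, P x -> Q x) ->
  {ae m, forall x, Q x}.
Proof. by move=> h PQ; apply: filterS h. Qed.

Lemma ae_imp2 P Q S : {ae m, forall x, P x} -> {ae m, forall x, Q x} ->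
  (forall x, P x -> Q x -> S x) -> {ae m, forall x, S x}.
Proof. by move=> h1 h2 PQS; apply: filterS2 h1 h2. Qed.

Lemma ae_and P Q : {ae m, forall x, P x} -> {ae m, forall x, Q x} ->
  {ae m, forall x, P x /\ Q x}.
Proof. by move=> h1 h2; exact: filterI. Qed.

End ae_lemmas.

Lemma cintegralD d (X : measurableType d) (R : realType)
    (m : {measure set X -> \bar R}) (f g : X -> R[i]) :
  cintegrable m f -> cintegrable m g ->
  cintegral m (fun x => f x + g x) = cintegral m f + cintegral m g.
Proof.
move=> [fR fI] [gR gI]; rewrite /cintegral.
apply/eqP; rewrite eq_complex /=; apply/andP; split; apply/eqP.
- by rewrite -RintegralD//; apply: eq_Rintegral => x _; rewrite raddfD.
- by rewrite -RintegralD//; apply: eq_Rintegral => x _; rewrite raddfD.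
Qed.

Lemma cintegrableZ d (X : measurableType d) (R : realType)
    (m : {measure set X -> \bar R}) (z : R[i]) (f : X -> R[i]) :
  cintegrable m f -> cintegrable m (fun x => z * f x).
Proof.
move=> fi; apply/asboolP; apply: (@rpredZ _ _ (cintegrable_pred m) z f).
exact/asboolP.
Qed.

Section mackey_retract.
Variables (R : realType) (G : topologicalGroupType) (c : cocycle R G).
Hypothesis hausdorffG : hausdorff_space G.
Hypothesis lcG : locally_compact [set: G].
Variable mu : {measure set (borel G) -> \bar R}.
Hypothesis Hmu : left_haar mu.
Variable m : G -> R.
Hypothesis Hm : modular_function mu m.
Local Notation T := (circle R).
Local Notation M := (mackey c).
Variable nu : {measure set (borel M) -> \bar R}.
Hypothesis Hnu : left_haar nu.
Variable lam : {finite_measure set (borel T) -> \bar R}.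
Hypothesis lam1 : lam setT = 1%E.
Hypothesis rect : forall (A : set (borel G)) (B : set (borel T)),
  measurable A -> measurable B -> (mu A < +oo)%E ->
  nu (A `*` B) = (mu A * lam B)%E.
Variable mc : M -> R.
Hypothesis Hmc : modular_function nu mc.

Let A := L1alg mu m c.
Let A' := L1alg nu mc (trivial_cocycle R M).

Let fubini_nu F := @fubini_mackey R G c hausdorffG lcG mu Hmu nu Hnu lam rect F.

Lemma cfubini (F : M -> R[i]) : cintegrable nu F ->
  [/\ {ae mu, forall x, cintegrable lam (fun t => F (x, t))},
      cintegrable mu (fun x => cintegral lam (fun t => F (x, t))) &
      cintegral nu F = cintegral mu (fun x => cintegral lam (fun t => F (x, t)))].
Proof.
move=> [FR FI]; have [aR iR eR] := fubini_nu FR; have [aI iI eI] := fubini_nu FI.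
have fin_int (H : borel G -> \bar R) : mu.-integrable setT H ->
    mu.-integrable setT (EFin \o (fine \o H)) /\
    (\int[mu]_x H x = \int[mu]_x (fine (H x))%:E)%E.
  move=> iH; have mH : measurable_fun setT H by exact: measurable_int iH.
  have mf : measurable_fun setT (EFin \o (fine \o H)).
    by apply/measurable_EFinP; exact: measurableT_comp.
  split.
    apply: (@le_integrable _ _ _ mu setT measurableT _ H) => //.
    by move=> x _ /=; case: (H x) => [r| |] //=; rewrite ?normr0 leey.
  apply: ae_eq_integral => //.
  by apply: (ae_imp (integrable_ae measurableT iH)) => x /(_ I) Hx _; rewrite /= fineK.
have [iR' eR'] := fin_int _ iR; have [iI' eI'] := fin_int _ iI.
split.
- by apply: (ae_imp2 aR aI) => x.
- by split.
- rewrite /cintegral /Rintegral eR eI eR' eI'; exact: erefl.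
Qed.

Lemma cmeasurable_fst (h : G -> R[i]) : cmeasurable (h : borel G -> R[i]) ->
  cmeasurable (fun p : borel M => h p.1).
Proof. exact: (cmeasurable_continuous_comp (@mackey_fst_continuous R G c)). Qed.

Lemma cmeasurable_snd : cmeasurable (fun p : borel M => circle_val p.2).
Proof. exact: (cmeasurable_circle (@mackey_snd_continuous R G c)). Qed.

Lemma cmeasurable_section (F : M -> R[i]) x : cmeasurable (F : borel M -> R[i]) ->
  cmeasurable (fun t : borel T => F (x, t)).
Proof.
exact: (@cmeasurable_continuous_comp R T M (fun t => (x, t)) F (@pairr_continuous G T x)).
Qed.

Lemma cmeasurable_character : cmeasurable (fun t : borel T => circle_val t).
Proof. by apply: (cmeasurable_circle (k := fun t : T => t)) => t U. Qed.

(** The functions on the Mackey group that transform under the central circle by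
    its identity character form a copy of the functions on [G]; the projection
    onto them is given by a Fourier coefficient. *)
Definition equivariant (f : G -> R[i]) (p : M) : R[i] := circle_val p.2 * f p.1.

Definition first_coefficient (F : M -> R[i]) (x : G) : R[i] :=
  cintegral lam (fun t => F (x, t) * (circle_val t)^*).

Lemma cabs_equivariant f p : cabs (equivariant f p) = cabs (f p.1).
Proof. by rewrite cabsM cabs_circle mul1r. Qed.

Lemma cmeasurable_equivariant f : cmeasurable (f : borel G -> R[i]) ->
  cmeasurable (equivariant f : borel M -> R[i]).
Proof. by move=> mf; apply: cmeasurableM; [exact: cmeasurable_snd|exact: cmeasurable_fst]. Qed.

Lemma integral_cabs_fst (f : G -> R[i]) : cintegrable mu f ->
  (\int[nu]_p (cabs (f p.1))%:E = \int[mu]_x (cabs (f x))%:E)%E.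
Proof.
move=> /cintegrableP[mf fi].
have fi' : mu.-integrable setT (EFin \o (fun x => cabs (f x))).
  apply/integrableP; split; first by apply/measurable_EFinP; exact: cmeasurable_cabs.
  by under eq_integral do rewrite gee0_abs ?lee_fin ?cabs_ge0//.
have := integral_mackey_fst hausdorffG lcG Hmu lam1 rect fi'.
under eq_integral do rewrite ger0_norm ?cabs_ge0//.
by under [X in _ = X -> _]eq_integral do rewrite ger0_norm ?cabs_ge0//.
Qed.

Lemma equivariant_cintegrable f : cintegrable mu f -> cintegrable nu (equivariant f).
Proof.
move=> fi; have [mf fi'] := (cintegrableP mu f).1 fi.
apply/cintegrableP; split; first exact: cmeasurable_equivariant.
by under eq_integral do rewrite cabs_equivariant; rewrite integral_cabs_fst.
Qed.

Lemma ae_fst (P : G -> Prop) : {ae mu, forall x, P x} -> {ae nu, forall p, P p.1}.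
Proof. by move=> /(negligible_mackey_fst rect). Qed.

Lemma cintegrable_circle_twist F (k : M -> R[i]) : cintegrable nu F ->
  cmeasurable (k : borel M -> R[i]) -> (forall p, cabs (k p) = 1) ->
  cintegrable nu (fun p => F p * k p).
Proof.
move=> /cintegrableP[mF Fi] mk k1; apply/cintegrableP; split; first exact: cmeasurableM.
by under eq_integral do rewrite cabsM k1 mulr1.
Qed.

Lemma cintegrable_conj_snd F : cintegrable nu F ->
  cintegrable nu (fun p : M => F p * (circle_val p.2)^*).
Proof.
move=> Fi; apply: cintegrable_circle_twist => //.
  by apply: cmeasurable_conj; exact: cmeasurable_snd.
by move=> p; rewrite cabs_conj cabs_circle.
Qed.

Lemma first_coefficient_cintegrable F : cintegrable nu F ->
  cintegrable mu (first_coefficient F).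
Proof. by move=> /cintegrable_conj_snd/cfubini[]. Qed.

Lemma first_coefficient_ae F F' : cmeasurable (F : borel M -> R[i]) ->
  cmeasurable (F' : borel M -> R[i]) -> {ae nu, forall p, F p = F' p} ->
  {ae mu, forall x, first_coefficient F x = first_coefficient F' x}.
Proof.
move=> mF mF' /(ae_mackey_section hausdorffG lcG Hmu Hnu rect) h.
have mS H x : cmeasurable (H : borel M -> R[i]) ->
    cmeasurable (fun t : borel T => H (x, t) * (circle_val t)^*).
  move=> mH; apply: cmeasurableM; first exact: cmeasurable_section.
  by apply: cmeasurable_conj; exact: cmeasurable_character.
apply: (ae_imp h) => x hx; apply: ae_eq_cintegral; [exact: mS|exact: mS|].
by apply: (ae_imp hx) => t ->.
Qed.

Lemma first_coefficient_equivariant f x : first_coefficient (equivariant f) x = f x.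
Proof.
rewrite /first_coefficient (_ : (fun t => _) = fun=> f x); last first.
  by apply/funext => t; rewrite /equivariant /= mulrAC (mulrC (circle_val t)) circleVM mul1r.
rewrite /cintegral !Rintegral_cst//.
transitivity (Complex (complex.Re (f x) * 1) (complex.Im (f x) * 1)).
  by congr Complex; congr (_ * _); exact: (congr1 fine lam1).
by rewrite !mulr1; case: (f x).
Qed.

Definition L1_equivariant (f : A) : A' := toL1 nu (equivariant (f : L1 mu)).
Definition L1_coefficient (F : A') : A := toL1 mu (first_coefficient (F : L1 nu)).

Lemma L1_equivariantE (f : A) :
  {ae nu, forall p, L1rep (L1_equivariant f : L1 nu) p = equivariant (f : L1 mu) p}.
Proof. by apply: toL1_cintegrable; apply: equivariant_cintegrable; exact: L1_cintegrable. Qed.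

Lemma L1_coefficientE (F : A') :
  {ae mu, forall x, L1rep (L1_coefficient F : L1 mu) x = first_coefficient (F : L1 nu) x}.
Proof. by apply: toL1_cintegrable; apply: first_coefficient_cintegrable; exact: L1_cintegrable. Qed.

(** Valid for every function [h]: if [equivariant h] agrees almost everywhere
    with an integrable function, so does [h], by taking the coefficient. *)
Lemma toL1_equivariant (h : G -> R[i]) :
  toL1 nu (equivariant h) = L1_equivariant (toL1 mu h).
Proof.
have [[u uh]|nh] := pselect (exists u : L1 mu, {ae mu, forall x, u x = h x}).
  rewrite -(toL1_ext uh) toL1_id; apply: toL1_ext.
  by apply: (ae_imp (ae_fst uh)) => p; rewrite /equivariant => ->.
have -> : toL1 mu h = 0 by apply: toL1_default => u ur; apply: nh; exists u.
have -> : L1_equivariant 0 = 0.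
  rewrite -(toL1_id (0 : L1 nu)); apply: toL1_ext.
  apply: (ae_imp2 (ae_fst (L1rep0 mu)) (L1rep0 nu)) => p; rewrite /equivariant => -> ->.
  by rewrite mulr0.
apply: toL1_default => F FE; apply: nh.
exists (toL1 mu (first_coefficient F)).
have /(ae_mackey_section hausdorffG lcG Hmu Hnu rect) FE' := FE.
have Fi := L1_cintegrable F.
apply: (ae_imp2 (toL1_cintegrable (first_coefficient_cintegrable Fi)) FE') => x -> hx.
have [mF _] := (cintegrableP nu _).1 Fi.
rewrite -[RHS](first_coefficient_equivariant h x); apply: ae_eq_cintegral.
- apply: cmeasurableM; first exact: cmeasurable_section.
  by apply: cmeasurable_conj; exact: cmeasurable_character.
- apply: cmeasurableM.
    by apply: cmeasurableM; [exact: cmeasurable_character|exact: (cmeasurable_cst _ (h x))].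
  by apply: cmeasurable_conj; exact: cmeasurable_character.
- by apply: (ae_imp hx) => t ->.
Qed.

Lemma L1_equivariantK (f : A) : L1_coefficient (L1_equivariant f) = f.
Proof.
rewrite -[RHS](toL1_id (f : L1 mu)); apply: toL1_ext.
have h := first_coefficient_ae (L1_cmeasurable (L1_equivariant f : L1 nu))
  (cmeasurable_equivariant (L1_cmeasurable (f : L1 mu))) (L1_equivariantE f).
by apply: (ae_imp h) => x ->; rewrite first_coefficient_equivariant.
Qed.

Lemma L1_equivariant_linear : linear L1_equivariant.
Proof.
move=> z f g; apply: L1_ext.
have h1 := ae_and (L1_equivariantE (z *: f + g)) (ae_fst (L1repD (z *: f : L1 mu) g)).
have h2 := ae_and (ae_fst (L1repZ z (f : L1 mu))) (L1_equivariantE f).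
have h3 := ae_and (L1_equivariantE g) (L1repD (z *: (L1_equivariant f : L1 nu)) (L1_equivariant g)).
have h4 := L1repZ z (L1_equivariant f : L1 nu).
apply: (ae_imp2 (ae_and h1 h2) (ae_and h3 h4)) => p [[e1 e2] [e3 e4]] [[e5 e6] e7].
rewrite e6 e7 e5 e4 e1 /equivariant e2 e3; ring.
Qed.

Lemma L1_coefficient_linear : linear L1_coefficient.
Proof.
move=> z F F'; apply: L1_ext.
have iF := L1_cintegrable (F : L1 nu); have iF' := L1_cintegrable (F' : L1 nu).
have [aF _ _] := cfubini (cintegrable_conj_snd iF).
have [aF' _ _] := cfubini (cintegrable_conj_snd iF').
have mzF : cmeasurable (fun p : borel M => z * L1rep (F : L1 nu) p + L1rep (F' : L1 nu) p).
  rewrite (_ : (fun p => _) = fun p => z * L1rep (F : L1 nu) p - (-1) * L1rep (F' : L1 nu) p).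
    apply: cmeasurableB; apply: cmeasurableM; try exact: cmeasurable_cst; exact: L1_cmeasurable.
  by apply/funext => p; rewrite mulN1r opprK.
have e0 : {ae nu, forall p, L1rep (z *: F + F' : L1 nu) p =
    z * L1rep (F : L1 nu) p + L1rep (F' : L1 nu) p}.
  by apply: (ae_imp2 (L1repD (z *: F : L1 nu) F') (L1repZ z (F : L1 nu))) => p -> ->.
have h1 := first_coefficient_ae (L1_cmeasurable (z *: F + F' : L1 nu)) mzF e0.
have h2 := ae_and (L1_coefficientE (z *: F + F')) (L1_coefficientE F).
have h3 := ae_and (L1_coefficientE F') (L1repD (z *: (L1_coefficient F : L1 mu)) (L1_coefficient F')).
have h4 := ae_and (L1repZ z (L1_coefficient F : L1 mu)) (ae_and aF aF').
apply: (ae_imp2 (ae_and h1 h2) (ae_and h3 h4)) => x [e1 [e2 e3]] [[e4 e5] [e6 [e7 e8]]].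
rewrite e5 e6 e4 e3 e2 e1 /first_coefficient -(cintegralZ z e7) -cintegralD//; last exact: cintegrableZ.
by congr cintegral; apply/funext => t; rewrite mulrDl mulrA.
Qed.


(** In the Mackey group, [p^-1 (x, t)] has the second coordinate
    [t conj(s) c(y, y^-1 x)] where [p = (y, s)]. *)
Lemma equivariant_ldiv (g : G -> R[i]) (p q : M) :
  equivariant g (p^-1 * q)%g = circle_val q.2 * ((circle_val p.2)^* *
    (g (p.1^-1 * q.1)%g * circle_val (c p.1 (p.1^-1 * q.1)%g))).
Proof.
case: p q => [y s] [x t]; rewrite /equivariant /=.
have E : (circle_val (c y y^-1%g) * (circle_val (c y^-1%g x))^* =
    circle_val (c y (y^-1 * x)%g)).
  have := cocycle_eq c y y^-1%g x; rewrite mulgV cocycle1x mulg1.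
  move=> /(congr1 (@circle_val R)) /= ->.
  by rewrite -mulrA (mulrC (circle_val (c y^-1%g x))) circleVM mulr1.
by rewrite -E; ring.
Qed.

Lemma equivariant_inv (f : G -> R[i]) (q : M) :
  equivariant f q^-1%g = (circle_val q.2)^* * (circle_val (c q.1 (q.1)^-1%g) * f (q.1)^-1%g).
Proof. by case: q => [x t]; rewrite /equivariant /= mulrA. Qed.

Lemma ae_inv (P : M -> Prop) : {ae nu, forall p, P p} -> {ae nu, forall p, P p^-1%g}.
Proof.
exact: (haar_inv_null (@mackey_hausdorff R G c hausdorffG)
  (@mackey_locally_compact R G c hausdorffG lcG) Hnu).
Qed.

Lemma ae_ldiv (P : M -> Prop) q : {ae nu, forall p, P p} ->
  {ae nu, forall p, P (p^-1 * q)%g}.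
Proof.
move=> /ae_inv [N [mN N0 PN]]; exists [set p | N (q^-1 * p)%g]; split.
- rewrite -[X in measurable X]setTI.
  by apply: (continuous_borel (@mulgl_continuous M q^-1%g)).
- exact: etrans (haar_transl Hnu q mN) N0.
- by move=> p nP; apply: PN => /=; rewrite invgM invgK.
Qed.

(** Convolution integrals over the Mackey group can be computed by integrating
    first over the circle, where the coefficient of [F] appears. [ae_ldiv] allows
    to replace the representative of [L1_equivariant g], and the convolution
    inequality in the Mackey group provides the integrability. *)
Lemma amul_equivariant (F : A') (g : A) :
  amul F (L1_equivariant g) = L1_equivariant (amul (L1_coefficient F) g).
Proof.
rewrite -[RHS]toL1_equivariant; apply: toL1_ext.
pose f0 := L1rep (F : L1 nu); pose g0 := L1rep (g : L1 mu).
have iF : cintegrable nu f0 by exact: L1_cintegrable.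
have ig : cintegrable mu g0 by exact: L1_cintegrable.
have [mF Fi] := (cintegrableP nu f0).1 iF; have [mg gi] := (cintegrableP mu g0).1 ig.
have ae_fin : {ae nu, forall q, (\int[nu]_p (cabs (f0 p) * cabs (g0 (p^-1 * q)%g.1))%:E < +oo)%E}.
  apply: (convolution_ae_fin (@mackey_hausdorff R G c hausdorffG) Hnu
    (f := fun p => cabs (f0 p)) (g := fun p : M => cabs (g0 p.1))).
  - exact: cmeasurable_cabs.
  - by move=> p; exact: cabs_ge0.
  - exact: Fi.
  - by apply: cmeasurable_cabs; exact: cmeasurable_fst.
  - by move=> p; exact: cabs_ge0.
  - by rewrite integral_cabs_fst.
apply: (ae_imp ae_fin) => -[x t] fin.
pose k (y : G) : R[i] := g0 (y^-1 * x)%g * circle_val (c y (y^-1 * x)%g).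
have mk : cmeasurable (k : borel G -> R[i]).
  apply: cmeasurableM; last exact: (cmeasurable_circle (cocycle_ldiv_continuous (c := c) (x := x))).
  exact: (cmeasurable_continuous_comp (@ldivl_continuous G x) mg).
pose Phi (p : M) : R[i] := f0 p * (circle_val p.2)^* * k p.1.
have mPhi : cmeasurable (Phi : borel M -> R[i]).
  apply: cmeasurableM; last exact: cmeasurable_fst.
  by apply: cmeasurableM => //; apply: cmeasurable_conj; exact: cmeasurable_snd.
have iPhi : cintegrable nu Phi.
  apply/cintegrableP; split=> //; apply: le_lt_trans fin.
  rewrite le_eqVlt; apply/orP; left; apply/eqP; apply: eq_integral => p _.
  by rewrite /Phi /k !cabsM cabs_conj !cabs_circle !mulr1.
transitivity (cintegral nu (fun p : M => circle_val t * Phi p)).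
  apply: ae_eq_cintegral.
  - apply: cmeasurableM; last exact: (cmeasurable_cst _ 1).
    apply: cmeasurableM => //.
    apply: (cmeasurable_continuous_comp (@ldivl_continuous M (x, t))).
    exact: L1_cmeasurable.
  - by apply: cmeasurableM => //; exact: (cmeasurable_cst _ (circle_val t)).
  - apply: (ae_imp (ae_ldiv (x, t) (L1_equivariantE g))) => p ->.
    rewrite equivariant_ldiv (_ : circle_val (trivial_cocycle R M _ _) = 1)// mulr1.
    by rewrite /Phi /k /= -!mulrA mulrCA.
rewrite cintegralZ// /equivariant /=; congr (_ * _).
have [aPhi i1 ->] := cfubini iPhi.
have [aF _ _] := cfubini (cintegrable_conj_snd iF).
apply: ae_eq_cintegral.
- by have [] := (cintegrableP mu _).1 i1.
- by apply: cmeasurable_twist.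
apply: (ae_imp2 aF (L1_coefficientE F)) => y ay ->.
rewrite -mulrA [RHS]mulrC /first_coefficient -(cintegralZ _ ay).
by congr cintegral; apply/funext => s; rewrite mulrC.
Qed.

(** Right translation by [(x, t)] maps [K * T] onto [K x * T]. *)
Lemma modular_mackey (q : M) : mc q = m q.1.
Proof.
have [K cK K1] := compact_nbhs1 lcG.
have mK : measurable (K : set (borel G)) by exact: compact_borel.
have Kfin : (mu K < +oo)%E := left_haar_compact Hmu cK.
have K0 : (0 < mu K)%E.
  move: K1; rewrite nbhsE => -[U [oU U1] UK].
  apply: (lt_le_trans (haar_open_gt0 hausdorffG Hmu oU U1)).
  by apply: haar_le => //; exact: open_borel.
case: q => x t; have [_ /(_ (K `*` [set: T]))] := Hmc (x, t).
have [mx /(_ K mK) eK] := Hm x.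
have mKT : measurable (K `*` [set: T] : set (borel M)).
  by apply: prod_mackey_borel; exact: measurableX.
have E : [set ((p : M) * ((x, t) : M))%g | p in (K `*` [set: T] : set M)] =
    [set (y * x)%g | y in K] `*` [set: T].
  apply/seteqP; split=> [_ [[y s] [/= Ky _] <-]|[_ s] [/= [y Ky <-] _]].
    by split=> //=; exists y.
  exists (y, (s * c y x * t^-1)%g) => //; congr pair => /=.
  apply: val_inj => /=; rewrite -(mulrA _ (circle_val t)^*) circleVM mulr1.
  by rewrite -mulrA (mulrC (circle_val (c y x))) circleVM mulr1.
move=> /(_ mKT) h; move: (etrans (congr1 nu (esym E)) h) => {h}.
have mKx : measurable ([set (y * x)%g | y in K] : set (borel G)).
  by rewrite image_mulgr -[X in measurable X]setTI; exact: (continuous_borel (@mulgr_continuous G x^-1%g)).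
have Kxfin : (mu [set (y * x)%g | y in K] < +oo)%E.
  by rewrite eK -ge0_fin_numE ?mule_ge0 ?lee_fin ?(ltW mx)// fin_numM// ge0_fin_numE.
have lT : lam [set: T] = 1%E by exact: lam1.
have r1 := rect mKx (measurableT : measurable ([set: borel T])) Kxfin.
have r2 := rect mK (measurableT : measurable ([set: borel T])) Kfin.
rewrite r1 r2 lam1 !mule1 eK.
have Kf : mu K \is a fin_num by rewrite ge0_fin_numE.
rewrite -(fineK Kf) -!EFinM => -[] /mulIf h; apply/esym/h.
by rewrite gt_eqF// -lte_fin fineK.
Qed.

(** The representative is evaluated at [q^-1], which is harmless because inversion
    preserves null sets. *)
Lemma astar_equivariant (f : A) :
  astar (L1_equivariant f) = L1_equivariant (astar f).
Proof.
rewrite -[RHS]toL1_equivariant; apply: toL1_ext.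
apply: (ae_imp (ae_inv (L1_equivariantE f))) => q ->.
rewrite equivariant_inv modular_mackey /equivariant /= mul1r !rmorphM /= conjCK.
by case: q => [x t] /=; ring.
Qed.

Definition equivariant_lin : {linear A -> A'} :=
  HB.pack L1_equivariant (GRing.isLinear.Build _ _ _ _ _ L1_equivariant_linear).
Definition coefficient_lin : {linear A' -> A} :=
  HB.pack L1_coefficient (GRing.isLinear.Build _ _ _ _ _ L1_coefficient_linear).

End mackey_retract.

(** * Symmetry of the twisted algebra *)

(** In a unital algebra, [x] inverts [b - z e] exactly when [x + z^-1 e - z^-1 1]
    inverts [b - z 1] in the unitization. *)
Lemma unitization_inverse (R : realType) (A : starAlg R) (b : A) (z : R[i]) :
  star_axioms A -> z != 0 -> ~ spectrum (@amul R A) b z ->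
  ainvertible (unitization_mul (@amul R A)) (0, 1) (b, - z).
Proof.
move=> HA z0 nb; have [[e he]|ne] := pselect (exists e, is_unity (@amul R A) e); last first.
  by apply: contrapT => h; apply: nb; right.
have [x [xl xr]] : ainvertible (@amul R A) e (b - z *: e).
  by apply: contrapT => h; apply: nb; left; exists e.
have zz : z * z^-1 = 1 by rewrite divff.
rewrite (amulBl HA) (amulZl HA) (he x).1 in xl.
rewrite (amulBr HA) (amulZr HA) (he x).2 in xr.
exists (x + z^-1 *: e, - z^-1); split; rewrite /unitization_mul /=; congr pair.
- rewrite (amulDr HA) (amulZr HA) (he b).2 !scaleNr scalerDr scalerA zz scale1r.
  by rewrite addrK opprD addrA xl subrr.
- by rewrite mulrNN.
- rewrite (amulDl HA) (amulZl HA) (he b).1 !scaleNr scalerDr scalerA zz scale1r opprD.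
  by rewrite addrACA xr addrCA subrr addr0 subrr.
- by rewrite mulrNN mulVf.
Qed.

Section symmetric_retract.
Variables (R : realType) (A A' : starAlg R).
Variables (j : {linear A -> A'}) (Q : {linear A' -> A}).
Hypothesis jK : cancel j Q.
Hypothesis mulj : forall F g, amul F (j g) = j (amul (Q F) g).
Hypothesis starj : forall f, astar (j f) = j (astar f).
Hypothesis HA' : star_axioms A'.

(** Apply [Q], extended to the unitizations, to an inverse in [A']. *)
Lemma symmetric_retract : symmetric_alg A' -> forall (a : A) (z : R[i]),
  ~~ (0 <= z) ->
  ainvertible (unitization_mul (@amul R A)) (0, 1) (amul (astar a) a, - z).
Proof.
move=> sym a z z0; have zn0 : z != 0 by apply: contraNneq z0 => ->.
have E : amul (astar (j a)) (j a) = j (amul (astar a) a) by rewrite mulj starj jK.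
have [|[F s] [h1 h2]] := unitization_inverse (b := j (amul (astar a) a)) HA' zn0.
  by rewrite -E => /sym; apply/negP.
exists (Q F, s); have QM := retractM jK mulj starj HA'.
move: h1 h2; rewrite /unitization_mul /= => -[/(congr1 Q) h1 s1] [/(congr1 Q) h2 s2].
rewrite !linearD !linearZZ !QM jK linear0 in h1 h2.
by split; congr pair.
Qed.

End symmetric_retract.

Theorem theorem1 (R : realType) (G : topologicalGroupType)
    (hausdorffG : hausdorff_space G) (lcG : locally_compact [set: G])
    (c : cocycle R G)
    (mu : {measure set (borel G) -> \bar R}) (haar_mu : left_haar mu)
    (m : G -> R) (modular_m : modular_function mu m)
    (nu : {measure set (borel (mackey c)) -> \bar R})
    (haar_nu : mackey_haar mu nu)
    (mc : mackey c -> R) (modular_mc : modular_function nu mc) :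
  let L1_mackey := L1alg nu mc (trivial_cocycle R (mackey c)) in
  let L1_twisted := L1alg mu m c in
  (cstar_unique L1_mackey -> cstar_unique L1_twisted) /\
  (symmetric_alg L1_mackey -> cstar_unique L1_mackey ->
   forall (H : hilbertType R) (pi : starRep L1_twisted H), injective pi ->
     (forall f : L1_twisted, opnorm (pi f) = max_norm f) /\
     (forall f : L1_twisted,
        spectrum (@amul R L1_twisted) f = spectrum (@bop_comp R H) (pi f))).
Proof.
move=> L1_mackey L1_twisted.
have [Hnu [lam0 [_ lam01 rect0]]] := haar_nu.
have lamfin : (lam0 setT < +oo)%E by rewrite lam01 ltry.
pose lam : {finite_measure set (borel (circle R)) -> \bar R} := mfrestr measurableT lamfin.
have lamE B : lam B = lam0 B by rewrite /lam /= /mfrestr /mrestr setIT.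
have lam1 : lam setT = 1%E by rewrite lamE.
have rect (A : set (borel G)) (B : set (borel (circle R))) :
    measurable A -> measurable B -> (mu A < +oo)%E -> nu (A `*` B) = (mu A * lam B)%E.
  by rewrite lamE; exact: rect0.
pose j : {linear L1_twisted -> L1_mackey} :=
  equivariant_lin hausdorffG lcG haar_mu m lam1 rect mc.
pose Q : {linear L1_mackey -> L1_twisted} :=
  coefficient_lin hausdorffG lcG haar_mu m Hnu rect mc.
have jK : cancel j Q := L1_equivariantK hausdorffG lcG haar_mu Hnu lam1 rect mc.
have mulj F g : amul F (j g) = j (amul (Q F) g) :=
  amul_equivariant hausdorffG lcG haar_mu Hnu lam1 rect F g.
have starj f : astar (j f) = j (astar f) :=
  astar_equivariant hausdorffG lcG haar_mu modular_m Hnu lam1 rect modular_mc f.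
have unique_A : cstar_unique L1_mackey -> cstar_unique L1_twisted.
  move=> HU; have [H [pi pi_inj]] := HU.1.
  exact: (cstar_unique_retract jK mulj starj (faithful_star_axioms pi_inj) HU).
split=> // sym HU H pi pi_inj; have HU_A := unique_A HU.
have [H' [pi' pi'_inj]] := HU.1; have HA' := faithful_star_axioms pi'_inj.
have HA := retract_star_axioms jK mulj starj HA'.
split=> f; first by have [_ [_ /(_ _ (opnorm_cstar_norm pi_inj)) <-]] := HU_A.
have Hnrm := L1_complete_anorm hausdorffG haar_mu m c.
have [n Hn pi_n] := symmetric_norm Hnrm pi_inj HA.
apply: (spectral_invariance (HA := HA) pi_inj Hn pi_n) => h hh.
exact: (symmetric_spr_opnorm Hnrm pi_inj HU_A (symmetric_retract jK mulj starj HA' sym) HA hh).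
Qed.
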